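(* Let $\mathbf k$ be a field of characteristic zero and let $(A,\partial,\bar\partial)$ be a bidifferential bigraded algebra over $\mathbf k$. (1) There is a contraction $(f,g,h)$ of the underlying bicomplex of $A$ into a minimal bicomplex $(H,\partial,\bar\partial)$, i.e. one with $\partial\bar\partial=0$ on $H$ (here $f\colon A\to H$, $g\colon H\to A$, $h\colon A\to A$). (2) There is a pluripotential $A_\infty$-algebra structure on the bicomplex $(H,\partial,\bar\partial)$ and a pluripotential $\infty$-weak equivalence $H\rightsquigarrow A$.
   Context: A bicomplex is a bigraded $\mathbf k$-vector space $A=\bigoplus_{p,q\in\mathbb Z}A^{p,q}$ with linear maps $\partial$ of bidegree $(1,0)$ and $\bar\partial$ of bidegree $(0,1)$ with $\partial^2=\bar\partial^2=\partial\bar\partial+\bar\partial\partial=0$; morphisms are bidegree-preserving linear maps commuting with both. Signs follow the Koszul rule for total degree; tensor powers carry the Leibniz differentials; for a linear map $\phi$ of total degree $|\phi|$, $[\partial,\phi]=\partial\phi-(-1)^{|\phi|}\phi\partial$ and likewise for $\bar\partial$. $H_{BC}=\frac{\ker\partial\cap\ker\bar\partial}{\operatorname{Im}\partial\bar\partial}$, $H_A=\frac{\ker\partial\bar\partial}{\operatorname{Im}\partial+\operatorname{Im}\bar\partial}$; a pluripotential weak equivalence is a morphism of bicomplexes inducing isomorphisms on both. A bidifferential bigraded algebra is a bicomplex with an associative product of bidegree $(0,0)$ for which $\partial,\bar\partial$ are derivations. A contraction of a bicomplex $A$ into a bicomplex $B$ consists of morphisms of bicomplexes $f\colon A\to B$,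 $g\colon B\to A$ and a linear map $h\colon A\to A$ of bidegree $(-1,-1)$ with $fg=\mathrm{id}_B$ and $gf-\mathrm{id}_A=[\partial,[\bar\partial,h]]$. A pluripotential $A_\infty$-algebra is a bicomplex $(A,\partial,\bar\partial)$ with linear maps $\mu_n^{p,q}\colon A^{\otimes n}\to A$ of bidegree $(p,q)$, $n\ge2$, which are zero unless ($p+q=2-n$ and $p,q\le0$) or ($p+q=1-n$ and $p,q\le-1$), such that $$[\partial,\mu_n^{p,q}]=q\mu_n^{p+1,q}+\sum_{\substack{k+\ell=n+1\\ 1\le i\le k}}\ \sum_{\substack{p_1+p_2=p+1\\ q_1+q_2=q}}(-1)^{i(\ell+1)+n+\varepsilon}\mu_k^{p_1,q_1}(\mathrm{id}^{\otimes i-1}\otimes\mu_\ell^{p_2,q_2}\otimes\mathrm{id}^{\otimes k-i}),$$ $$[\bar\partial,\mu_n^{p,q}]=-p\mu_n^{p,q+1}+\sum_{\substack{k+\ell=n+1\\ 1\le i\le k}}\ \sum_{\substack{p_1+p_2=p\\ q_1+q_2=q+1}}(-1)^{i(\ell+1)+n+\varepsilon}\mu_k^{p_1,q_1}(\mathrm{id}^{\otimes i-1}\otimes\mu_\ell^{p_2,q_2}\otimes\mathrm{id}^{\otimes k-i}),$$ with $k,\ell\ge2$ and $\varepsilon=(p_1+q_1)(\ell+p_2+q_2)+(p+q+n)$. A bidifferential bigraded algebra is a pluripotential $A_\infty$-algebra with $\mu_n^{p,q}=0$ for $n\ge3$. A pluripotential $\infty$-morphism $f\colon(A,\mu)\rightsquigarrow(B,\nu)$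 is a family of linear maps $f_n^{p,q}\colon A^{\otimes n}\to B$, $n\ge1$, of bidegree $(p,q)$, zero unless ($p+q=1-n$ and $p,q\le0$) or ($p+q=-n$ and $p,q\le-1$), such that $$[\partial,f_n^{p,q}]=qf_n^{p+1,q}-\sum_{i_1+\cdots+i_k=n}\ \sum(-1)^{\theta+\varepsilon_1}\nu_k^{p_0,q_0}(f_{i_1}^{p_1,q_1}\otimes\cdots\otimes f_{i_k}^{p_k,q_k})-\sum_{\substack{k+\ell=n+1\\ r+s+1=k}}\ \sum(-1)^{r(1+\ell)+k+\varepsilon_2}f_k^{p_1,q_1}(\mathrm{id}^{\otimes r}\otimes\mu_\ell^{p_2,q_2}\otimes\mathrm{id}^{\otimes s}),$$ where the inner sums run over $p_0+\dots+p_k=p+1$, $q_0+\dots+q_k=q$, respectively $p_1+p_2=p+1$, $q_1+q_2=q$; and the same equation for $[\bar\partial,f_n^{p,q}]$ with first term $-pf_n^{p,q+1}$ and inner sums over indices with total $(p,q+1)$ instead of $(p+1,q)$. In the first outer sum $k\ge2$, $i_j\ge1$; in the second $k\ge1$, $\ell\ge2$. Here $\theta=\sum_{1\le r<s\le k}i_r(i_s+1)$, $\varepsilon_1=\sum_{j=1}^k\big(\sum_{r=0}^{j-1}(p_r+q_r)\big)(p_j+q_j+i_j+1)+p+q+n+1$, $\varepsilon_2=(p_1+q_1)(p_2+q_2+\ell)+p+q+n+1$. In particular $f_1:=f_1^{0,0}$ is a morphism of bicomplexes; $f$ is a pluripotential $\infty$-weak equivalence if $f_1$ is a pluripotential weak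 equivalence.
   Formalization: The equations for μ_n^{p,q} and f_n^{p,q} are imposed only at the (n,p,q) where these maps may be nonzero; imposed at every (p,q) they would force μ_3^{-1,-1}=0, a strictly associative product and a strictly multiplicative f_1, and the claim would fail. *)

(* Defs.v *)
From HB Require Import structures.
From mathcomp Require Import all_boot all_order all_algebra.
From mathcomp Require Import zify.

Set Implicit Arguments.
Unset Strict Implicit.
Unset Printing Implicit Defensive.

Import Order.TTheory GRing.Theory Num.Theory.
Local Open Scope ring_scope.

(* The internal direct sum decomposition is given by subspaces [homog d],
   d : int * int, which span (every vector is a finite sum of homogeneous
   ones) and are independent. *)
Record bigraded (k : fieldType) := Bigraded {
  bg_sort :> lmodType k;
  homog : int * int -> bg_sort -> Prop;
  homog0 : forall d, homog d 0;
  homogP : forall d (c : k) x y, homog d x -> homog d y -> homog d (c *: x + y);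
  homog_span : forall x, exists (s : seq (int * int)) (v : int * int -> bg_sort),
    (forall d, homog d (v d)) /\ x = \sum_(d <- s) v d;
  homog_indep : forall (s : seq (int * int)) (v : int * int -> bg_sort),
    uniq s -> (forall d, homog d (v d)) -> \sum_(d <- s) v d = 0 ->
    forall d, d \in s -> v d = 0 }.

Record bicomplex (k : fieldType) := Bicomplex {
  bc_space :> bigraded k;
  del : {linear bc_space -> bc_space};
  delb : {linear bc_space -> bc_space};
  del_deg : forall d x, homog d x -> homog (d + (1, 0)) (del x);
  delb_deg : forall d x, homog d x -> homog (d + (0, 1)) (delb x);
  del_del : forall x, del (del x) = 0;
  delb_delb : forall x, delb (delb x) = 0;
  del_delb : forall x, del (delb x) + delb (del x) = 0 }.

Definition tdeg (d : int * int) : int := d.1 + d.2.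

Definition sgn (k : fieldType) (m : int) : k := (-1) ^ m.

Section Bicomplexes.
Variable k : fieldType.
Implicit Types A B : bicomplex k.

Record bicomplex_mor A B (f : A -> B) : Prop := BicomplexMor {
  mor_linear : linear f;
  mor_deg : forall d x, homog d x -> homog d (f x);
  mor_del : forall x, f (del A x) = del B (f x);
  mor_delb : forall x, f (delb A x) = delb B (f x) }.

Definition minimal A : Prop := forall x : A, del A (delb A x) = 0.

(* H_BC = BC_cycle / BC_bound and H_A = Ae_cycle / Ae_bound. *)
Definition BC_cycle A (x : A) : Prop := del A x = 0 /\ delb A x = 0.
Definition BC_bound A (x : A) : Prop := exists y, x = del A (delb A y).
Definition Ae_cycle A (x : A) : Prop := del A (delb A x) = 0.
Definition Ae_bound A (x : A) : Prop :=
  exists y z, x = del A y + delb A z.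

(* For f linear with f(Z) in Z' and f(S) in S' (automatic for the cycles and
   boundaries above when f is a morphism): the induced linear map
   Z / S -> Z' / S' is injective and surjective. *)
Definition subquotient_iso A B (f : A -> B)
    (Z S : A -> Prop) (Z' S' : B -> Prop) : Prop :=
  (forall x, Z x -> S' (f x) -> S x) /\
  (forall y, Z' y -> exists2 x, Z x & S' (y - f x)).

Record pluripotential_weq A B (f : A -> B) : Prop := PluripotentialWeq {
  weq_mor : bicomplex_mor f;
  weq_BC : subquotient_iso f (@BC_cycle A) (@BC_bound A)
                             (@BC_cycle B) (@BC_bound B);
  weq_A : subquotient_iso f (@Ae_cycle A) (@Ae_bound A)
                            (@Ae_cycle B) (@Ae_bound B) }.

(* [D, phi] = D phi - (-1)^m phi D for phi of total degree m. *)
Definition gcomm A (D : A -> A) (m : int) (phi : A -> A) (x : A) : A :=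
  D (phi x) - sgn k m *: phi (D x).

Record contraction A B (f : A -> B) (g : B -> A) (h : A -> A) : Prop :=
  Contraction {
  ctr_f : bicomplex_mor f;
  ctr_g : bicomplex_mor g;
  ctr_h_linear : linear h;
  ctr_h_deg : forall d x, homog d x -> homog (d + (-1, -1)) (h x);
  ctr_fg : forall y, f (g y) = y;
  ctr_gf : forall x, g (f x) - x =
    gcomm (del A) (-1) (gcomm (delb A) (-2) h) x }.

(* A linear map out of the n-th tensor power of A is encoded as an n-linear
   map.  A function phi : seq A -> B encodes the whole family (phi_n)_n of its
   restrictions to sequences of size n.  Since homogeneous elements span,
   identities between such maps are stated on homogeneous sequences, with
   [ds] listing the bidegrees of the entries of [a]. *)
Definition multilinear A B (phi : seq A -> B) : Prop :=
  forall s1 s2 (c : k) x y,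
  phi (s1 ++ (c *: x + y) :: s2) = c *: phi (s1 ++ x :: s2) + phi (s1 ++ y :: s2).

Definition homogs A (ds : seq (int * int)) (a : seq A) : Prop :=
  size ds = size a /\
  forall i, (i < size a)%N -> homog (nth 0 ds i) (nth 0 a i).

Definition bideg (ds : seq (int * int)) : int * int := \sum_(d <- ds) d.

Definition has_bidegree A B (phi : seq A -> B) (d : int * int) : Prop :=
  forall ds a, homogs ds a -> homog (d + bideg ds) (phi a).

(* [D, phi] for phi of total degree m, where D is either differential (of
   total degree 1), extended to tensor powers by the Leibniz rule. *)
Definition tcomm A B (DA : A -> A) (DB : B -> B) (m : int) (phi : seq A -> B)
    (ds : seq (int * int)) (a : seq A) : B :=
  DB (phi a) - sgn k m *:
    \sum_(i < size a) sgn k (tdeg (bideg (take i ds))) *: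
      phi (take i a ++ DA (nth 0 a i) :: drop i.+1 a).

(* phi (id^r (x) psi_l (x) id^s) (a), with psi of total degree m. *)
Definition insert A B (phi : seq A -> B) (psi : seq A -> A) (m : int)
    (r l : nat) (ds : seq (int * int)) (a : seq A) : B :=
  sgn k (m * tdeg (bideg (take r ds))) *:
    phi (take r a ++ psi (take l (drop r a)) :: drop (r + l)%N a).

(* The bidegrees (-a, -b) with 0 <= a, b <= n.  All operations of arity at
   most n vanish outside of them, so the sums over bidegrees below, where the
   last bidegree is determined by the prescribed total, are the full ones. *)
Definition npair n (e : 'I_n.+1 * 'I_n.+1) : int * int :=
  (- (e.1%:Z), - (e.2%:Z)).

(* (p, q) such that mu_n^{p,q} may be nonzero; this forces 2 <= n. *)
Definition mu_range (n : nat) (d : int * int) : bool :=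
  ((tdeg d == 2 - n%:Z) && (d.1 <= 0) && (d.2 <= 0)) ||
  ((tdeg d == 1 - n%:Z) && (d.1 <= -1) && (d.2 <= -1)).

(* The quadratic term in the equation for mu_n^d, with total bidegree t. *)
Definition mu_quad A (mu : int * int -> seq A -> A) (d t : int * int)
    (ds : seq (int * int)) (a : seq A) : A :=
  let n := size a in
  \sum_(2 <= l < n) \sum_(1 <= i < (n.+1 - l).+1)
  \sum_(e : 'I_n.+1 * 'I_n.+1)
    let d1 := npair e in
    let d2 := t - d1 in
    let eps := tdeg d1 * (l%:Z + tdeg d2) + (tdeg d + n%:Z) in
    sgn k ((i * l.+1 + n)%:Z + eps) *:
      insert (mu d1) (mu d2) (tdeg d2) i.-1 l ds a.

(* The structure equations range over the pairs (n, (p, q)) for which an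
   operation mu_n^{p,q} exists.  Imposing them also at the identically zero
   mu_n^{p,q}, p + q = -n, would force mu_3^{-1,-1} = 0. *)
Record ppAinf A := PPAinf {
  mu :> int * int -> seq A -> A;
  mu_multilinear : forall d, multilinear (mu d);
  mu_bidegree : forall d, has_bidegree (mu d) d;
  mu_zero : forall d a, ~~ mu_range (size a) d -> mu d a = 0;
  mu_del : forall d ds a, homogs ds a -> mu_range (size a) d ->
    tcomm (del A) (del A) (tdeg d) (mu d) ds a =
    (d.2)%:~R *: mu (d + (1, 0)) a + mu_quad mu d (d + (1, 0)) ds a;
  mu_delb : forall d ds a, homogs ds a -> mu_range (size a) d ->
    tcomm (delb A) (delb A) (tdeg d) (mu d) ds a =
    - (d.1)%:~R *: mu (d + (0, 1)) a + mu_quad mu d (d + (0, 1)) ds a }.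

(* (p, q) such that f_n^{p,q} may be nonzero; this forces 1 <= n.  As above,
   the equations are imposed for these (n, (p, q)) only. *)
Definition mor_range (n : nat) (d : int * int) : bool :=
  ((tdeg d == 1 - n%:Z) && (d.1 <= 0) && (d.2 <= 0)) ||
  ((tdeg d == - n%:Z) && (d.1 <= -1) && (d.2 <= -1)).

(* (f_{i_1}^{d_1} (x) ... (x) f_{i_k}^{d_k}) (a), as the sequence of its
   tensor factors; [tensor_sign] is its Koszul sign. *)
Definition tensor_app A B (f : int * int -> seq A -> B)
    (ar : seq nat) (es : seq (int * int)) (a : seq A) : seq B :=
  [seq f x.1 x.2 | x <- zip es (reshape ar a)].

Definition tensor_sign (ar : seq nat) (es ds : seq (int * int)) : int :=
  \sum_(j < size ar) tdeg (nth 0 es j) * tdeg (bideg (take (sumn (take j ar)) ds)).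

Definition theta (ar : seq nat) : nat :=
  (\sum_(s < size ar) \sum_(r < s) nth 0 ar r * (nth 0 ar s).+1)%N.

(* es = [:: d_0; d_1; ...; d_k] and ar = [:: i_1; ...; i_k]. *)
Definition eps1 (ar : seq nat) (es : seq (int * int)) (d : int * int) (n : nat)
    : int :=
  \sum_(j < size ar) (\sum_(r < j.+1) tdeg (nth 0 es r)) *
    (tdeg (nth 0 es j.+1) + (nth 0%N ar j)%:Z + 1)
  + tdeg d + n%:Z + 1.

Definition mor_target A B (nu : int * int -> seq B -> B)
    (f : int * int -> seq A -> B) (d t : int * int)
    (ds : seq (int * int)) (a : seq A) : B :=
  let n := size a in
  \sum_(2 <= m < n.+1)
  \sum_(it : m.-tuple 'I_n.+1 |
      let ar := [seq nat_of_ord i | i <- it] in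
      all (leq 1) ar && (sumn ar == n))
  \sum_(et : m.-tuple ('I_n.+1 * 'I_n.+1))
    let ar := [seq nat_of_ord i | i <- it] in
    let es := [seq npair e | e <- et] in
    let d0 := t - bideg es in
    sgn k ((theta ar)%:Z + eps1 ar (d0 :: es) d n + tensor_sign ar es ds) *:
      nu d0 (tensor_app f ar es a).

Definition mor_source A B (mu : int * int -> seq A -> A)
    (f : int * int -> seq A -> B) (d t : int * int)
    (ds : seq (int * int)) (a : seq A) : B :=
  let n := size a in
  \sum_(2 <= l < n.+1) \sum_(0 <= r < n.+1 - l)
  \sum_(e : 'I_n.+1 * 'I_n.+1)
    let m := (n.+1 - l)%N in
    let d1 := npair e in
    let d2 := t - d1 in
    let eps2 := tdeg d1 * (tdeg d2 + l%:Z) + tdeg d + n%:Z + 1 in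
    sgn k ((r * l.+1 + m)%:Z + eps2) *:
      insert (f d1) (mu d2) (tdeg d2) r l ds a.

Record ppinf_mor A B (muA : ppAinf A) (nuB : ppAinf B) := PPInfMor {
  im :> int * int -> seq A -> B;
  im_multilinear : forall d, multilinear (im d);
  im_bidegree : forall d, has_bidegree (im d) d;
  im_zero : forall d a, ~~ mor_range (size a) d -> im d a = 0;
  im_del : forall d ds a, homogs ds a -> mor_range (size a) d ->
    tcomm (del A) (del B) (tdeg d) (im d) ds a =
    (d.2)%:~R *: im (d + (1, 0)) a - mor_target nuB im d (d + (1, 0)) ds a
      - mor_source muA im d (d + (1, 0)) ds a;
  im_delb : forall d ds a, homogs ds a -> mor_range (size a) d ->
    tcomm (delb A) (delb B) (tdeg d) (im d) ds a =
    - (d.1)%:~R *: im (d + (0, 1)) a - mor_target nuB im d (d + (0, 1)) ds a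
      - mor_source muA im d (d + (0, 1)) ds a }.

Definition ppinf_weq A B (muA : ppAinf A) (nuB : ppAinf B)
    (f : ppinf_mor muA nuB) : Prop :=
  pluripotential_weq (fun x : A => f (0, 0) [:: x]).

Record bidiff_algebra := BidiffAlgebra {
  ba_bicomplex :> bicomplex k;
  ba_mul : ba_bicomplex -> ba_bicomplex -> ba_bicomplex;
  ba_mul_linearl : forall y, linear (ba_mul^~ y);
  ba_mul_linearr : forall x, linear (ba_mul x);
  ba_mulA : associative ba_mul;
  ba_mul_deg : forall d e x y,
    homog d x -> homog e y -> homog (d + e) (ba_mul x y);
  ba_del : forall d x y, homog d x ->
    del ba_bicomplex (ba_mul x y) =
    ba_mul (del ba_bicomplex x) y
      + sgn k (tdeg d) *: ba_mul x (del ba_bicomplex y);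
  ba_delb : forall d x y, homog d x ->
    delb ba_bicomplex (ba_mul x y) =
    ba_mul (delb ba_bicomplex x) y
      + sgn k (tdeg d) *: ba_mul x (delb ba_bicomplex y) }.

Definition ba_mu (A : bidiff_algebra) (d : int * int) (a : seq A) : A :=
  if (d == 0) && (size a == 2%N) then ba_mul (nth 0 a 0%N) (nth 0 a 1%N) else 0.

Lemma sgn0 : sgn k 0 = 1. Proof. exact: expr0z. Qed.

Lemma sgnS m : sgn k (1 + m) = - sgn k m.
Proof. by rewrite /sgn expfzDr ?oppr_eq0 ?oner_eq0 // expr1z mulN1r. Qed.

Section BidiffAlgebraAsPPAinf.
Variable A : bidiff_algebra.
Local Notation "x ** y" := (@ba_mul A x y) (at level 40).

Lemma ba_mul0x (y : A) : 0 ** y = 0.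
Proof.
by have := ba_mul_linearl y (-1) 0 0; rewrite /= scaler0 add0r scaleN1r addNr.
Qed.

Lemma ba_mu_multilinear d : multilinear (@ba_mu A d).
Proof.
move=> s1 s2 c x y; rewrite /ba_mu !size_cat /=.
case: eqP => _ /=; last by rewrite scaler0 addr0.
case: s1 => [|u [|v s1]] /=.
- case: s2 => [|v [|w s2]] /=; rewrite ?scaler0 ?addr0 //.
  exact: ba_mul_linearl.
- case: s2 => [|v s2] /=; rewrite ?scaler0 ?addr0 //.
  exact: ba_mul_linearr.
- by rewrite addnS !eqSS /= scaler0 addr0.
Qed.

Lemma ba_mu_bidegree d : has_bidegree (@ba_mu A d) d.
Proof.
move=> ds a [sz hom]; rewrite /ba_mu.
case: eqP => [->|_] /=; last exact: homog0.
case: eqP => [sz2|_]; last exact: homog0.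
move: sz hom; rewrite sz2 add0r.
case: ds => [|d1 [|d2 []]] //= _ hom.
rewrite /bideg !big_cons big_nil addr0.
by apply: ba_mul_deg; [apply: (hom 0%N) | apply: (hom 1%N)].
Qed.

Lemma ba_mu_zero d a : ~~ mu_range (size a) d -> @ba_mu A d a = 0.
Proof.
rewrite /ba_mu; case: eqP => [->|//]; case: eqP => [->|//].
by rewrite /mu_range.
Qed.

Lemma ba_mu_size d a : size a != 2%N -> @ba_mu A d a = 0.
Proof. by rewrite /ba_mu andbC => /negbTE->. Qed.

Lemma ba_mu_deg d a : d != 0 -> @ba_mu A d a = 0.
Proof. by rewrite /ba_mu => /negbTE->. Qed.

Lemma ba_mu0 d s1 s2 : @ba_mu A d (s1 ++ 0 :: s2) = 0.
Proof.
have := ba_mu_multilinear d s1 s2 (-1) 0 0.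
by rewrite scaler0 add0r scaleN1r addNr.
Qed.

Lemma ba_mu_quad d t ds a : mu_quad (@ba_mu A) d t ds a = 0.
Proof.
rewrite /mu_quad; have [sz|szN] := eqVneq (size a) 3%N; last first.
  apply: big1_seq => l /andP[_]; rewrite mem_index_iota => /andP[l2 ln].
  apply: big1_seq => i /andP[_]; rewrite mem_index_iota => /andP[i1 ik].
  apply: big1 => e _; rewrite /insert.
  have [l2'|lN2] := eqVneq l 2%N; last first.
    rewrite (@ba_mu_size _ (take l _)) ?ba_mu0 ?scaler0 // size_take size_drop.
    by case: ifP; lia.
  rewrite (@ba_mu_size _ (_ ++ _)) ?scaler0 // size_cat /= size_take size_drop.
  by case: ifP; lia.
case: a sz => [|x [|y [|z []]]] //= _.
rewrite big_nat1 big_nat_recr //= big_nat1 -big_split /=.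
apply: big1 => e _; rewrite /insert /=.
have [->|/ba_mu_deg nz] := eqVneq (npair e) 0; last by rewrite !nz !scaler0 addr0.
rewrite subr0; have [->|/ba_mu_deg nz] := eqVneq t 0; last first.
  by rewrite !nz (ba_mu0 _ [::] [:: z]) (ba_mu0 _ [:: x] [::]) !scaler0 addr0.
rewrite /ba_mu /= !mul0r sgn0 !scale1r ba_mulA.
set u := 0 + (tdeg d + 3%:Z).
have opp : sgn k (((4 - 2) * 3 + 3)%N%:Z + u) = - sgn k ((1 * 3 + 3)%N%:Z + u).
  suff -> : ((4 - 2) * 3 + 3)%N%:Z + u = 1 + (1 + (1 + ((1 * 3 + 3)%N%:Z + u))).
    by rewrite !sgnS opprK.
  by rewrite !addrA.
by rewrite -scalerDl opp subrr scale0r.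
Qed.

Lemma ba_tcomm0 (D : {linear A -> A}) d ds a :
  (forall d x y, homog d x ->
     D (x ** y) = D x ** y + sgn k (tdeg d) *: (x ** D y)) ->
  homogs ds a -> tcomm D D (tdeg d) (@ba_mu A d) ds a = 0.
Proof.
move=> DM [sz hom]; rewrite /tcomm.
have [d0|dN] := eqVneq d 0; last first.
  rewrite ba_mu_deg // linear0 big1 ?scaler0 ?subr0 // => i _.
  by rewrite ba_mu_deg ?scaler0.
have [a2|aN] := eqVneq (size a) 2%N; last first.
  rewrite ba_mu_size // linear0 big1 ?scaler0 ?subr0 // => i _.
  rewrite ba_mu_size ?scaler0 // size_cat /= size_take size_drop.
  by case: ifP; have := ltn_ord i; lia.
rewrite d0 sgn0 scale1r.
case: a a2 sz hom => [|x [|y []]] //= _.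
case: ds => [|d1 [|d2 []]] //= _ hom.
rewrite !big_ord_recl big_ord0 /= addr0 /bideg big_nil big_seq1.
rewrite /ba_mu /= sgn0 scale1r (DM d1) ?subrr //.
exact: (hom 0%N).
Qed.

Lemma ba_mu_del d ds a : homogs ds a -> mu_range (size a) d ->
  tcomm (del A) (del A) (tdeg d) (@ba_mu A d) ds a =
  (d.2)%:~R *: @ba_mu A (d + (1, 0)) a + mu_quad (@ba_mu A) d (d + (1, 0)) ds a.
Proof.
move=> ha _; rewrite ba_mu_quad addr0 ba_tcomm0 //; last exact: ba_del.
have [/eqP|/ba_mu_deg->] := eqVneq (d + (1, 0)) 0; last by rewrite scaler0.
by case: d => p q; rewrite xpair_eqE /= addr0 => /andP[_ /eqP->]; rewrite scale0r.
Qed.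

Lemma ba_mu_delb d ds a : homogs ds a -> mu_range (size a) d ->
  tcomm (delb A) (delb A) (tdeg d) (@ba_mu A d) ds a =
  - (d.1)%:~R *: @ba_mu A (d + (0, 1)) a + mu_quad (@ba_mu A) d (d + (0, 1)) ds a.
Proof.
move=> ha _; rewrite ba_mu_quad addr0 ba_tcomm0 //; last exact: ba_delb.
have [/eqP|/ba_mu_deg->] := eqVneq (d + (0, 1)) 0; last by rewrite scaler0.
case: d => p q; rewrite xpair_eqE /= addr0 => /andP[/eqP-> _].
by rewrite oppr0 scale0r.
Qed.

Definition ba_ppAinf : ppAinf A :=
  PPAinf ba_mu_multilinear ba_mu_bidegree ba_mu_zero
    ba_mu_del ba_mu_delb.
End BidiffAlgebraAsPPAinf.
End Bicomplexes.

(* Main.v *)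
(* Every linear map T has a generalized inverse S, T S T = T.  Applied to
   T = del delb, made homogeneous and normalised, this gives a map h for which
   [del, [delb, h]] is the projection onto a sum of squares; its kernel is the
   minimal bicomplex H.

   For the transferred structure, let (f, g, h) be the contraction obtained in
   this way (its h is the negative of the one above).  Adjoin even variables
   s, t and an odd variable eps with eps^2 = 0.  Put k1 = [delb, h] and
   k2 = -[del, h], so that [del, k1] = [delb, k2] = gf - 1 and
   [del, k2] = [delb, k1] = 0.  Then
     khat = s k1 + t k2 + eps s t h
   satisfies
     [del - eps s t d/dt, khat] = s (gf - 1),
     [delb + eps t s d/ds, khat] = t (gf - 1),
   and both perturbed differentials are still derivations.  The usual sum over
   binary trees with khat on the inner edges is therefore an A_infinity
   structure and morphism over k[s, t, eps] for both of them at once.  The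
   coefficients of s^i t^j and of eps s^i t^j are, up to sign, mu_n^{-i,-j} and
   f_n^{-i,-j}, and the derivations s d/ds, t d/dt produce the coefficients -p
   and q in the structure equations. *)

From HB Require Import structures.
Require Import Defs.
From mathcomp Require Import all_boot all_order all_algebra.
From mathcomp Require Import zify.
From mathcomp Require Import boolp classical_sets functions.

Set Implicit Arguments.
Unset Strict Implicit.
Unset Printing Implicit Defensive.
Import Order.TTheory GRing.Theory Num.Theory.
Local Open Scope ring_scope.

(** * Tree transfer over an algebra with one differential *)

(** The contraction identity is of second order in [h]: [k1] is a contracting homotopy only for del
    and [k2] only for delb, so neither serves both differentials, and s and t keep the two apart.
    But s k1 + t k2 alone would give no operations of total degree 1 - n. They come from the fact
    that [k1] and [k2] are themselves commutators with [h], which the eps term records. The factors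
    s and t are central. So the tree calculus is done once, for one differential d and a homotopy
    [kap] with [d, kap] = c (g f - 1), where the operator c commutes with all the other maps; each
    perturbed differential is an instance. Degrees appear nowhere in this calculus. Signs are
    carried by parity operators, and lists are treated as in a bar construction: minus the parity
    operator is the parity of the shifted degree, and with it every recursion has a uniform sign.
    Degrees, the twist [chi] and the sign [rho] come in only when coefficients are compared with the
    structure equations. *)

Section ZmodMorphism.
Variables (U V : zmodType) (t : U -> V).
Hypothesis tB : zmod_morphism t.

Lemma zmod0 : t 0 = 0.
Proof. by rewrite -[X in t X](subrr 0) tB subrr. Qed.

Lemma zmodN : {morph t : x / - x}.
Proof. by move=> x; rewrite -sub0r tB zmod0 sub0r. Qed.

Lemma zmodD : {morph t : x y / x + y}.
Proof. by move=> x y; rewrite -[in LHS](opprK y) tB zmodN opprK. Qed.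

Lemma zmod_sum (I : Type) (r : seq I) (P : pred I) (F : I -> U) :
  t (\sum_(i <- r | P i) F i) = \sum_(i <- r | P i) t (F i).
Proof. exact: (big_morph t zmodD zmod0). Qed.
End ZmodMorphism.

(** * Sums over the splittings of a list, and insertions *)

Section SplitSums.
Variables (T : Type) (U : zmodType).
Implicit Types (phi psi : seq T -> seq T -> U) (a u v w : seq T).

(** Summation over the deconcatenation coproduct of the list; in recursive form coassociativity is
    an induction on the list. *)
Fixpoint ssum phi a : U :=
  phi [::] a + if a is x :: a' then ssum (fun u v => phi (x :: u) v) a' else 0.

Lemma eq_ssum phi psi a :
  (forall u v, a = u ++ v -> phi u v = psi u v) -> ssum phi a = ssum psi a.
Proof.
elim: a phi psi => [|x a IH] phi psi e /=; first by rewrite (e [::] [::]).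
by rewrite e //; congr (_ + _); apply: IH => u v a_uv; apply: e; rewrite a_uv.
Qed.

Lemma ssum0 a : ssum (fun _ _ => 0) a = 0.
Proof. by elim: a => [|x a IH] /=; rewrite ?IH addr0. Qed.

Lemma ssumD phi psi a :
  ssum (fun u v => phi u v + psi u v) a = ssum phi a + ssum psi a.
Proof.
elim: a phi psi => [|x a IH] phi psi /=; first by rewrite !addr0.
by rewrite IH addrACA.
Qed.

Lemma ssumB phi psi a :
  ssum (fun u v => phi u v - psi u v) a = ssum phi a - ssum psi a.
Proof.
elim: a phi psi => [|x a IH] phi psi /=; first by rewrite !addr0.
by rewrite IH opprD addrACA.
Qed.

Lemma ssum_coassoc (phi : seq T -> seq T -> seq T -> U) a :
  ssum (fun y w => ssum (fun u v => phi u v w) y) a =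
  ssum (fun u z => ssum (phi u) z) a.
Proof.
elim: a phi => [|x a IH] phi /=; first by rewrite !addr0.
by rewrite addr0 ssumD IH addrA.
Qed.

Lemma ssum_cat phi u x w :
  ssum phi (u ++ x :: w) = ssum (fun u1 u2 => phi u1 (u2 ++ x :: w)) u
    + ssum (fun w1 w2 => phi (u ++ x :: w1) w2) w.
Proof.
by elim: u phi => [|y u IH] phi /=; rewrite ?addr0 // IH addrA.
Qed.

Lemma ssum_big phi a :
  ssum phi a = \sum_(i < (size a).+1) phi (take i a) (drop i a).
Proof.
elim: a phi => [|x a IH] phi /=; rewrite big_ord_recl ?big_ord0 //=.
by rewrite IH.
Qed.
End SplitSums.

Lemma ssum_raddf (T : Type) (U U' : zmodType) (f : U -> U')
    (phi : seq T -> seq T -> U) a : zmod_morphism f ->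
  f (ssum phi a) = ssum (fun u v => f (phi u v)) a.
Proof.
move=> fB; elim: a phi => [|x a IH] phi /=; first by rewrite !addr0.
by rewrite -IH (zmodD fB).
Qed.

Lemma ssum_map (T T' : Type) (U : zmodType) (t : T -> T')
    (phi : seq T' -> seq T' -> U) a :
  ssum phi (map t a) = ssum (fun u v => phi (map t u) (map t v)) a.
Proof. by elim: a phi => [|x a IH] phi //=; rewrite IH. Qed.

Lemma ssum_swap (T T' : Type) (U : zmodType)
    (phi : seq T -> seq T -> seq T' -> seq T' -> U) a b :
  ssum (fun u v => ssum (phi u v) b) a
  = ssum (fun u' v' => ssum (fun u v => phi u v u' v') a) b.
Proof.
elim: b phi => [|x b IH] phi /=; last by rewrite ssumD IH.
by rewrite addr0; apply: eq_ssum => *; rewrite addr0.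
Qed.

Section Nabla.
Variables (V : Type) (tau : V -> V).

(* b inserted into phi at all positions, the entries to its left being twisted
   by tau. *)
Definition nabla (U : zmodType) (b : seq V -> V) (phi : seq V -> U) a : U :=
  ssum (fun u z => ssum (fun v w => phi (map tau u ++ b v :: w)) z) a.

Lemma eq_nabla (U : zmodType) b (phi psi : seq V -> U) a :
  phi =1 psi -> nabla b phi a = nabla b psi a.
Proof. by move=> e; apply: eq_ssum => u z _; apply: eq_ssum => v w _. Qed.

Lemma nablaD (U : zmodType) b (phi psi : seq V -> U) a :
  nabla b (fun x => phi x + psi x) a = nabla b phi a + nabla b psi a.
Proof.
rewrite /nabla -ssumD; apply: eq_ssum => u z _.
by rewrite -ssumD; apply: eq_ssum.
Qed.

Lemma nabla_raddf (U U' : zmodType) (f : U -> U') b phi a :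
  zmod_morphism f -> f (nabla b phi a) = nabla b (fun x => f (phi x)) a.
Proof.
move=> fB; rewrite ssum_raddf //; apply: eq_ssum => u z _.
by rewrite ssum_raddf.
Qed.

(** [nabla b] is a coderivation of deconcatenation: the inserted entry lies in the left or in the
    right piece, and in the second case the whole left piece precedes it and is twisted by [tau]. *)
Lemma nabla_split (U : zmodType) (chi : seq V -> seq V -> U) b a :
  nabla b (ssum chi) a =
  ssum (fun y z => nabla b (chi^~ z) y) a
  + ssum (fun y z => nabla b (chi (map tau y)) z) a.
Proof.
transitivity (ssum (fun u z => ssum (fun v w =>
    ssum (fun u1 u2 => chi (map tau u1) (map tau u2 ++ b v :: w)) u) z) a
  + ssum (fun u z => ssum (fun v w =>
    ssum (fun w1 w2 => chi (map tau u ++ b v :: w1) w2) w) z) a).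
  rewrite -ssumD; apply: eq_ssum => u z _; rewrite -ssumD.
  by apply: eq_ssum => v w _; rewrite ssum_cat ssum_map.
rewrite addrC; congr (_ + _).
  rewrite (ssum_coassoc (fun u z w2 => ssum (fun v w1 =>
    chi (map tau u ++ b v :: w1) w2) z)).
  apply: eq_ssum => u z _.
  by rewrite (ssum_coassoc (fun v w1 w2 => chi (map tau u ++ b v :: w1) w2)).
rewrite -(ssum_coassoc (fun u1 u2 z => ssum (fun v w =>
  chi (map tau u1) (map tau u2 ++ b v :: w)) z)).
apply: eq_ssum => u z _.
by rewrite ssum_swap.
Qed.
End Nabla.

Section TreeTransfer.
Variables (V W : zmodType).
Variables (sV : V -> V) (sW : W -> W) (mul : W -> W -> W).
Variables (g : V -> W) (f : W -> V) (kap : W -> W).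
Hypothesis mulBl : forall y, zmod_morphism (mul^~ y).
Hypothesis mulBr : forall x, zmod_morphism (mul x).
Hypothesis mulA : associative mul.
Hypothesis sWB : zmod_morphism sW.
Hypothesis gB : zmod_morphism g.
Hypothesis fB : zmod_morphism f.
Hypothesis kapB : zmod_morphism kap.
Hypothesis sWK : involutive sW.
Hypothesis sW_mul : forall x y, sW (mul x y) = mul (sW x) (sW y).
Hypothesis g_s : forall x, g (sV x) = sW (g x).
Hypothesis kap_s : forall x, kap (sW x) = - sW (kap x).
Implicit Types (a u v w : seq V) (b : seq V -> V).

Let mul0x x : mul 0 x = 0. Proof. exact: zmod0 (mulBl x). Qed.
Let mulx0 x : mul x 0 = 0. Proof. exact: zmod0 (mulBr x). Qed.

(** Parity after a shift of degree by one: where [sV] is (-1)^|x|, this is (-1)^(|x|+1). *)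
Let tau x := - sV x.

(** Convolution of maps on the tensor coalgebra, for the product transported to the shifted space;
    [sW] on the left factor is the sign of that transport. *)
Definition star (phi psi : seq V -> W) a : W :=
  ssum (fun u v => mul (sW (phi u)) (psi v)) a.

Definition leaf a : W := if a is [:: x] then g x else 0.

(* The recursion tree = leaf + kap (tree * tree), with fuel n. *)
Fixpoint tree_rec n a : W :=
  if n is n'.+1
  then leaf a + kap (star (tree_rec n') (tree_rec n') a) else 0.

(** All three sum over binary trees: [tree] carries the homotopy on the root edge as well and gives
    the transferred morphism, [forest] has a bare root, and [stem] closes the root with [f] and
    gives the transferred operations. *)
Definition tree a : W := tree_rec (size a) a.
Definition forest a : W := star tree tree a.
Definition stem a : V := f (forest a).

Let tree_rec0 n : tree_rec n [::] = 0.
Proof.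
elim: n => //= n IH.
by rewrite /star /= IH (zmod0 sWB) mul0x !add0r (zmod0 kapB).
Qed.

Lemma tree_nil : tree [::] = 0. Proof. by []. Qed.

Let eq_star_tree phi psi phi' psi' a :
    phi [::] = 0 -> psi [::] = 0 -> phi' [::] = 0 -> psi' [::] = 0 ->
    (forall u, (size u < size a)%N -> phi u = phi' u /\ psi u = psi' u) ->
  star phi psi a = star phi' psi' a.
Proof.
move=> p0 q0 p'0 q'0 e; apply: eq_ssum => u v a_uv; move: e.
rewrite {a}a_uv size_cat => e.
case: u v e => [|x u] [|y v] e; rewrite ?p0 ?q0 ?p'0 ?q'0 ?(zmod0 sWB) ?mul0x ?mulx0 //.
by have [-> _] := e (x :: u) ltac:(by rewrite /=; lia);
   have [_ ->] := e (y :: v) ltac:(by rewrite /=; lia).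
Qed.

(** Fuel equal to the length is enough: the empty list has no trees, so both factors of a nonzero
    product come from shorter lists. *)
Let tree_recE n a : (size a <= n)%N -> tree_rec n a = tree a.
Proof.
elim/ltn_ind: n a => -[|n] IH [|x a]; rewrite ?tree_rec0 // => an.
rewrite /tree /=; congr (_ + kap _).
apply: eq_star_tree; rewrite ?tree_rec0 // => u; rewrite [size (_ :: _)]/= ltnS => ua.
by rewrite !IH // (leq_trans ua).
Qed.

Lemma treeE a : tree a = leaf a + kap (forest a).
Proof.
rewrite -(tree_recE (leqnSn (size a))) /=; congr (_ + kap _).
by apply: eq_ssum => u v ->; rewrite !tree_recE // size_cat ?leq_addl ?leq_addr.
Qed.

(** An induction on the length says nothing about the two splittings with an empty piece, so these
    are compared separately. *)
Let proper_ssum (U : zmodType) (chi chi' : seq V -> seq V -> U) a :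
    (forall u v, a = u ++ v -> (size u < size a)%N -> (size v < size a)%N ->
       chi u v = chi' u v) ->
    chi [::] a = chi' [::] a -> chi a [::] = chi' a [::] ->
  ssum chi a = ssum chi' a.
Proof.
move=> e el er; apply: eq_ssum => -[|x u] [|y v] a_uv.
- by move: el; rewrite a_uv.
- by move: el; rewrite a_uv.
- by move: er; rewrite a_uv cats0.
- by apply: e; rewrite // a_uv size_cat /=; lia.
Qed.

(** In shifted degrees [tree] is an even map and [forest] an odd one, since there the product is odd
    and [kap] is odd too. *)
Let tree_forest_parity a :
  tree (map tau a) = - sW (tree a) /\ forest (map tau a) = sW (forest a).
Proof.
have [n] := ubnP (size a); elim: n a => // n IH a an.
have pf : forest (map tau a) = sW (forest a).
  rewrite /forest /star ssum_map ssum_raddf //.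
  apply: proper_ssum; rewrite ?tree_nil ?(zmod0 sWB) ?mul0x ?mulx0 ?(zmod0 sWB) //.
  move=> u v _ ua va; rewrite !(IH _ _).1 ?(leq_trans ua) ?(leq_trans va) //.
  by rewrite sW_mul (zmodN sWB) (zmodN (mulBl _)) (zmodN (mulBr _)) opprK.
split=> //; rewrite !treeE pf kap_s (zmodD sWB) opprD; congr (_ + _).
case: a {IH an pf} => [|x [|y a]] /=; rewrite ?(zmod0 sWB) ?oppr0 //.
by rewrite (zmodN gB) g_s.
Qed.

Lemma tree_parity a : tree (map tau a) = - sW (tree a).
Proof. by case: (tree_forest_parity a). Qed.

Lemma forest_parity a : forest (map tau a) = sW (forest a).
Proof. by case: (tree_forest_parity a). Qed.

Lemma forest_nil : forest [::] = 0.
Proof. by rewrite /forest /star /= tree_nil mulx0 addr0. Qed.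

Lemma forest1 x : forest [:: x] = 0.
Proof. by rewrite /forest /star /= tree_nil (zmod0 sWB) mul0x mulx0 !addr0. Qed.

Lemma tree1 x : tree [:: x] = g x.
Proof. by rewrite treeE forest1 (zmod0 kapB) addr0. Qed.

Let tree_forest_sub u x y w :
  tree (u ++ (x - y) :: w) = tree (u ++ x :: w) - tree (u ++ y :: w) /\
  forest (u ++ (x - y) :: w) = forest (u ++ x :: w) - forest (u ++ y :: w).
Proof.
have [n] := ubnP (size (u ++ x :: w)); elim: n u w => // n IH u w.
rewrite size_cat /= ltnS addnS => uw.
have fB' : forest (u ++ (x - y) :: w) = forest (u ++ x :: w) - forest (u ++ y :: w).
  rewrite /forest /star !ssum_cat opprD addrACA -!ssumB; congr (_ + _).
    apply: eq_ssum => -[|z u1] u2 u_u; first by rewrite tree_nil (zmod0 sWB) !mul0x subr0.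
    by rewrite (IH _ _ _).1 ?mulBr // size_cat /=; move: uw; rewrite u_u size_cat /=; lia.
  apply: eq_ssum => w1 [|z w2] w_w; first by rewrite tree_nil !mulx0 subr0.
  by rewrite (IH _ _ _).1 ?sWB ?mulBl // size_cat /=; move: uw; rewrite w_w size_cat /=; lia.
split=> //; rewrite !treeE fB' kapB opprD addrACA; congr (_ + _).
by case: u w {IH uw fB'} => [|z [|z' u]] [|z'' w] /=; rewrite ?subr0 ?gB.
Qed.

Lemma tree_sub u x y w :
  tree (u ++ (x - y) :: w) = tree (u ++ x :: w) - tree (u ++ y :: w).
Proof. by case: (tree_forest_sub u x y w). Qed.

Lemma forest_sub u x y w :
  forest (u ++ (x - y) :: w) = forest (u ++ x :: w) - forest (u ++ y :: w).
Proof. by case: (tree_forest_sub u x y w). Qed.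

Section Operator.
Variables (p : bool) (zV : V -> V) (zW : W -> W).
Let sg (U : zmodType) (x : U) := if p then - x else x.
Let stau u := if p then map tau u else u.
Hypothesis zWB : zmod_morphism zW.
Hypothesis zg : forall x, g (zV x) = zW (g x).
Hypothesis zkap : forall x, kap (zW x) = sg (zW (kap x)).
Hypothesis z_sW : forall x, sW (zW x) = sg (zW (sW x)).
Hypothesis z_mull : forall x y, mul (zW x) y = zW (mul x y).
Hypothesis z_mulr : forall x y,
  mul x (zW y) = zW (mul (if p then sW x else x) y).

(** [zV] and [zW] stand for multiplication by one scalar of parity [p], so this is multilinearity of
    the tree sums over such scalars. It serves monomials in s, t and elements of the field
    ([p = false]), and eps ([p = true]), which has to pass the entries on its left. *)
Let tree_forest_operator u x w :
  tree (u ++ zV x :: w) = zW (tree (stau u ++ x :: w)) /\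
  forest (u ++ zV x :: w) = sg (zW (forest (stau u ++ x :: w))).
Proof.
have sgB : zmod_morphism (fun y => sg (zW y)).
  by move=> y z; rewrite /sg zWB; case: ifP => // _; rewrite opprB addrC opprK.
have [n] := ubnP (size (u ++ x :: w)); elim: n u w => // n IH u w.
rewrite size_cat /= ltnS addnS => uw.
have ff : forest (u ++ zV x :: w) = sg (zW (forest (stau u ++ x :: w))).
  rewrite /forest /star !ssum_cat (zmodD sgB); congr (_ + _).
    rewrite [RHS](ssum_raddf _ _ sgB).
    have -> : forall chi : seq V -> seq V -> W, ssum chi (stau u) =
        ssum (fun u v => chi (stau u) (stau v)) u.
      by move=> chi; rewrite /stau; case: (p) => //; rewrite ssum_map.
    apply: eq_ssum => -[|z u1] u2 u_u.
      by rewrite /stau /=; case: ifP => _; rewrite /= tree_nil (zmod0 sWB) !mul0x (zmod0 sgB).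
    rewrite (IH u2 w _).1; last by rewrite size_cat /=; move: uw; rewrite u_u size_cat /=; lia.
    rewrite z_mulr /sg /stau; case: ifP => // _.
    by rewrite tree_parity (zmodN sWB) (zmodN (mulBl _)) (zmodN zWB) opprK.
  rewrite [RHS](ssum_raddf _ _ sgB); apply: eq_ssum => w1 [|z w2] w_w.
    by rewrite tree_nil !mulx0 (zmod0 sgB).
  rewrite (IH u w1 _).1; last by rewrite size_cat /=; move: uw; rewrite w_w size_cat /=; lia.
  by rewrite z_sW /sg; case: ifP => _; rewrite ?(zmodN (mulBl _)) z_mull.
split=> //; rewrite !treeE ff (zmodD zWB); congr (_ + _).
  rewrite /stau; case: u w {IH uw ff} => [|z [|z' u]] [|z'' w] /=;
  by case: (p); rewrite /= ?(zmod0 zWB) ?zg.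
by have := zkap; rewrite /sg; case: (p) => zk; rewrite ?(zmodN kapB) zk ?opprK.
Qed.

Lemma tree_operator u x w :
  tree (u ++ zV x :: w) = zW (tree (stau u ++ x :: w)).
Proof. by case: (tree_forest_operator u x w). Qed.

Lemma forest_operator u x w :
  forest (u ++ zV x :: w) = sg (zW (forest (stau u ++ x :: w))).
Proof. by case: (tree_forest_operator u x w). Qed.
End Operator.

(** * The A-infinity equations of the tree sums *)

Section Differential.
Variables (cV dV : V -> V) (cW dW : W -> W).
Hypothesis dVB : zmod_morphism dV.
Hypothesis cWB : zmod_morphism cW.
Hypothesis dWB : zmod_morphism dW.
Hypothesis dg : forall x, dW (g x) = g (dV x).
Hypothesis df : forall x, dV (f x) = f (dW x).
Hypothesis cf : forall x, cV (f x) = f (cW x).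
Hypothesis d_sW : forall x, dW (sW x) = - sW (dW x).
Hypothesis c_sW : forall x, cW (sW x) = sW (cW x).
Hypothesis c_kap : forall x, cW (kap x) = kap (cW x).
Hypothesis d_mul : forall x y, dW (mul x y) = mul (dW x) y + mul (sW x) (dW y).
Hypothesis c_mull : forall x y, mul (cW x) y = cW (mul x y).
Hypothesis c_mulr : forall x y, mul x (cW y) = cW (mul x y).
Hypothesis d_kap : forall x, dW (kap x) + kap (dW x) = cW (g (f x) - x).

Definition unary v : V := if v is [:: x] then dV x else 0.

(** [leaf] sees only lists of length one, so [b] has to swallow the whole list. *)
Let nabla_leaf b a : nabla tau b leaf a = g (b a).
Proof.
have last_split (h : seq V -> W) y :
    ssum (fun v w => if w is [::] then h v else 0) y = h y.
  elim: y h => [|x y IH] h /=; first by rewrite addr0.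
  by rewrite IH add0r.
have -> : nabla tau b leaf a = ssum (fun v w => leaf (b v :: w)) a.
  case: a => [|x a]; first by rewrite /nabla /= !addr0.
  rewrite /nabla [LHS]/= -[RHS]addr0; congr (_ + _).
  rewrite -[RHS](ssum0 _ a); apply: eq_ssum => u z _.
  rewrite -[RHS](ssum0 _ z); apply: eq_ssum => v w _ /=.
  by case: (_ ++ _) (size_cat (map tau u) (b v :: w)); rewrite //= addnS.
by rewrite -[RHS](last_split (fun v => g (b v)) a).
Qed.

Let nabla_tree b a :
  nabla tau b tree a = g (b a) + kap (nabla tau b forest a).
Proof.
rewrite (nabla_raddf tau b _ _ kapB) -nabla_leaf -nablaD.
by apply: eq_nabla => z; rewrite treeE.
Qed.

Let nabla_forest b a : nabla tau b forest a =
  ssum (fun y z => mul (sW (nabla tau b tree y)) (tree z)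
                   - mul (tree y) (nabla tau b tree z)) a.
Proof.
rewrite {1}/forest /star nabla_split -ssumD; apply: eq_ssum => y z _.
have mB : zmod_morphism (fun t => mul (sW t) (tree z)).
  by move=> t t'; rewrite sWB mulBl.
congr (_ + _); first exact: (esym (nabla_raddf tau b tree y mB)).
rewrite -(nabla_raddf tau b tree z (mulBr _)) tree_parity (zmodN sWB) sWK.
by rewrite (zmodN (mulBl _)).
Qed.

(** The value that [d_tree] gives to dW (tree a); the bracket holds the quadratic terms of the
    A-infinity morphism equation. *)
Let err a := nabla tau unary tree a + cW (nabla tau stem tree a - forest a).

Let err_nil : err [::] = 0.
Proof.
rewrite /err !nabla_tree /stem forest_nil (zmod0 fB) subr0 /nabla /= !addr0.
by rewrite !forest1 (zmod0 kapB) (zmod0 gB) !addr0 (zmod0 cWB) addr0.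
Qed.

(** The Leibniz rule leads to shorter lists, where [err] is available. Its [forest] terms produce
    products of three trees in both bracketings, and these cancel by associativity. *)
Let d_forest a :
  (forall u, (size u < size a)%N -> dW (tree u) = err u) ->
  dW (forest a) =
  - (nabla tau unary forest a + cW (nabla tau stem forest a)).
Proof.
move=> IH; transitivity
  (ssum (fun y z => mul (tree y) (err z) - mul (sW (err y)) (tree z)) a).
  rewrite /forest /star ssum_raddf //.
  apply: proper_ssum => [u v _ ua va||].
  - by rewrite d_mul d_sW sWK !IH // (zmodN (mulBl _)) addrC.
  - by rewrite d_mul d_sW sWK !tree_nil err_nil (zmod0 dWB) (zmod0 sWB)
      oppr0 !mul0x subr0 add0r.
  - by rewrite d_mul d_sW sWK !tree_nil err_nil (zmod0 dWB) !mulx0 subr0 addr0.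
have assoc : ssum (fun y z => mul (sW (forest y)) (tree z)) a
           = ssum (fun y z => mul (tree y) (forest z)) a.
  transitivity (ssum (fun y z => ssum (fun u v =>
      mul (tree u) (mul (sW (tree v)) (tree z))) y) a).
    apply: eq_ssum => y z _.
    have mB : zmod_morphism (fun t => mul (sW t) (tree z)).
      by move=> t t'; rewrite sWB mulBl.
    apply: etrans (ssum_raddf _ _ mB) _; apply: eq_ssum => u v _ /=.
    by rewrite sW_mul sWK mulA.
  rewrite ssum_coassoc; apply: eq_ssum => u z _.
  by rewrite (ssum_raddf _ _ (mulBr _)).
have cB y z : mul (tree y) (err z) - mul (sW (err y)) (tree z) =
    - ((mul (sW (nabla tau unary tree y)) (tree z)
        - mul (tree y) (nabla tau unary tree z))
      + cW (mul (sW (nabla tau stem tree y)) (tree z)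
        - mul (tree y) (nabla tau stem tree z)))
    + cW (mul (sW (forest y)) (tree z) - mul (tree y) (forest z)).
  rewrite /err (zmodD (mulBr _)) (zmodD sWB) (zmodD (mulBl _)) -c_sW.
  rewrite c_mull c_mulr opprD addrACA [in RHS]opprD opprB -[RHS]addrA.
  congr (_ + _); rewrite -cWB addrC -cWB; congr cW.
  rewrite sWB (mulBr (tree y)) (mulBl (tree z)) !opprB.
  by rewrite addrC addrACA [RHS]addrACA; congr (_ + _); rewrite addrC.
rewrite (eq_ssum (fun u v _ => cB u v)) ssumD.
rewrite -(ssum_raddf _ _ cWB) ssumB assoc subrr (zmod0 cWB) addr0.
rewrite !nabla_forest (ssum_raddf _ _ cWB) -ssumD.
have oppB : zmod_morphism (fun x : W => - x) by move=> x y; rewrite !opprB addrC opprK.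
by rewrite -(ssum_raddf _ _ oppB).
Qed.

(** At the root edge the homotopy identity leaves three terms: g f, which is a stem feeding a leaf;
    minus the identity, which is the bare [forest]; and - kap dW of the forest, which reproduces the
    insertions deeper in the tree. *)
Lemma d_tree a : dW (tree a) =
  nabla tau unary tree a + cW (nabla tau stem tree a - forest a).
Proof.
rewrite -/(err a); have [n] := ubnP (size a); elim: n a => // n IH a an.
rewrite treeE (zmodD dWB) (canRL (addrK _) (d_kap _)) d_forest; last first.
  by move=> u ua; apply: IH; apply: leq_trans ua _.
rewrite /err !nabla_tree -[f (forest a)]/(stem a) (zmodN kapB) (zmodD kapB).
have -> : dW (leaf a) = g (unary a).
  by case: a {an} => [|x [|y a]] //=; rewrite ?(zmod0 dWB) ?(zmod0 gB).
rewrite opprK -c_kap -!addrA; congr (_ + _).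
rewrite [LHS]addrCA; congr (_ + _).
by rewrite -(zmodD cWB) addrAC addrA.
Qed.

Lemma d_stem a : dV (stem a) =
  - (nabla tau unary stem a + cV (nabla tau stem stem a)).
Proof.
rewrite df d_forest => [|u _]; last exact: d_tree.
by rewrite (zmodN fB) (zmodD fB) -cf !(nabla_raddf tau _ _ _ fB).
Qed.
End Differential.
End TreeTransfer.

(** * Contraction onto a minimal bicomplex *)

Section GeneralizedInverse.
Variables (k : fieldType) (V W : lmodType k) (T : {linear V -> W}).

Lemma generalized_inverse :
  exists S : {linear W -> V}, forall x, T (S (T x)) = T x.
Proof.
(* Zorn on graphs of partial linear maps that contain a preimage of every
   element of the image of T in their domain. *)
pose P (G : set (W * V)) := [/\
  forall c p q, G p -> G q -> G (c *: p + q),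
  forall v, G (0, v) -> v = 0 &
  forall x v, G (T x, v) -> T v = T x].
have [|G [[Gl Gf GT] Gmax]] := @Zorn_bigcup _ P.
  move=> F FP tot; split.
  - move=> c p q [X FX Xp] [Y FY Yq].
    have [XY|YX] := tot X Y FX FY.
      by exists Y => //; have [Yl _ _] := FP _ FY; apply: Yl => //; apply: XY.
    by exists X => //; have [Xl _ _] := FP _ FX; apply: Xl => //; apply: YX.
  - by move=> v [X /FP[_ Xf _]]; apply: Xf.
  - by move=> x v [X /FP[_ _ XT]]; apply: XT.
(* The empty set also satisfies [P], so that [G] contains zero has to be drawn from maximality. *)
have G0 : G (0, 0).
  have [[p Gp]|nG] := pselect (exists p, G p).
    by have := Gl (-1) p p Gp Gp; rewrite scaleN1r addNr.
  case: (Gmax (fun p => p = (0, 0))).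
    by split=> [p Gp|/(_ (0, 0) erefl) G0]; case: nG; [exists p | exists (0, 0)].
  split=> [c p q -> ->|v [->]|x v [-> ->]] //=; last exact: raddf0.
  by rewrite /= scaler0 addr0.
have GD w v w' v' : G (w, v) -> G (w', v') -> G (w + w', v + v').
  by move=> /(Gl 1) h /h; rewrite scale1r.
have GZ c w v : G (w, v) -> G (c *: w, c *: v).
  by move=> /(Gl c) /(_ G0); rewrite addr0.
have Gdom w0 : exists v, G (w0, v).
  have [//|nw0] := pselect (exists v, G (w0, v)).
  (* The value at the new vector [w0] is constrained only if [w0] lies in the domain plus the image
     of [T]. From w0 = T y - w1 comes v0 = y - v1; otherwise any value will do. *)
  have [v0 v0P] : exists v0, forall w v c x, G (w, v) -> w + c *: w0 = T x ->
      T (v + c *: v0) = T x.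
    have [[w1 [v1 [y [Gwv1 w1y]]]]|no] :=
        pselect (exists w1 v1 y, G (w1, v1) /\ w1 + w0 = T y).
      exists (y - v1) => w v c x Gwv e.
      have wE : w - c *: w1 = T (x - c *: y).
        by rewrite raddfB /= [T (c *: y)]linearZ /= -e -w1y scalerDr opprD addrACA subrr addr0.
      have := GD _ _ _ _ Gwv (GZ (- c) _ _ Gwv1).
      rewrite !scaleNr wE => /GT e'.
      have -> : v + c *: (y - v1) = v - c *: v1 + c *: y.
        by rewrite scalerBr addrCA addrC.
      by rewrite raddfD /= e' raddfB /= subrK.
    exists 0 => w v c x Gwv e; rewrite scaler0 addr0.
    have [c0|c0] := eqVneq c 0.
      by move: e Gwv; rewrite c0 scale0r addr0 => -> /GT.
    case: no; exists (c^-1 *: w), (c^-1 *: v), (c^-1 *: x); split; first exact: GZ.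
    by rewrite linearZ /= -e scalerDr scalerA mulVf // scale1r.
  pose G2 : set (W * V) := fun p => exists w v c,
    G (w, v) /\ p = (w + c *: w0, v + c *: v0).
  case: (Gmax G2).
    split=> [[w v] Gwv|/(_ (w0, v0)) sub].
      by exists w, v, 0; rewrite !scale0r !addr0.
    by case: nw0; exists v0; apply: sub; exists 0, 0, 1; rewrite !scale1r !add0r.
  split.
  - move=> c _ _ [w [v [a [Gwv ->]]]] [w' [v' [a' [Gwv' ->]]]].
    exists (c *: w + w'), (c *: v + v'), (c * a + a').
    split; first by apply: (Gl c (w, v) (w', v')).
    by rewrite !scalerDl -!scalerA; congr (_, _) => /=; rewrite scalerDr addrACA.
  - move=> v [w [v' [c [Gwv' [/esym/eqP]]]]].
    have [->|c0] := eqVneq c 0.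
      by rewrite !scale0r !addr0 => /eqP w0' ->; apply: Gf; rewrite -w0'.
    rewrite addr_eq0 => /eqP wE; case: nw0; exists (- c^-1 *: v').
    suff -> : w0 = - c^-1 *: w by apply: GZ.
    by rewrite wE scalerN scaleNr opprK scalerA mulVf // scale1r.
  - by move=> x _ [w [v [c [Gwv [e ->]]]]]; rewrite (v0P w v c x).
have [S SG] := choice Gdom.
have Sl : linear S.
  move=> c x y; apply/eqP; rewrite -subr_eq0; apply/eqP/Gf.
  have := GD _ _ _ _ (SG (c *: x + y)) (GZ (-1) _ _ (GD _ _ _ _ (GZ c _ _ (SG x)) (SG y))).
  by rewrite !scaleN1r subrr.
pose SM := GRing.isLinear.Build k W V *:%R S Sl.
by exists (HB.pack S SM : {linear W -> V}) => x; apply: GT; apply: SG.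
Qed.
End GeneralizedInverse.

(** * Linear maps prescribed on homogeneous elements *)

Section GradedExtension.
Variables (k : fieldType) (A : bigraded k).
Implicit Types (s : seq (int * int)) (c : int * int -> A).

(** Vanishing of [c] off [s] lets two decompositions be moved to a common list of degrees, where
    they can be added and compared. *)
Definition components s c (x : A) : Prop :=
  [/\ forall d, homog d (c d), forall d, d \notin s -> c d = 0, uniq s
    & x = \sum_(d <- s) c d].

Lemma homogZ d (a : k) (x : A) : homog d x -> homog d (a *: x).
Proof. by move=> hx; rewrite -[_ *: _]addr0; apply: homogP => //; apply: homog0. Qed.

Lemma homogD d (x y : A) : homog d x -> homog d y -> homog d (x + y).
Proof. by move=> hx hy; rewrite -[x]scale1r; apply: homogP. Qed.

Lemma homogN d (x : A) : homog d x -> homog d (- x).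
Proof. by move=> hx; rewrite -scaleN1r; apply: homogZ. Qed.

Lemma homog_sum (I : Type) (r : seq I) (p : pred I) d (F : I -> A) :
  (forall i, p i -> homog d (F i)) -> homog d (\sum_(i <- r | p i) F i).
Proof.
move=> h; elim/big_rec: _ => [|i x pi hx]; first exact: homog0.
by apply: homogD => //; apply: h.
Qed.

Lemma components_widen s s' c x : components s c x -> uniq s' ->
  {subset s <= s'} -> components s' c x.
Proof.
case=> hc c0 us xE us' ss'; split=> // [d ds'|].
  by apply: c0; apply: contra ds' => /ss'.
rewrite (bigID (mem s)) /= [X in _ + X]big1 ?addr0 // -big_filter xE.
apply: perm_big; apply: uniq_perm => //; first exact: filter_uniq.
by move=> d; rewrite mem_filter; case: (boolP (d \in s)) => // /ss'.
Qed.

Lemma components_exist x : exists s c, components s c x.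
Proof.
have [s [v [hv xE]]] := homog_span x.
(* [homog_span] may list a degree several times; repetitions become multiplicities. *)
exists (undup s), (fun d => v d *+ count_mem d s); split.
- by move=> d; rewrite -scaler_nat; apply: homogZ.
- by move=> d; rewrite mem_undup => /count_memPn->.
- exact: undup_uniq.
- by rewrite xE -big_undup_iterop_count.
Qed.

Lemma components0 s c : components s c 0 -> forall d, c d = 0.
Proof.
case=> hc c0 us xE d; have [ds|/c0//] := boolP (d \in s).
by apply: (homog_indep us hc) => //; rewrite -xE.
Qed.

Lemma componentsP s c x s' c' y a : components s c x -> components s' c' y ->
  components (undup (s ++ s')) (fun d => a *: c d + c' d) (a *: x + y).
Proof.
move=> /components_widen/(_ (undup_uniq (s ++ s')))[d ds|hc c0 us ->].
  by rewrite mem_undup mem_cat ds.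
move=> /components_widen/(_ us)[d ds|hc' c0' _ ->].
  by rewrite mem_undup mem_cat ds orbT.
split=> // [d|d ds|]; first exact: homogP.
  by rewrite c0 // c0' // scaler0 addr0.
by rewrite scaler_sumr -big_split.
Qed.

Lemma components_homog d x : homog d x ->
  components [:: d] (fun e => if e == d then x else 0) x.
Proof.
move=> hx; split=> // [e|e|].
- by case: eqP => [->|_] //; apply: homog0.
- by rewrite inE => /negbTE->.
- by rewrite big_seq1 eqxx.
Qed.

(** Independence of the components makes a prescription in each degree consistent. The homogeneous
    projections, the homogeneous part of a generalized inverse and the parity operator all come from
    here. *)
Lemma graded_extension (B : lmodType k) (L : int * int -> {linear A -> B}) :
  exists F : {linear A -> B}, forall d x, homog d x -> F x = L d x.
Proof.
have [s /choice[c scP]] := choice components_exist.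
pose F x := \sum_(d <- s x) L d (c x d).
have FE s' c' x : components s' c' x -> F x = \sum_(d <- s') L d (c' d).
  move=> sc'; have := componentsP (-1) sc' (scP x).
  rewrite scaleN1r addNr => /components0 cc'.
  have {}cc' : c x =1 c'.
    by move=> d; apply/eqP; rewrite -subr_eq0 addrC -scaleN1r cc'.
  have su := undup_uniq (s x ++ s'); set S := undup _ in su.
  have wide (t : seq (int * int)) c1 : uniq t -> {subset t <= S} ->
      (forall d, d \notin t -> c1 d = 0) ->
      \sum_(d <- t) L d (c1 d) = \sum_(d <- S) L d (c1 d).
    move=> ut tS c0; rewrite [RHS](bigID (mem t)) /=.
    rewrite [X in _ + X]big1 ?addr0 => [|d /c0->]; last exact: raddf0.
    rewrite -[RHS]big_filter; apply: perm_big; apply: uniq_perm => //.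
      exact: filter_uniq.
    by move=> d; rewrite mem_filter; case: (boolP (d \in t)) => // /tS.
  rewrite /F; have [_ c0 us _] := scP x; have [_ c0' us' _] := sc'.
  rewrite (wide (s x)) // 1?(wide s') //.
  - by apply: eq_bigr => d _; rewrite cc'.
  - by move=> d ds; rewrite mem_undup mem_cat ds orbT.
  - by move=> d ds; rewrite mem_undup mem_cat ds.
have Fl : linear F.
  move=> a x y; rewrite (FE _ _ _ (componentsP a (scP x) (scP y))).
  rewrite (FE _ _ x (components_widen (scP x) (undup_uniq (s x ++ s y)) _)).
    rewrite (FE _ _ y (components_widen (scP y) (undup_uniq (s x ++ s y)) _)).
      by rewrite scaler_sumr -big_split; apply: eq_bigr => d _; rewrite linearP.
    by move=> d ds; rewrite mem_undup mem_cat ds orbT.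
  by move=> d ds; rewrite mem_undup mem_cat ds.
pose FM := GRing.isLinear.Build k A B *:%R F Fl.
exists (HB.pack F FM : {linear A -> B}) => d x /components_homog/FE /= ->.
by rewrite big_seq1 eqxx.
Qed.
End GradedExtension.

Lemma eq_homog (k : fieldType) (A : bigraded k) (B : lmodType k)
    (F G : A -> B) : linear F -> linear G ->
  (forall d x, homog d x -> F x = G x) -> F =1 G.
Proof.
move=> Fl Gl e x.
pose Fa : {linear A -> B} := HB.pack F (GRing.isLinear.Build k A B *:%R F Fl).
pose Ga : {linear A -> B} := HB.pack G (GRing.isLinear.Build k A B *:%R G Gl).
have [s [c [hc _ _ ->]]] := components_exist x.
rewrite -[F _]/(Fa _) -[G _]/(Ga _) !linear_sum; apply: eq_bigr => d _.
exact: e (hc d).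
Qed.

Section Kernel.
Variables (k : fieldType) (A : lmodType k) (P : {linear A -> A}).
Definition ker_pred : {pred A} := fun x => P x == 0.
Fact ker_pred_closed : submod_closed ker_pred.
Proof.
split=> [|a x y /eqP Px /eqP Py]; rewrite unfold_in ?raddf0 //.
by rewrite linearP Px Py scaler0 addr0.
Qed.
HB.instance Definition _ :=
  GRing.isSubmodClosed.Build k A ker_pred ker_pred_closed.
Record ker_type := KerType { ker_val : A; _ : ker_val \in ker_pred }.
HB.instance Definition _ := [isSub for ker_val].
HB.instance Definition _ := [Choice of ker_type by <:].
HB.instance Definition _ := [SubChoice_isSubLmodule of ker_type by <:].
Lemma ker_valK x : P (val (x : ker_type)) = 0.
Proof. by apply/eqP/(valP x). Qed.
End Kernel.

(** * A homotopy that splits off the squares *)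

Section SquareSplitting.
Variables (k : fieldType) (A : bicomplex k).
Local Notation d1 := (del A).
Local Notation d2 := (delb A).

Lemma delb_del x : d2 (d1 x) = - d1 (d2 x).
Proof. by apply/eqP; rewrite -addr_eq0 addrC del_delb. Qed.

Lemma homog_proj (d : int * int) : exists p : {linear A -> A},
  (forall x, homog d (p x)) /\
  forall e x, homog e x -> p x = if e == d then x else 0.
Proof.
have [p pP] := graded_extension
  (fun e => if e == d then (idfun : {linear A -> A}) else (\0 : {linear A -> A})).
exists p; split=> [x|e x /pP->]; last by case: eqP.
have [s [c [hc _ _ ->]]] := components_exist x; rewrite linear_sum.
apply: homog_sum => e _; rewrite (pP _ _ (hc e)); case: eqP => [<-|_] //=.
exact: homog0.
Qed.

Lemma graded_generalized_inverse : exists h : {linear A -> A},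
  (forall d x, homog d x -> homog (d + (-1, -1)) (h x)) /\
  forall x, d1 (d2 (h (d1 (d2 x)))) = d1 (d2 x).
Proof.
have [S SP] := generalized_inverse (d1 \o d2).
have {}SP x : d1 (d2 (S (d1 (d2 x)))) = d1 (d2 x) by exact: SP.
have [p pP] := choice homog_proj.
have [h hP] := graded_extension
  (fun d => (p (d + (-1, -1)) \o S) : {linear A -> A}).
exists h; split=> [d x /hP-> /=|]; first by case: (pP (d + (-1, -1))).
have pD d x : d1 (d2 (p d x)) = p (d + (1, 1)) (d1 (d2 x)).
  move: x; apply: (@eq_homog k A A (d1 \o d2 \o p d) (p (d + (1, 1)) \o d1 \o d2)).
  - exact: linearP.
  - exact: linearP.
  move=> e x hx /=; rewrite ((pP d).2 _ _ hx).
  rewrite ((pP (d + (1, 1))).2 _ _ (del_deg (delb_deg hx))).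
  rewrite -addrA -[_ + (1, 0)]/(1, 1) (inj_eq (addIr _)).
  by case: eqP; rewrite ?raddf0.
apply: (@eq_homog k A A (d1 \o d2 \o h \o d1 \o d2) (d1 \o d2)).
- exact: linearP.
- exact: linearP.
move=> d x hx /=; have hDx := del_deg (delb_deg hx).
rewrite (hP _ _ hDx) /= pD SP /= -addrA -[_ + (1, 1)]/(0 : int * int) addr0.
by rewrite ((pP _).2 _ _ hDx) eqxx.
Qed.

(** On the square spanned by h x, [h] kills three corners and sends the fourth, del delb h x, back
    to h x. These side conditions are what makes the projection built from [h] idempotent. *)
Lemma square_homotopy : exists h : {linear A -> A}, [/\
  forall d x, homog d x -> homog (d + (-1, -1)) (h x),
  forall x, h (d1 (d2 (h x))) = h x,
  (forall x, h (h x) = 0) /\ (forall x, h (d1 (h x)) = 0)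
    /\ (forall x, h (d2 (h x)) = 0) &
  forall x, d1 (d2 (h (d1 (d2 x)))) = d1 (d2 x)].
Proof.
have [h0 [h0_deg DhD]] := graded_generalized_inverse.
have [h hE] : exists h : {linear A -> A}, forall x, h x = h0 (d1 (d2 (h0 x))).
  by exists (h0 \o d1 \o d2 \o h0).
have hDh x : h (d1 (d2 (h x))) = h x by rewrite !hE !DhD.
have hD x : d1 (d2 (h (d1 (d2 x)))) = d1 (d2 x) by rewrite hE !DhD.
have h_deg d x : homog d x -> homog (d + (-1, -1)) (h x).
  rewrite hE => /h0_deg/delb_deg/del_deg/h0_deg.
  by rewrite -!addrA.
(* The corrected homotopy is r q. The factor [q] kills the image of [h] and fixes all d1 (h x) and
   d2 (h x); on these the added terms of [r] cancel the leading [h], because h d1 d2 h = h. On the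
   image of d1 d2 nothing changes. *)
have [q qE] : exists q : {linear A -> A}, forall x, q x = x - h (d1 (d2 x)).
  by exists (idfun \- (h \o d1 \o d2)).
have [r rE] : exists r : {linear A -> A},
    forall x, r x = h (x + (d1 (h (d2 x)) - d2 (h (d1 x)))).
  by exists (h \o (idfun \+ ((d1 \o h \o d2) \- (d2 \o h \o d1)))).
have rq_deg d x : homog d x -> homog (d + (-1, -1)) (r (q x)).
  move=> hx; have hqx : homog d (q x).
    rewrite qE; apply: homogD => //; apply: homogN.
    move: (h_deg _ _ (del_deg (delb_deg hx))).
    by rewrite -!addrA addr0.
  rewrite rE; apply: (h_deg); apply: homogD => //; apply: homogD; last apply: homogN.
    by move: (del_deg (h_deg _ _ (delb_deg hqx))); rewrite -!addrA addr0.
  by move: (delb_deg (h_deg _ _ (del_deg hqx))); rewrite -!addrA addr0.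
have rqh x : r (q (h x)) = 0 by rewrite qE hDh subrr raddf0.
have rqdh x : r (q (d1 (h x))) = 0.
  rewrite qE delb_del raddfN /= del_del oppr0 [h 0]raddf0 subr0 rE.
  by rewrite del_del [h 0]raddf0 [d2 0]raddf0 subr0 delb_del [h (- _)]raddfN [d1 (- _)]raddfN /= hDh subrr raddf0.
have rqdbh x : r (q (d2 (h x))) = 0.
  rewrite qE delb_delb [d1 0]raddf0 [h 0]raddf0 subr0 rE delb_delb [h 0]raddf0.
  by rewrite [d1 0]raddf0 sub0r hDh subrr raddf0.
have r_im x : exists y, r (q x) = h y by rewrite rE; eexists.
have rqD x : r (q (d1 (d2 x))) = h (d1 (d2 x)).
  have qD : q (d1 (d2 x)) = d1 (d2 x).
    by rewrite qE delb_del delb_delb [d1 0]raddf0 oppr0 [d1 0]raddf0 [h 0]raddf0 subr0.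
  by rewrite qD rE delb_del delb_delb del_del [d1 0]raddf0 oppr0 [h 0]raddf0 [d1 0]raddf0 [d2 0]raddf0 subr0 addr0.
exists (r \o q : {linear A -> A}); split=> [d x||| x] /=.
- exact: rq_deg.
- by move=> x; have [y ->] := r_im x; rewrite rqD hDh.
- by split; [|split] => x; have [y ->] := r_im x.
- by rewrite rqD hD.
Qed.
End SquareSplitting.

(** * The bicomplex on the kernel of a projection *)

Section KernelBicomplex.
Variables (k : fieldType) (A : bicomplex k) (P : {linear A -> A}).
Hypothesis PP : forall x, P (P x) = P x.
Hypothesis P_deg : forall d x, homog d x -> homog d (P x).
Hypothesis P_del : forall x, P (del A x) = del A (P x).
Hypothesis P_delb : forall x, P (delb A x) = delb A (P x).

Let K : lmodType k := ker_type P.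
Let in_ker x (Px : P x = 0) : K := KerType (introT eqP Px : x \in ker_pred P).

Definition ker_homog (d : int * int) (x : K) : Prop := homog d (val x).

Fact ker_homog0 d : ker_homog d 0.
Proof. exact: homog0. Qed.

Fact ker_homogP d (c : k) x y :
  ker_homog d x -> ker_homog d y -> ker_homog d (c *: x + y).
Proof. exact: homogP. Qed.

Fact projP x : P (x - P x) = 0.
Proof. by rewrite raddfB /= PP subrr. Qed.

Fact ker_homog_span x : exists (s : seq (int * int)) (v : int * int -> K),
  (forall d, ker_homog d (v d)) /\ x = \sum_(d <- s) v d.
Proof.
have [s [v [hv xE]]] := homog_span (val x).
(* The components of a kernel vector are pushed into the kernel by 1 - P; their sum does not change,
   since P kills it. *)
exists s, (fun d => in_ker (projP (v d))); split=> [d|].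
  by apply: homogD => //; apply/homogN/P_deg.
apply: val_inj; rewrite raddf_sum /= sumrB -linear_sum -xE.
by rewrite (ker_valK x) subr0.
Qed.

Fact ker_homog_indep (s : seq (int * int)) (v : int * int -> K) :
  uniq s -> (forall d, ker_homog d (v d)) -> \sum_(d <- s) v d = 0 ->
  forall d, d \in s -> v d = 0.
Proof.
move=> us hv /(congr1 val); rewrite raddf_sum /= => v0 d ds.
apply: val_inj; exact: (homog_indep us hv v0 ds).
Qed.

Definition ker_bigraded : bigraded k :=
  Bigraded ker_homog0 ker_homogP ker_homog_span ker_homog_indep.

Section Restriction.
Variable D : {linear A -> A}.
Hypothesis PD : forall x, P (D x) = D (P x).

Fact ker_restr_subproof (x : K) : P (D (val x)) = 0.
Proof. by rewrite PD (ker_valK x) raddf0. Qed.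

Definition ker_restr (x : K) : K := in_ker (ker_restr_subproof x).

Fact ker_restr_linear : linear ker_restr.
Proof. by move=> c x y; apply: val_inj; rewrite /= linearP. Qed.

HB.instance Definition _ :=
  GRing.isLinear.Build k K K *:%R ker_restr ker_restr_linear.
End Restriction.

Definition ker_del : {linear ker_bigraded -> ker_bigraded} := ker_restr P_del.
Definition ker_delb : {linear ker_bigraded -> ker_bigraded} := ker_restr P_delb.

Definition ker_bicomplex : bicomplex k.
Proof.
apply: (@Bicomplex k ker_bigraded ker_del ker_delb).
- by move=> d x; apply: del_deg.
- by move=> d x; apply: delb_deg.
- by move=> x; apply/val_inj/del_del.
- by move=> x; apply/val_inj/delb_delb.
- by move=> x; apply/val_inj/del_delb.
Defined.

Definition ker_incl (x : ker_bicomplex) : A := val (x : K).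
Definition ker_proj (x : A) : ker_bicomplex := in_ker (projP x).

Lemma ker_incl_mor : bicomplex_mor ker_incl.
Proof. by split. Qed.

Lemma ker_proj_mor : bicomplex_mor ker_proj.
Proof.
split.
- move=> c x y; apply: val_inj => /=.
  by rewrite linearP scalerBr opprD addrACA.
- by move=> d x hx; apply: homogD => //; apply/homogN/P_deg.
- by move=> x; apply: val_inj; rewrite /= P_del raddfB.
- by move=> x; apply: val_inj; rewrite /= P_delb raddfB.
Qed.

Lemma ker_projK : cancel ker_incl ker_proj.
Proof. by move=> x; apply: val_inj; rewrite /= (ker_valK (x : K)) subr0. Qed.
End KernelBicomplex.

(** * The contraction and the weak equivalence that it gives *)

Section Contraction.
Variable k : fieldType.

Lemma gcomm_gcommE (A : bicomplex k) (h : A -> A) x : linear h ->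
  gcomm (del A) (-1) (gcomm (delb A) (-2) h) x =
  del A (delb A (h x)) - del A (h (delb A x)) + delb A (h (del A x))
    + h (del A (delb A x)).
Proof.
move=> hl; pose H : {linear A -> A} := HB.pack h (GRing.isLinear.Build k A A *:%R h hl).
have s1 : sgn k (-1) = -1 by rewrite /sgn exprN1 invrN1.
have s2 : sgn k (-2) = 1 by rewrite /sgn /exprz /= sqrrN expr1n invr1.
rewrite /gcomm s1 s2 !scale1r scaleN1r opprK.
rewrite raddfB /= addrA; congr (_ + _).
by rewrite delb_del -[h _]/(H _) raddfN opprK.
Qed.

Lemma minimal_contraction (A : bicomplex k) :
  exists (H : bicomplex k) (f : A -> H) (g : H -> A) (h : A -> A),
    minimal H /\ contraction f g h.
Proof.
have [h [h_deg hDh [hh [hdh hdbh]] DhD]] := square_homotopy A.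
pose d1 := del A; pose d2 := delb A.
have [P PE] : exists P : {linear A -> A}, forall x,
    P x = d1 (d2 (h x)) - d1 (h (d2 x)) + d2 (h (d1 x)) + h (d1 (d2 x)).
  by exists ((((d1 \o d2 \o h) \- (d1 \o h \o d2)) \+ (d2 \o h \o d1)) \+ (h \o d1 \o d2)).
have d21 x : d2 (d1 x) = - d1 (d2 x) by exact: delb_del.
have d11 x : d1 (d1 x) = 0 by exact: del_del.
have d22 x : d2 (d2 x) = 0 by exact: delb_delb.
have d0 : [/\ d1 0 = 0, d2 0 = 0 & h 0 = 0] by split; apply: raddf0.
have [d10 d20 h0] := d0.
have dN x : [/\ d1 (- x) = - d1 x, d2 (- x) = - d2 x & h (- x) = - h x].
  by split; apply: raddfN.
have d1N x : d1 (- x) = - d1 x by case: (dN x).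
have d2N x : d2 (- x) = - d2 x by case: (dN x).
have hN x : h (- x) = - h x by case: (dN x).
have d1D x y : d1 (x + y) = d1 x + d1 y by exact: raddfD.
have d2D x y : d2 (x + y) = d2 x + d2 y by exact: raddfD.
have P_del x : P (d1 x) = d1 (P x).
  rewrite PE d11 h0 d20 addr0 d21 d1N d11 oppr0 h0 addr0 hN d1N opprK.
  by rewrite [P x]PE !d1D d1N !d11 oppr0 !add0r.
have P_delb x : P (d2 x) = d2 (P x).
  rewrite PE d22 h0 d10 subr0 h0 addr0.
  by rewrite [P x]PE !d2D d2N !d21 !d22 !d10 oppr0 add0r opprK addr0.
(* Three of the four terms vanish by the side conditions; the last one is h d1 d2 h = h. *)
have Ph x : P (h x) = h x.
  by rewrite PE hh hdh hdbh hDh d20 d10 subrr !add0r.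
have PDx x y : P (x + y) = P x + P y by exact: raddfD.
have PNx x : P (- x) = - P x by exact: raddfN.
(* [P] commutes with [d1] and [d2] and fixes the image of [h], and every term of P x is obtained
   from that image by [d1] and [d2]. *)
have PP x : P (P x) = P x.
  rewrite [P x in LHS]PE !PDx PNx !P_del !P_delb !Ph.
  by rewrite PE.
have P_deg d x : homog d x -> homog d (P x).
  move=> hx; rewrite PE; apply: homogD.
    apply: homogD; first apply: homogD.
    - by move: (del_deg (delb_deg (h_deg _ _ hx))); rewrite -!addrA addr0.
    - by apply/homogN; move: (del_deg (h_deg _ _ (delb_deg hx))); rewrite -!addrA addr0.
    - by move: (delb_deg (h_deg _ _ (del_deg hx))); rewrite -!addrA addr0.
  by move: (h_deg _ _ (del_deg (delb_deg hx))); rewrite -!addrA addr0.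
exists (ker_bicomplex PP P_deg P_del P_delb), (ker_proj PP P_deg P_del P_delb).
exists (@ker_incl _ _ _ PP P_deg P_del P_delb), (\- h); split.
  move=> x; apply: val_inj => /=.
  (* Since [P] fixes the image of d1 d2 and commutes with d1 d2, this operator vanishes on the
     kernel of [P]. *)
  have PD y : P (d1 (d2 y)) = d1 (d2 y).
    by rewrite PE d21 d22 d10 oppr0 d11 h0 d10 d20 h0 subr0 !addr0 DhD.
  by rewrite -[LHS]PD P_del P_delb (ker_valK x) d20 d10.
split.
- exact: ker_proj_mor.
- exact: ker_incl_mor.
- exact: linearP.
- by move=> d x hx; apply/homogN/h_deg.
- exact: ker_projK.
move=> x; rewrite gcomm_gcommE; last exact: linearP.
rewrite /= /ker_incl /= addrC addKr PE !opprD !opprK.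
by rewrite -/d1 -/d2 d2N !d1N d2N !opprK.
Qed.

(** Injectivity is f g = id. For surjectivity x - g (f x) is written out as minus [del, [delb, h]]:
    on a Bott-Chern cycle only the term in del delb h survives, and on an Aeppli cycle the term in h
    del delb dies, which leaves an element of im del + im delb. *)
Lemma contraction_weq (A H : bicomplex k) (f : A -> H) (g : H -> A) (h : A -> A) :
  contraction f g h -> pluripotential_weq g.
Proof.
case=> [[fl _ f_del f_delb] gm hl _ fg gf].
have := gm; case=> gl _ g_del g_delb.
have gfE x : x - g (f x) = del A (- delb A (h x) + h (delb A x))
   + delb A (- h (del A x)) - h (del A (delb A x)).
  have -> : x - g (f x) = - (g (f x) - x) by rewrite opprB.
  by rewrite gf gcomm_gcommE // !opprD opprK [in RHS]raddfD !raddfN.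
split=> //; split.
- move=> x _ [y gxE]; exists (f y).
  by rewrite -f_delb -f_del -gxE fg.
- move=> y [dy dby]; exists (f y).
    split; rewrite -?f_del -?f_delb ?dy ?dby.
    + by have := fl (-1) 0 0; rewrite scaleN1r addNr scaleN1r addNr.
    + by have := fl (-1) 0 0; rewrite scaleN1r addNr scaleN1r addNr.
  have h0 : h 0 = 0.
    by have := hl (-1) 0 0; rewrite scaleN1r addNr scaleN1r addNr.
  exists (- h y); rewrite gfE dy dby [del A 0]raddf0 !h0.
  by rewrite !oppr0 [delb A 0]raddf0 !addr0 [delb A (- _)]raddfN.
- move=> x _ [y [z gxE]]; exists (f y), (f z).
  by rewrite -[LHS]fg gxE -f_del -f_delb -[f (_ y)]scale1r -fl scale1r.
- move=> y; rewrite /Ae_cycle => dy; exists (f y).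
    rewrite /Ae_cycle -f_delb -f_del dy.
    by have := fl (-1) 0 0; rewrite scaleN1r addNr scaleN1r addNr.
  have h0 : h 0 = 0.
    by have := hl (-1) 0 0; rewrite scaleN1r addNr scaleN1r addNr.
  by eexists; eexists; rewrite gfE dy h0 subr0.
Qed.
End Contraction.

(** * Coefficients in the variables s, t and eps *)

Section DiagonalSums.
Variable U : zmodType.
Implicit Types F G : nat -> nat -> U.

(* The sum of F i j over i + j = a, as a sum over the splittings of a list of
   length a. *)
Definition dsum F a : U :=
  ssum (fun u v : seq unit => F (size u) (size v)) (nseq a tt).

Lemma eq_dsum F G a : (forall i j, (i + j)%N = a -> F i j = G i j) ->
  dsum F a = dsum G a.
Proof.
move=> e; apply: eq_ssum => u v a_uv; apply: e.
by rewrite -size_cat -a_uv size_nseq.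
Qed.

Lemma dsumD F G a : dsum (fun i j => F i j + G i j) a = dsum F a + dsum G a.
Proof. exact: ssumD. Qed.

Lemma dsum_zero a : dsum (fun _ _ => 0) a = 0.
Proof. exact: ssum0. Qed.

Lemma dsumS F a : dsum F a.+1 = F 0%N a.+1 + dsum (fun i => F i.+1) a.
Proof. by rewrite /dsum /= size_nseq. Qed.

Lemma dsum0 F : dsum F 0 = F 0%N 0%N.
Proof. by rewrite /dsum /= addr0. Qed.

Lemma dsum_coassoc (F : nat -> nat -> nat -> U) a :
  dsum (fun i j => dsum (fun i1 i2 => F i1 i2 j) i) a =
  dsum (fun i j => dsum (F i) j) a.
Proof.
have nseqE (u : seq unit) : nseq (size u) tt = u by elim: u => [|[] u /= ->].
rewrite /dsum; transitivity (ssum (fun u v => ssum (fun u1 u2 =>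
  F (size u1) (size u2) (size v)) u) (nseq a tt)).
  by apply: eq_ssum => u v _; rewrite nseqE.
rewrite (ssum_coassoc (fun u v w => F (size u) (size v) (size w))).
by apply: eq_ssum => u v _; rewrite nseqE.
Qed.

Lemma dsum_shiftl F c a :
  dsum (fun i j => if (c <= i)%N then F (i - c)%N j else 0) a
  = if (c <= a)%N then dsum F (a - c) else 0.
Proof.
elim: a c => [|a IH] [|c]; rewrite ?subn0.
- by apply: eq_dsum => i j _; rewrite subn0.
- by rewrite dsum0.
- by apply: eq_dsum => i j _; rewrite subn0.
- by rewrite dsumS add0r; apply: IH.
Qed.

Lemma dsum_shiftr F c a :
  dsum (fun i j => if (c <= j)%N then F i (j - c)%N else 0) a
  = if (c <= a)%N then dsum F (a - c) else 0.
Proof.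
elim: a F c => [|a IH] F c.
  by rewrite dsum0; case: c => [|c] //=; rewrite dsum0.
rewrite dsumS (IH (fun i => F i.+1)); case: (ltngtP c a.+1) => [ca|ca|->].
- by rewrite -[(c <= a)%N]ltnS ca subSn // dsumS.
- by rewrite leqNgt (ltn_trans _ ca) // addr0.
- by rewrite ltnn addr0 subnn dsum0.
Qed.

Lemma dsum_big F a : dsum F a = \sum_(i < a.+1) F i (a - i)%N.
Proof.
rewrite /dsum ssum_big size_nseq; apply: eq_bigr => i _.
by rewrite size_takel ?size_drop size_nseq // -ltnS.
Qed.

Lemma dsumC F a : dsum F a = dsum (fun i j => F j i) a.
Proof.
rewrite !dsum_big (reindex_inj rev_ord_inj) /=; apply: eq_bigr => i _.
by rewrite !subSS subKn // -ltnS.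
Qed.

(** Bridge to the structure equations, which sum over a fixed window of bidegrees and not over a
    diagonal. *)
Lemma dsum_window F a n : (a < n)%N ->
  \sum_(i < n) (if (i <= a)%N then F i (a - i)%N else 0) = dsum F a.
Proof.
move=> an; rewrite dsum_big (big_ord_widen n (fun i => F i (a - i)%N)) // [RHS]big_mkcond.
by apply: eq_bigr => i _; rewrite ltnS.
Qed.
End DiagonalSums.

Lemma dsum_raddf (U U' : zmodType) (f : U -> U') (F : nat -> nat -> U) a :
  zmod_morphism f -> f (dsum F a) = dsum (fun i j => f (F i j)) a.
Proof. exact: ssum_raddf. Qed.

Lemma dsum_swap (U : zmodType) (F : nat -> nat -> nat -> nat -> U) a b :
  dsum (fun i j => dsum (F i j) b) a
  = dsum (fun i' j' => dsum (fun i j => F i j i' j') a) b.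
Proof. exact: (ssum_swap (fun u v u' v' => F (size u) (size v) (size u') (size v'))). Qed.

(* x e i j is the coefficient of eps^e s^i t^j, with eps written on the left;
   this is why odd maps change sign on the eps part. *)
Definition coef (A : Type) : Type := bool -> nat -> nat -> A.
HB.instance Definition _ (k : fieldType) (A : lmodType k) :=
  GRing.Lmodule.copy (coef A) (bool -> nat -> nat -> A).

Section CoefficientOperators.
Variable (k : fieldType).
Implicit Types A B C : lmodType k.

(** [shift i j] is multiplication by s^i t^j, [eps] left multiplication by the odd variable, and
    [weigh w], for additive [w], a combination of s d/ds and t d/dt. No finiteness is imposed:
    elements are formal power series in s and t. *)
Definition shift A i j (x : coef A) : coef A := fun e a b =>
  if (i <= a)%N && (j <= b)%N then x e (a - i)%N (b - j)%N else 0.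
Definition eps A (x : coef A) : coef A := fun e => if e then x false else 0.
Definition coef_const A (v : A) : coef A := fun e a b =>
  if [&& ~~ e, a == 0%N & b == 0%N] then v else 0.
Definition even_lift A B (t : A -> B) (x : coef A) : coef B :=
  fun e a b => t (x e a b).
Definition odd_lift A B (t : A -> B) (x : coef A) : coef B :=
  fun e a b => if e then - t (x e a b) else t (x e a b).
Definition weigh A (w : nat -> nat -> k) (x : coef A) : coef A :=
  fun e a b => w a b *: x e a b.

Lemma coefP A (x y : coef A) : (forall e a b, x e a b = y e a b) -> x = y.
Proof. by move=> xy; apply: funext => e; apply: funext => a; apply: funext => b. Qed.

Lemma coefBE A (x y : coef A) e a b : (x - y) e a b = x e a b - y e a b.
Proof. by []. Qed.
Lemma coefDE A (x y : coef A) e a b : (x + y) e a b = x e a b + y e a b.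
Proof. by []. Qed.
Lemma coefNE A (x : coef A) e a b : (- x) e a b = - x e a b.
Proof. by []. Qed.
Lemma coefZE A c (x : coef A) e a b : (c *: x) e a b = c *: x e a b.
Proof. by []. Qed.
Lemma coef0E A e a b : (0 : coef A) e a b = 0.
Proof. by []. Qed.

Lemma shiftB A i j : zmod_morphism (@shift A i j).
Proof.
move=> x y; apply: coefP => e a b; rewrite coefBE /shift.
by case: ifP => _; rewrite ?coefBE ?subr0.
Qed.

Lemma epsB A : zmod_morphism (@eps A).
Proof.
by move=> x y; apply: coefP => -[] a b; rewrite ?coefBE /= ?coefBE ?subr0.
Qed.

Lemma even_liftB A B (t : A -> B) :
  zmod_morphism t -> zmod_morphism (even_lift t).
Proof. by move=> tB x y; apply: coefP => e a b; apply: tB. Qed.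

Lemma odd_liftB A B (t : A -> B) :
  zmod_morphism t -> zmod_morphism (odd_lift t).
Proof.
move=> tB x y; apply: coefP => -[] a b; rewrite coefBE /odd_lift coefBE tB //.
by rewrite opprD.
Qed.

Lemma shiftZ A i j : scalable (@shift A i j).
Proof.
move=> c x; apply: coefP => e a b; rewrite coefZE /shift.
by case: ifP => _; rewrite ?scaler0.
Qed.

Lemma epsZ A : scalable (@eps A).
Proof. by move=> c x; apply: coefP => -[] a b //=; rewrite [RHS]scaler0. Qed.

Lemma even_liftZ A B (t : A -> B) : scalable t -> scalable (even_lift t).
Proof. by move=> tZ c x; apply: coefP => e a b; apply: tZ. Qed.

Lemma odd_liftZ A B (t : A -> B) : scalable t -> scalable (odd_lift t).
Proof.
move=> tZ c x; apply: coefP => -[] a b; last exact: tZ.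
by rewrite coefZE /odd_lift tZ scalerN.
Qed.

Lemma weighB A w : zmod_morphism (@weigh A w).
Proof. by move=> x y; apply: coefP => e a b; rewrite coefBE /weigh -scalerBr. Qed.

Lemma shift_shift A i j i' j' (x : coef A) :
  shift i j (shift i' j' x) = shift (i + i') (j + j') x.
Proof.
apply: coefP => e a b; rewrite /shift !subnDA.
case: (boolP (i + i' <= a)%N) => ia; case: (boolP (j + j' <= b)%N) => jb /=;
  do ?[case: ifP => //]; rewrite ?if_same //; lia.
Qed.

Lemma even_lift_shift A B (t : A -> B) i j x : zmod_morphism t ->
  even_lift t (shift i j x) = shift i j (even_lift t x).
Proof.
move=> tB; apply: coefP => e a b; rewrite /even_lift /shift.
by case: ifP => // _; rewrite (zmod0 tB).
Qed.

Lemma odd_lift_shift A B (t : A -> B) i j x : zmod_morphism t ->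
  odd_lift t (shift i j x) = shift i j (odd_lift t x).
Proof.
move=> tB; apply: coefP => e a b; rewrite /odd_lift /shift.
by case: (_ && _); rewrite // (zmod0 tB) oppr0 if_same.
Qed.

Lemma odd_lift_comp A B C (t : B -> C) (u : A -> B) x : zmod_morphism t ->
  odd_lift t (odd_lift u x) = even_lift (t \o u) x.
Proof.
move=> tB; apply: coefP => -[] a b; rewrite /odd_lift /even_lift //=.
by rewrite (zmodN tB) opprK.
Qed.

Lemma odd_lift_eps A B (t : A -> B) x : zmod_morphism t ->
  odd_lift t (eps x) = - eps (odd_lift t x).
Proof.
move=> tB; apply: coefP => -[] a b //.
by rewrite -[LHS]/(t 0) -[RHS]/(- 0) oppr0 (zmod0 tB).
Qed.

Lemma even_lift_eps A B (t : A -> B) x : zmod_morphism t ->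
  even_lift t (eps x) = eps (even_lift t x).
Proof.
move=> tB; apply: coefP => -[] a b //=.
exact: zmod0.
Qed.

Lemma eps_shift A i j (x : coef A) : eps (shift i j x) = shift i j (eps x).
Proof. by apply: coefP => -[] a b //=; rewrite /shift /= if_same. Qed.

Lemma eps_eps A (x : coef A) : eps (eps x) = 0.
Proof. by apply: coefP => -[] a b. Qed.

Lemma weigh_eps A w (x : coef A) : weigh w (eps x) = eps (weigh w x).
Proof. by apply: coefP => -[] a b //=; apply: scaler0. Qed.

Lemma weigh_odd_lift A B (t : A -> B) w x : scalable t ->
  weigh w (odd_lift t x) = odd_lift t (weigh w x).
Proof.
by move=> tZ; apply: coefP => -[] a b; rewrite /odd_lift /weigh tZ ?scalerN.
Qed.

Lemma weigh_even_lift A B (t : A -> B) w x : scalable t ->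
  weigh w (even_lift t x) = even_lift t (weigh w x).
Proof. by move=> tZ; apply: coefP => e a b; rewrite /even_lift /weigh tZ. Qed.

(** Leibniz rule for the derivation [weigh w], which multiplies s^i t^j by w i j. *)
Lemma weigh_shift A w i j (x : coef A) :
  (forall a b a' b', w (a + a')%N (b + b')%N = w a b + w a' b') ->
  weigh w (shift i j x) = shift i j (weigh w x) + w i j *: shift i j x.
Proof.
move=> wD; apply: coefP => e a b; rewrite coefDE coefZE /weigh /shift.
case: ifP => [/andP[ia jb]|_]; last by rewrite !scaler0 addr0.
by rewrite -scalerDl -wD !subnK.
Qed.
End CoefficientOperators.

(** * The product with coefficients in s, t and eps *)

Section CoefficientProduct.
Variables (k : fieldType) (A : lmodType k) (mul : A -> A -> A) (sig : A -> A).
Hypothesis mulBl : forall y, zmod_morphism (mul^~ y).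
Hypothesis mulBr : forall x, zmod_morphism (mul x).
Hypothesis mulA : associative mul.
Hypothesis sigB : zmod_morphism sig.
Hypothesis sigK : involutive sig.
Hypothesis sig_mul : forall x y, sig (mul x y) = mul (sig x) (sig y).
Implicit Types (u v w : nat -> nat -> A) (x y z : coef A).

Definition conv u v a b : A :=
  dsum (fun i i' => dsum (fun j j' => mul (u i j) (v i' j')) b) a.

(** The twist [sig] is the sign of moving eps leftwards past [x]. *)
Definition cmul x y : coef A := fun e a b =>
  if e then conv (x true) (y false) a b
            + conv (fun i j => sig (x false i j)) (y true) a b
  else conv (x false) (y false) a b.

Lemma eq_conv u v u' v' a b :
  (forall i j, u i j = u' i j) -> (forall i j, v i j = v' i j) ->
  conv u v a b = conv u' v' a b.
Proof. by move=> eu ev; do 2!apply: eq_dsum => ? ? _; rewrite eu ev. Qed.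

Lemma convA u v w a b : conv (conv u v) w a b = conv u (conv v w) a b.
Proof.
transitivity (dsum (fun i i' => dsum (fun i1 i2 => dsum (fun j j' =>
    dsum (fun j1 j2 => mul (mul (u i1 j1) (v i2 j2)) (w i' j')) j) b) i) a).
  apply: eq_dsum => i i' _; rewrite -dsum_swap; apply: eq_dsum => j j' _.
  rewrite /conv (dsum_raddf _ _ (mulBl _)); apply: eq_dsum => i1 i2 _.
  by rewrite (dsum_raddf _ _ (mulBl _)).
rewrite dsum_coassoc; apply: eq_dsum => i1 i' _.
transitivity (dsum (fun i2 i3 => dsum (fun j1 j' => dsum (fun j2 j3 =>
    mul (u i1 j1) (mul (v i2 j2) (w i3 j3))) j') b) i').
  apply: eq_dsum => i2 i3 _; rewrite dsum_coassoc.
  by do 2!apply: eq_dsum => ? ? _; rewrite mulA.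
rewrite dsum_swap; apply: eq_dsum => j1 j' _.
rewrite /conv (dsum_raddf _ _ (mulBr _)); apply: eq_dsum => i2 i3 _.
by rewrite (dsum_raddf _ _ (mulBr _)).
Qed.

Lemma convBl u u' v a b :
  conv (fun i j => u i j - u' i j) v a b = conv u v a b - conv u' v a b.
Proof.
rewrite /conv /dsum -ssumB; apply: eq_ssum => ? ? _.
by rewrite -ssumB; apply: eq_ssum => ? ? _; rewrite mulBl.
Qed.

Lemma convBr u v v' a b :
  conv u (fun i j => v i j - v' i j) a b = conv u v a b - conv u v' a b.
Proof.
rewrite /conv /dsum -ssumB; apply: eq_ssum => ? ? _.
by rewrite -ssumB; apply: eq_ssum => ? ? _; rewrite mulBr.
Qed.

Lemma conv0l v a b : conv (fun _ _ => 0) v a b = 0.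
Proof. by have := convBl (fun _ _ => 0) (fun _ _ => 0) v a b; rewrite !subr0 subrr. Qed.

Lemma conv0r u a b : conv u (fun _ _ => 0) a b = 0.
Proof. by have := convBr u (fun _ _ => 0) (fun _ _ => 0) a b; rewrite !subr0 subrr. Qed.

Lemma convNl u v a b : conv (fun i j => - u i j) v a b = - conv u v a b.
Proof.
rewrite -sub0r -(conv0l v a b) -convBl.
by apply: eq_conv => i j; rewrite ?sub0r.
Qed.

Lemma convNr u v a b : conv u (fun i j => - v i j) a b = - conv u v a b.
Proof.
rewrite -sub0r -(conv0r u a b) -convBr.
by apply: eq_conv => i j; rewrite ?sub0r.
Qed.

Lemma convDl u u' v a b :
  conv (fun i j => u i j + u' i j) v a b = conv u v a b + conv u' v a b.
Proof.
rewrite -[conv u' v a b]opprK -convNl -convBl.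
by apply: eq_conv => i j; rewrite ?opprK.
Qed.

Lemma convDr u v v' a b :
  conv u (fun i j => v i j + v' i j) a b = conv u v a b + conv u v' a b.
Proof.
rewrite -[conv u v' a b]opprK -convNr -convBr.
by apply: eq_conv => i j; rewrite ?opprK.
Qed.

Lemma conv_morph (t : A -> A) u v a b : zmod_morphism t ->
  (forall p q, t (mul p q) = mul (t p) (t q)) ->
  t (conv u v a b) = conv (fun i j => t (u i j)) (fun i j => t (v i j)) a b.
Proof.
move=> tB tM; rewrite /conv (dsum_raddf _ _ tB); apply: eq_dsum => i i' _.
by rewrite (dsum_raddf _ _ tB); apply: eq_dsum => j j' _.
Qed.

Lemma cmulBl y : zmod_morphism (cmul^~ y).
Proof.
move=> x x'; apply: coefP => -[] a b; rewrite coefBE /cmul /=; last exact: convBl.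
rewrite opprD addrACA -convBl -convBl; congr (_ + _).
by apply: eq_conv => i j //; rewrite coefBE sigB.
Qed.

Lemma cmulBr x : zmod_morphism (cmul x).
Proof.
move=> y y'; apply: coefP => -[] a b; rewrite coefBE /cmul /=; last exact: convBr.
by rewrite opprD addrACA -convBr -convBr.
Qed.

Lemma cmulZl (c : k) x y : (forall p q, mul (c *: p) q = c *: mul p q) ->
  (forall p, sig (c *: p) = c *: sig p) -> cmul (c *: x) y = c *: cmul x y.
Proof.
have ZB : zmod_morphism (fun z : A => c *: z).
  by move=> z z'; rewrite scalerBr.
move=> mulZ sigZ; have convZ u v a b :
    conv (fun i j => c *: u i j) v a b = c *: conv u v a b.
  rewrite /conv (dsum_raddf _ _ ZB); apply: eq_dsum => i i' _.
  by rewrite (dsum_raddf _ _ ZB); apply: eq_dsum => j j' _; rewrite mulZ.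
apply: coefP => -[] a b; rewrite coefZE /cmul; last exact: convZ.
rewrite scalerDr -!convZ; congr (_ + _).
by apply: eq_conv => i j //; rewrite coefZE sigZ.
Qed.

Lemma cmulZr (c : k) x y : (forall p q, mul p (c *: q) = c *: mul p q) ->
  cmul x (c *: y) = c *: cmul x y.
Proof.
have ZB : zmod_morphism (fun z : A => c *: z).
  by move=> z z'; rewrite scalerBr.
move=> mulZ; have convZ u v a b :
    conv u (fun i j => c *: v i j) a b = c *: conv u v a b.
  rewrite /conv (dsum_raddf _ _ ZB); apply: eq_dsum => i i' _.
  by rewrite (dsum_raddf _ _ ZB); apply: eq_dsum => j j' _; rewrite mulZ.
apply: coefP => -[] a b; rewrite coefZE /cmul; last exact: convZ.
by rewrite scalerDr -!convZ.
Qed.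

Lemma cmulA : associative cmul.
Proof.
move=> x y z; apply: coefP => -[] a b; rewrite /cmul; last by rewrite convA.
rewrite convDl convDr -addrA !convA; congr (_ + (_ + _)).
rewrite -convA; apply: eq_conv => i j //.
by rewrite (conv_morph _ _ _ _ sigB sig_mul).
Qed.

Lemma odd_lift_sigK : involutive (odd_lift sig).
Proof.
by move=> x; apply: coefP => -[] a b; rewrite /odd_lift ?(zmodN sigB) ?opprK sigK.
Qed.

Lemma odd_lift_sig_mul x y :
  odd_lift sig (cmul x y) = cmul (odd_lift sig x) (odd_lift sig y).
Proof.
apply: coefP => -[] a b; rewrite /odd_lift /cmul; last exact: conv_morph.
rewrite (zmodD sigB) !(conv_morph _ _ _ _ sigB sig_mul) opprD.
by rewrite convNl convNr.
Qed.

Let sh i j u a b :=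
  if (i <= a)%N && (j <= b)%N then u (a - i)%N (b - j)%N else 0.

Lemma conv_shiftl i j u v a b :
  conv (sh i j u) v a b = sh i j (conv u v) a b.
Proof.
rewrite /conv /sh; transitivity (dsum (fun i1 i2 => if (i <= i1)%N then
    (if (j <= b)%N then
       dsum (fun j1 j2 => mul (u (i1 - i)%N j1) (v i2 j2)) (b - j) else 0)
    else 0) a).
  apply: eq_dsum => i1 i2 _; case: (i <= i1)%N => /=.
    rewrite -dsum_shiftl; apply: eq_dsum => j1 j2 _.
    by case: (j <= j1)%N; rewrite // (zmod0 (mulBl _)).
  by rewrite -[RHS](dsum_zero A b); apply: eq_dsum => *; rewrite (zmod0 (mulBl _)).
rewrite (dsum_shiftl (fun i1 i2 => if (j <= b)%N then
  dsum (fun j1 j2 => mul (u i1 j1) (v i2 j2)) (b - j) else 0)).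
by case: (j <= b)%N; rewrite ?andbT // andbF dsum_zero if_same.
Qed.

Lemma conv_shiftr i j u v a b :
  conv u (sh i j v) a b = sh i j (conv u v) a b.
Proof.
rewrite /conv /sh; transitivity (dsum (fun i1 i2 => if (i <= i2)%N then
    (if (j <= b)%N then
       dsum (fun j1 j2 => mul (u i1 j1) (v (i2 - i)%N j2)) (b - j) else 0)
    else 0) a).
  apply: eq_dsum => i1 i2 _; case: (i <= i2)%N => /=.
    rewrite -dsum_shiftr; apply: eq_dsum => j1 j2 _.
    by case: (j <= j2)%N; rewrite // (zmod0 (mulBr _)).
  by rewrite -[RHS](dsum_zero A b); apply: eq_dsum => *; rewrite (zmod0 (mulBr _)).
rewrite (dsum_shiftr (fun i1 i2 => if (j <= b)%N then
  dsum (fun j1 j2 => mul (u i1 j1) (v i2 j2)) (b - j) else 0)).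
by case: (j <= b)%N; rewrite ?andbT // andbF dsum_zero if_same.
Qed.

Lemma cmul_shiftl i j x y : cmul (shift i j x) y = shift i j (cmul x y).
Proof.
apply: coefP => -[] a b; last exact: conv_shiftl.
rewrite /cmul conv_shiftl.
have -> : conv (fun i0 j0 => sig (shift i j x false i0 j0)) (y true) a b
        = conv (sh i j (fun i0 j0 => sig (x false i0 j0))) (y true) a b.
  by apply: eq_conv => i0 j0 //; rewrite /shift /sh; case: ifP; rewrite // (zmod0 sigB).
by rewrite conv_shiftl /shift /sh; case: ifP; rewrite ?addr0.
Qed.

Lemma cmul_shiftr i j x y : cmul x (shift i j y) = shift i j (cmul x y).
Proof.
apply: coefP => -[] a b; last exact: conv_shiftr.
rewrite /cmul !conv_shiftr /shift /sh.
by case: ifP; rewrite ?addr0.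
Qed.

Lemma cmul_epsl x y : cmul (eps x) y = eps (cmul x y).
Proof.
apply: coefP => -[] a b; last exact: conv0l.
rewrite /cmul /= -[RHS]addr0; congr (_ + _).
rewrite -[RHS](conv0l (y true) a b); apply: eq_conv => i j //.
exact: (zmod0 sigB).
Qed.

Lemma cmul_epsr x y : cmul x (eps y) = eps (cmul (odd_lift sig x) y).
Proof.
apply: coefP => -[] a b; last exact: conv0r.
by rewrite /cmul /= conv0r add0r.
Qed.

Lemma odd_lift_derivation (d : A -> A) x y : zmod_morphism d ->
  (forall p q, d (mul p q) = mul (d p) q + mul (sig p) (d q)) ->
  (forall p, d (sig p) = - sig (d p)) ->
  odd_lift d (cmul x y) =
  cmul (odd_lift d x) y + cmul (odd_lift sig x) (odd_lift d y).
Proof.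
move=> dB dM dsig.
have d_conv u v a b : d (conv u v a b) = conv (fun i j => d (u i j)) v a b
    + conv (fun i j => sig (u i j)) (fun i j => d (v i j)) a b.
  rewrite /conv (dsum_raddf _ _ dB) -dsumD; apply: eq_dsum => i i' _.
  rewrite (dsum_raddf _ _ dB) -dsumD; apply: eq_dsum => j j' _.
  exact: dM.
apply: coefP => -[] a b; rewrite coefDE /odd_lift /cmul; last exact: d_conv.
rewrite (zmodD dB) !d_conv !opprD addrACA; congr (_ + _ + (_ + _)).
- by rewrite -convNl.
- by rewrite -convNl; apply: eq_conv => i j //; rewrite dsig opprK.
- by rewrite -convNl.
- by rewrite -convNr.
Qed.

Lemma weigh_derivation (w : nat -> nat -> k) x y :
  (forall p q c, mul (c *: p) q = c *: mul p q) ->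
  (forall p q c, mul p (c *: q) = c *: mul p q) -> scalable sig ->
  (forall a b a' b', w (a + a')%N (b + b')%N = w a b + w a' b') ->
  weigh w (cmul x y) = cmul (weigh w x) y + cmul x (weigh w y).
Proof.
move=> mulZl mulZr sigZ wD.
have w_conv u v a b : w a b *: conv u v a b =
    conv (fun i j => w i j *: u i j) v a b
    + conv u (fun i j => w i j *: v i j) a b.
  have ZB (c : k) : zmod_morphism (fun z : A => c *: z).
    by move=> z z'; rewrite scalerBr.
  rewrite /conv (dsum_raddf _ _ (ZB _)) -dsumD; apply: eq_dsum => i i' <-.
  rewrite (dsum_raddf _ _ (ZB _)) -dsumD; apply: eq_dsum => j j' <-.
  by rewrite wD mulZl mulZr scalerDl.
apply: coefP => -[] a b; rewrite coefDE /weigh /cmul; last exact: w_conv.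
rewrite scalerDr !w_conv addrACA; congr (_ + _ + (_ + _)).
by apply: eq_conv => i j //; rewrite sigZ.
Qed.
End CoefficientProduct.

Lemma linearB (k : fieldType) (V W : lmodType k) (t : {linear V -> W}) :
  zmod_morphism t.
Proof. exact: raddfB. Qed.

(** * The formal homotopy and the perturbed differentials *)

Section FormalHomotopy.
Variables (k : fieldType) (V W : lmodType k).
Variables (g : {linear V -> W}) (f : {linear W -> V}).
Variables (k1 k2 h : {linear W -> W}).

Definition khat (x : coef W) : coef W :=
  shift 1 0 (odd_lift k1 x) + shift 0 1 (odd_lift k2 x)
  + eps (shift 1 1 (even_lift h x)).

(** Two instances occur: i = 1, j = 0 with w a b = b perturbs del by - eps s (t d/dt), and i = 0, j
    = 1 with w a b = - a perturbs delb by eps t (s d/ds). *)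
Definition dhat (X : lmodType k) (d : {linear X -> X}) i j
    (w : nat -> nat -> k) (x : coef X) : coef X :=
  odd_lift d x - eps (shift i j (weigh w x)).

Lemma khatB : zmod_morphism khat.
Proof.
move=> x y; rewrite /khat !(odd_liftB (linearB _)) !shiftB.
rewrite (even_liftB (linearB _)) shiftB epsB !opprD.
by rewrite [LHS](AC (2*2*2) (1*3*5*(2*4*6))).
Qed.

Lemma dhatB (X : lmodType k) (d : {linear X -> X}) i j w :
  zmod_morphism (dhat d i j w).
Proof.
move=> x y; rewrite /dhat (odd_liftB (linearB _)) weighB shiftB epsB.
by rewrite !opprD opprK [LHS](AC (2*2) (1*3*(2*4))).
Qed.

(** The perturbation contributes its commutator with s k1 + t k2, in which each summand is
    multiplied by its weight; against eps s t h it gives nothing, as eps^2 = 0. The eps part on the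
    right is what has to cancel in each instance. *)
Lemma dhat_khat (d : {linear W -> W}) i j w x :
  (forall a b a' b', w (a + a')%N (b + b')%N = w a b + w a' b') ->
  dhat d i j w (khat x) + khat (dhat d i j w x) =
  shift 1 0 (even_lift (fun y => d (k1 y) + k1 (d y)) x)
  + shift 0 1 (even_lift (fun y => d (k2 y) + k2 (d y)) x)
  + eps (shift 1 1 (even_lift (fun y => h (d y) - d (h y)) x)
         - shift i j (w 1%N 0%N *: shift 1 0 (odd_lift k1 x)
                      + w 0%N 1%N *: shift 0 1 (odd_lift k2 x))).
Proof.
move=> wD.
have comp (t u : {linear W -> W}) y :
  odd_lift t (odd_lift u y) = even_lift (t \o u) y.
  exact: odd_lift_comp (linearB t).
have sh (t : {linear W -> W}) a b y :
  odd_lift t (shift a b y) = shift a b (odd_lift t y).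
  exact: odd_lift_shift (linearB t).
have E1 : odd_lift d (khat x) = shift 1 0 (even_lift (d \o k1) x)
    + shift 0 1 (even_lift (d \o k2) x)
    - eps (shift 1 1 (even_lift (d \o h) x)).
  rewrite /khat !(zmodD (odd_liftB (linearB d))) !sh !comp; congr (_ + _).
  by rewrite (odd_lift_eps _ (linearB d)) sh.
have E2 : eps (shift i j (weigh w (khat x))) = eps (shift i j (
      (shift 1 0 (odd_lift k1 (weigh w x)) + shift 0 1 (odd_lift k2 (weigh w x)))
    + (w 1%N 0%N *: shift 1 0 (odd_lift k1 x)
       + w 0%N 1%N *: shift 0 1 (odd_lift k2 x)))).
  have wD' := zmodD (weighB (A := W) w).
  rewrite /khat !wD' weigh_eps !(zmodD (@shiftB k W _ _)) !(zmodD (@epsB k W)).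
  rewrite -[in X in _ + X = _]eps_shift eps_eps addr0.
  rewrite !weigh_shift // !(weigh_odd_lift _ _ (linearZ_LR _)).
  rewrite !(zmodD (@shiftB k W _ _)) !(zmodD (@epsB k W)).
  by rewrite [LHS](AC (2*2) (1*3*(2*4))).
have E3 : khat (odd_lift d x) = shift 1 0 (even_lift (k1 \o d) x)
    + shift 0 1 (even_lift (k2 \o d) x) + eps (shift 1 1 (even_lift (h \o d) x)).
  by rewrite /khat !comp; congr (_ + _); rewrite !eps_shift; congr shift; apply: coefP => -[] a b.
have E4 y : khat (eps y) = - eps (shift 1 0 (odd_lift k1 y) + shift 0 1 (odd_lift k2 y)).
  rewrite /khat !(odd_lift_eps _ (linearB _)) (even_lift_eps _ (linearB h)).
  rewrite -[in X in _ + X]eps_shift eps_eps addr0.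
  by rewrite !(zmodN (@shiftB k W _ _)) -!eps_shift -opprD -(zmodD (@epsB k W)).
have E5 : eps (shift 1 0 (odd_lift k1 (shift i j (weigh w x)))
               + shift 0 1 (odd_lift k2 (shift i j (weigh w x))))
    = eps (shift i j (shift 1 0 (odd_lift k1 (weigh w x))
                      + shift 0 1 (odd_lift k2 (weigh w x)))).
  rewrite !sh (zmodD (@shiftB k W _ _)) !shift_shift.
  by rewrite ![(_ + i)%N]addnC ![(_ + j)%N]addnC.
rewrite /dhat khatB E1 E2 E3 E4 E5 opprK (zmodD (@shiftB k W i j)).
rewrite (zmodD (@epsB k W)) (@epsB k W).
have split1 (t u : W -> W) : even_lift (fun y => t y + u y) x
   = even_lift t x + even_lift u x by [].
have split2 (t u : W -> W) : even_lift (fun y => t y - u y) x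
   = even_lift t x - even_lift u x by [].
rewrite (split1 (d \o k1) (k1 \o d)) (split1 (d \o k2) (k2 \o d)).
rewrite (split2 (h \o d) (d \o h)) !(@shiftB k W 1 1) !(zmodD (@shiftB k W 1 0)).
rewrite !(zmodD (@shiftB k W 0 1)) (@epsB k W (shift 1 1 _)).
set b := eps (shift i j (_ + shift 0 1 (odd_lift k2 (weigh w x)))).
set b' := eps (shift i j _); set a3 := eps (shift 1 1 _); set c3 := eps _.
rewrite opprD [LHS](AC (3*2*4) ((1*6)*(2*7)*((8*3)*5)*(4*9))) /=.
by rewrite addNr addr0.
Qed.
End FormalHomotopy.

(** * Tree transfer for the coefficients *)

Section SlotExpansion.
Variables (k : fieldType) (V U : lmodType k) (tauh : coef V -> coef V).
Variables (q : bool) (Phi : seq (coef V) -> coef U).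
Hypothesis PhiB : forall u w, zmod_morphism (fun x => Phi (u ++ x :: w)).
Hypothesis Phi_shift : forall u i j x w,
  Phi (u ++ shift i j x :: w) = shift i j (Phi (u ++ x :: w)).
Hypothesis Phi_eps : forall u x w,
  Phi (u ++ eps x :: w) = (-1) ^+ q *: eps (Phi (map tauh u ++ x :: w)).

Lemma coef_expand n (y : coef V) :
  (forall e i j, (n <= i)%N || (n <= j)%N -> y e i j = 0) ->
  y = \sum_(i < n) \sum_(j < n)
    (shift i j (coef_const (y false i j))
     + eps (shift i j (coef_const (y true i j)))).
Proof.
move=> y0.
have sumE (I : Type) (r : seq I) (F : I -> coef V) e a b :
    (\sum_(i <- r) F i) e a b = \sum_(i <- r) F i e a b.
  by elim/big_rec2: _ => // i x y' _ <-; rewrite coefDE.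
apply: coefP => e a b; rewrite sumE; under eq_bigr do rewrite sumE.
transitivity (\sum_(i < n) \sum_(j < n)
    if (i == a :> nat) && (j == b :> nat) then y e i j else 0); last first.
  apply: eq_bigr => i _; apply: eq_bigr => j _.
  rewrite coefDE /eps /shift /coef_const; case: e => /=.
    rewrite !subn_eq0 if_same add0r.
    by case: (ltngtP i a); case: (ltngtP j b).
  rewrite !subn_eq0 addr0.
  by case: (ltngtP i a); case: (ltngtP j b).
case: (ltnP a n) => an; last first.
  rewrite y0 ?an // big1 // => i _; rewrite big1 // => j _.
  by rewrite ltn_eqF // (leq_trans (ltn_ord i)).
case: (ltnP b n) => bn; last first.
  rewrite y0 ?bn ?orbT // big1 // => i _; rewrite big1 // => j _.
  by rewrite andbC ltn_eqF // (leq_trans (ltn_ord j)).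
rewrite (bigD1 (Ordinal an)) //= (bigD1 (Ordinal bn)) //= !eqxx /=.
rewrite !big1 ?addr0 // => [i ia|j jb]; last by rewrite (negbTE (jb : (j : nat) != b)).
by rewrite big1 // => j _; rewrite (negbTE (ia : (i : nat) != a)).
Qed.

(** Multilinearity over the coefficient ring reduces an entry of finite support to constant entries.
    Pulling out eps costs the sign of passing [Phi], of parity [q], and twists the entries on the
    left. *)
Lemma slot_expand n (y : coef V) u w e a b :
  (forall e i j, (n <= i)%N || (n <= j)%N -> y e i j = 0) ->
  Phi (u ++ y :: w) e a b =
  dsum (fun i i' => dsum (fun j j' =>
    Phi (u ++ coef_const (y false i' j') :: w) e i j
    + if e then (-1) ^+ q *:
        Phi (map tauh u ++ coef_const (y true i' j') :: w) false i j
      else 0) b) a.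
Proof.
(* The window has to contain the support of [y] and also all exponents up to [a] and [b]. *)
move=> y0; pose m := (maxn n (maxn a b)).+1.
have ym : forall e i j, (m <= i)%N || (m <= j)%N -> y e i j = 0.
  move=> e' i j mij; apply: y0; lia.
rewrite {1}(coef_expand ym).
have evB : zmod_morphism (fun x => Phi (u ++ x :: w) e a b).
  by move=> x x'; rewrite (PhiB u w).
rewrite (zmod_sum evB).
have -> : forall F : nat -> nat -> nat -> nat -> U,
    dsum (fun i i' => dsum (fun j j' => F i i' j j') b) a
    = \sum_(i < m) \sum_(j < m) if (i <= a)%N && (j <= b)%N
        then F (a - i)%N i (b - j)%N j else 0.
  move=> F; rewrite dsumC -(@dsum_window _ _ a m); last by rewrite /m; lia.
  apply: eq_bigr => i _; case: (i <= a)%N => /=; last by rewrite big1.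
  by rewrite dsumC -(@dsum_window _ _ b m) //; rewrite /m; lia.
apply: eq_bigr => i _; rewrite (zmod_sum evB); apply: eq_bigr => j _.
rewrite (zmodD evB) Phi_shift Phi_eps Phi_shift coefZE /shift /eps.
by case: e {evB}; case: ifP => _; rewrite ?scaler0 ?addr0.
Qed.
End SlotExpansion.

(** Coefficients of [nabla] with a stem inserted. In the eps summand the entries of [u] would be
    twisted twice, by the insertion and by eps, and the two twists cancel. *)
Definition insert_coef (V : Type) (k : fieldType) (U : lmodType k) (tau : V -> V)
    (Psi : bool -> nat -> nat -> seq V -> V) (Phi : bool -> nat -> nat -> seq V -> U)
    (q : bool) e i j (a : seq V) : U :=
  ssum (fun u z => ssum (fun v w =>
    dsum (fun i1 i2 => dsum (fun j1 j2 =>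
      Phi e i1 j1 (map tau u ++ Psi false i2 j2 v :: w)
      + if e then (-1) ^+ q *: Phi false i1 j1 (u ++ Psi true i2 j2 v :: w)
        else 0) j) i) z) a.

(** Coefficients of the convolution square of the trees. The odd lift of [sW] gives the minus sign
    of the first eps term; in the second, eps passing the left factor undoes [sW]. *)
Definition product_coef (V : Type) (W : zmodType) (mul : W -> W -> W)
    (sW : W -> W) (Phi : bool -> nat -> nat -> seq V -> W) e i j (a : seq V) : W :=
  ssum (fun u v => dsum (fun i1 i2 => dsum (fun j1 j2 =>
    if e then mul (- sW (Phi true i1 j1 u)) (Phi false i2 j2 v)
              + mul (Phi false i1 j1 u) (Phi true i2 j2 v)
    else mul (sW (Phi false i1 j1 u)) (Phi false i2 j2 v)) j) i) a.

Section CoefficientTransfer.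
Variables (k : fieldType) (V W : lmodType k) (mul : W -> W -> W).
Variables (sV : {linear V -> V}) (sW : {linear W -> W}).
Variables (g : {linear V -> W}) (f : {linear W -> V}) (k1 k2 h : {linear W -> W}).
Hypothesis mul_linl : forall y, linear (mul^~ y).
Hypothesis mul_linr : forall x, linear (mul x).
Hypothesis mulA : associative mul.
Hypothesis sVK : involutive sV.
Hypothesis sWK : involutive sW.
Hypothesis sW_mul : forall x y, sW (mul x y) = mul (sW x) (sW y).
Hypothesis g_s : forall x, g (sV x) = sW (g x).
Hypothesis f_s : forall x, f (sW x) = sV (f x).
Hypothesis k1_s : forall x, k1 (sW x) = - sW (k1 x).
Hypothesis k2_s : forall x, k2 (sW x) = - sW (k2 x).
Hypothesis h_s : forall x, h (sW x) = sW (h x).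

Let mulBl y : zmod_morphism (mul^~ y).
Proof. by move=> a b; rewrite -scaleN1r addrC mul_linl scaleN1r addrC. Qed.
Let mulBr x : zmod_morphism (mul x).
Proof. by move=> a b; rewrite -scaleN1r addrC mul_linr scaleN1r addrC. Qed.
Let mulZl y c x : mul (c *: x) y = c *: mul x y.
Proof. by rewrite -[c *: x]addr0 mul_linl (zmod0 (mulBl y)) addr0. Qed.
Let mulZr x c y : mul x (c *: y) = c *: mul x y.
Proof. by rewrite -[c *: y]addr0 mul_linr (zmod0 (mulBr x)) addr0. Qed.

Let sVh : coef V -> coef V := odd_lift sV.
Let sWh : coef W -> coef W := odd_lift sW.
Let mulh := cmul mul sW.
Let gh : coef V -> coef W := even_lift g.
Let fh : coef W -> coef V := even_lift f.
Let kh := khat k1 k2 h.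
Let tauh (x : coef V) := - sVh x.
Let tau (x : V) := - sV x.

Let mulhBl y : zmod_morphism (mulh^~ y).
Proof. exact: (cmulBl mulBl (linearB sW)). Qed.
Let mulhBr x : zmod_morphism (mulh x).
Proof. exact: cmulBr. Qed.
Let mulhA : associative mulh.
Proof. exact: (cmulA mulBl mulBr mulA (linearB sW)). Qed.
Let sWhB : zmod_morphism sWh.
Proof. exact: odd_liftB (linearB sW). Qed.
Let ghB : zmod_morphism gh.
Proof. exact: even_liftB (linearB g). Qed.
Let fhB : zmod_morphism fh.
Proof. exact: even_liftB (linearB f). Qed.
Let khB : zmod_morphism kh.
Proof. exact: @khatB k W k1 k2 h. Qed.
Let sWhK : involutive sWh.
Proof. exact: odd_lift_sigK (linearB sW) sWK. Qed.
Let sWh_mul x y : sWh (mulh x y) = mulh (sWh x) (sWh y).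
Proof. exact: (odd_lift_sig_mul mulBl mulBr (linearB sW)). Qed.
Let gh_s x : gh (sVh x) = sWh (gh x).
Proof.
by apply: coefP => -[] a b; rewrite /gh /even_lift /sVh /sWh /odd_lift ?raddfN /= g_s.
Qed.
Let kh_s x : kh (sWh x) = - sWh (kh x).
Proof.
have odd_s (t : {linear W -> W}) y : (forall z, t (sW z) = - sW (t z)) ->
    odd_lift t (odd_lift sW y) = - odd_lift sW (odd_lift t y).
  move=> ts; rewrite !odd_lift_comp; try exact: linearB.
  by apply: coefP => e a b; rewrite coefNE /even_lift /= ts.
rewrite /kh /khat /sWh !(zmodD (odd_liftB (linearB sW))) !opprD.
rewrite !(odd_lift_shift _ _ _ (linearB sW)) !odd_s // !(zmodN (@shiftB k W _ _)).
congr (_ + _); rewrite (odd_lift_eps _ (linearB sW)) opprK.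
rewrite (odd_lift_shift _ _ _ (linearB sW)) !eps_shift; congr shift.
by apply: coefP => -[] a b //; rewrite /eps /even_lift /odd_lift /= h_s.
Qed.

Definition ctree := tree sWh mulh gh kh.
Definition cforest := forest sWh mulh gh kh.
Definition cstem := stem sWh mulh gh fh kh.

Let khat_shift i j x : kh (shift i j x) = shift i j (kh x).
Proof.
rewrite /kh /khat !(odd_lift_shift _ _ _ (linearB _)).
rewrite (even_lift_shift _ _ _ (linearB h)) !(zmodD (@shiftB k W i j)).
by rewrite -eps_shift !shift_shift ![(i + _)%N]addnC ![(j + _)%N]addnC.
Qed.

Let khat_eps x : kh (eps x) = - eps (kh x).
Proof.
rewrite /kh /khat !(odd_lift_eps _ (linearB _)) (even_lift_eps _ (linearB h)).
rewrite !(zmodN (@shiftB k W _ _)) -!eps_shift -opprD.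
by rewrite !(zmodD (@epsB k W)) !eps_eps !addr0.
Qed.

Let khat_scale c x : kh (c *: x) = c *: kh x.
Proof.
rewrite /kh /khat !(odd_liftZ (linearZ_LR _)) (even_liftZ (linearZ_LR _)).
by rewrite !shiftZ epsZ !scalerDr.
Qed.

Let shift_ops i j := (fun x => even_lift_shift i j x (linearB g) :
    gh (shift i j x) = shift i j (gh x)).
Let sWh_shift i j x : sWh (shift i j x) = shift i j (sWh x).
Proof. exact: odd_lift_shift (linearB sW). Qed.
Let sWh_eps x : sWh (eps x) = - eps (sWh x).
Proof. exact: odd_lift_eps (linearB sW). Qed.
Let gh_eps x : gh (eps x) = eps (gh x).
Proof. exact: even_lift_eps (linearB g). Qed.
Let fh_eps x : fh (eps x) = eps (fh x).
Proof. exact: even_lift_eps (linearB f). Qed.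
Let fh_shift i j x : fh (shift i j x) = shift i j (fh x).
Proof. exact: even_lift_shift (linearB f). Qed.
Let mulh_shiftl i j x y : mulh (shift i j x) y = shift i j (mulh x y).
Proof. exact: cmul_shiftl (linearB sW) _ _ _ _. Qed.
Let mulh_shiftr i j x y : mulh x (shift i j y) = shift i j (mulh x y).
Proof. exact: cmul_shiftr. Qed.
Let mulh_epsl x y : mulh (eps x) y = eps (mulh x y).
Proof. exact: cmul_epsl (linearB sW) _ _. Qed.
Let mulh_epsr x y : mulh x (eps y) = eps (mulh (sWh x) y).
Proof. exact: cmul_epsr. Qed.

Let ctree_shift u i j x w :
  ctree (u ++ shift i j x :: w) = shift i j (ctree (u ++ x :: w)).
Proof.
exact: (tree_operator mulhBl mulhBr sWhB ghB khB sWh_mul gh_s kh_s (p := false)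
  (@shiftB k W i j) (shift_ops i j) (khat_shift i j) (sWh_shift i j)
  (mulh_shiftl i j) (mulh_shiftr i j)).
Qed.

Let cstem_shift u i j x w :
  cstem (u ++ shift i j x :: w) = shift i j (cstem (u ++ x :: w)).
Proof.
rewrite /cstem /stem -fh_shift; congr fh.
exact: (forest_operator mulhBl mulhBr sWhB ghB khB sWh_mul gh_s kh_s (p := false)
  (@shiftB k W i j) (shift_ops i j) (khat_shift i j) (sWh_shift i j)
  (mulh_shiftl i j) (mulh_shiftr i j)).
Qed.

Let ctree_eps u x w :
  ctree (u ++ eps x :: w) = (-1) ^+ 0 *: eps (ctree (map tauh u ++ x :: w)).
Proof.
rewrite scale1r.
exact: (tree_operator mulhBl mulhBr sWhB ghB khB sWh_mul gh_s kh_s (p := true)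
  (@epsB k W) gh_eps khat_eps sWh_eps mulh_epsl mulh_epsr).
Qed.

Let cstem_eps u x w :
  cstem (u ++ eps x :: w) = (-1) ^+ true *: eps (cstem (map tauh u ++ x :: w)).
Proof.
rewrite scaleN1r /cstem /stem -fh_eps -(zmodN fhB); congr fh.
exact: (forest_operator mulhBl mulhBr sWhB ghB khB sWh_mul gh_s kh_s (p := true)
  (@epsB k W) gh_eps khat_eps sWh_eps mulh_epsl mulh_epsr).
Qed.

Let ctree_sub u w : zmod_morphism (fun x => ctree (u ++ x :: w)).
Proof. by move=> x y; apply: tree_sub. Qed.

Let cstem_sub u w : zmod_morphism (fun x => cstem (u ++ x :: w)).
Proof. by move=> x y; rewrite /cstem /stem forest_sub // fhB. Qed.

Definition tree_coef e i j (a : seq V) : W :=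
  ctree (map (@coef_const k V) a) e i j.
Definition stem_coef e i j (a : seq V) : V :=
  cstem (map (@coef_const k V) a) e i j.

Let C := @coef_const k V.

Let C_linear c x y : C (c *: x + y) = c *: C x + C y.
Proof.
apply: coefP => e a b; rewrite coefDE coefZE /C /coef_const.
by case: ifP => _; rewrite ?scaler0 ?addr0.
Qed.

Let C_tau a : map C (map tau a) = map tauh (map C a).
Proof.
rewrite -!map_comp; apply: eq_map => x /=; apply: coefP => e i j.
rewrite /tauh coefNE /sVh /C /coef_const /odd_lift /tau.
by case: e => /=; [|case: ifP => _]; rewrite ?raddf0 ?oppr0.
Qed.

Let tauK : involutive tau.
Proof. by move=> x; rewrite /tau (zmodN (linearB sV)) opprK sVK. Qed.

Let mulhZl c x y : mulh (c *: x) y = c *: mulh x y.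
Proof.
apply: cmulZl => [p q|p]; [exact: mulZl | exact: (linearZ_LR sW)].
Qed.
Let mulhZr c x y : mulh x (c *: y) = c *: mulh x y.
Proof. by apply: cmulZr. Qed.
Let ghZ c x : gh (c *: x) = c *: gh x.
Proof. exact: even_liftZ (linearZ_LR g) _ _. Qed.
Let fhZ c x : fh (c *: x) = c *: fh x.
Proof. exact: even_liftZ (linearZ_LR f) _ _. Qed.
Let sWhZ c x : sWh (c *: x) = c *: sWh x.
Proof. exact: odd_liftZ (linearZ_LR sW) _ _. Qed.
Let ZB c : zmod_morphism (fun z : coef W => c *: z).
Proof. by move=> z z'; rewrite scalerBr. Qed.

Lemma tree_coef1 x : tree_coef false 0 0 [:: x] = g x.
Proof. by rewrite /tree_coef /ctree /= tree1. Qed.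

Lemma tree_coef_linear e i j s1 s2 c x y :
  tree_coef e i j (s1 ++ (c *: x + y) :: s2) =
  c *: tree_coef e i j (s1 ++ x :: s2) + tree_coef e i j (s1 ++ y :: s2).
Proof.
rewrite /tree_coef !map_cat /= -/C C_linear (zmodD (ctree_sub _ _)).
have tZ u z w : ctree (u ++ (c *: z) :: w) = c *: ctree (u ++ z :: w).
  exact: (tree_operator mulhBl mulhBr sWhB ghB khB sWh_mul gh_s kh_s (p := false)
    (@ZB c) (ghZ c) (khat_scale c) (sWhZ c) (mulhZl c) (fun x' y' => mulhZr c x' y')).
by rewrite tZ.
Qed.

Lemma stem_coef_linear e i j s1 s2 c x y :
  stem_coef e i j (s1 ++ (c *: x + y) :: s2) =
  c *: stem_coef e i j (s1 ++ x :: s2) + stem_coef e i j (s1 ++ y :: s2).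
Proof.
rewrite /stem_coef !map_cat /= -/C C_linear (zmodD (cstem_sub _ _)).
have tZ u z w : cstem (u ++ (c *: z) :: w) = c *: cstem (u ++ z :: w).
  rewrite /cstem /stem -fhZ; congr fh.
  exact: (forest_operator mulhBl mulhBr sWhB ghB khB sWh_mul gh_s kh_s (p := false)
    (@ZB c) (ghZ c) (khat_scale c) (sWhZ c) (mulhZl c) (fun x' y' => mulhZr c x' y')).
by rewrite tZ.
Qed.

Lemma stem_coef_parity e i j a : stem_coef e i j (map tau a) =
  if e then - sV (stem_coef e i j a) else sV (stem_coef e i j a).
Proof.
rewrite /stem_coef C_tau /cstem /stem forest_parity //.
suff -> : forall x, fh (sWh x) = sVh (fh x) by case: e.
by move=> x; apply: coefP => -[] p q; rewrite /fh /sVh /even_lift /odd_lift ?raddfN /= f_s.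
Qed.

(** For arity [n] this is the range of bidegrees of the operations: total degree c - n without eps,
    and one less with eps, where s and t must both occur. Trees have c = 1, forests and stems c =
    2. *)
Definition supported (U : lmodType k) c n (x : coef U) : Prop :=
  forall i j, ((i + j + c)%N != n -> x false i j = 0)
    /\ (~~ [&& (i + j + c)%N == n.+1, (0 < i)%N & (0 < j)%N] -> x true i j = 0).

Lemma cmul_supported c d m n x y : supported c m x -> supported d n y ->
  supported (c + d) (m + n) (mulh x y).
Proof.
move=> hx hy i j.
have conv_eq0 (u v : nat -> nat -> W) :
    (forall i1 j1 i2 j2, (i1 + i2 = i)%N -> (j1 + j2 = j)%N ->
       mul (u i1 j1) (v i2 j2) = 0) -> conv mul u v i j = 0.
  move=> uv0; rewrite /conv -[RHS](dsum_zero W i); apply: eq_dsum => i1 i2 ei.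
  by rewrite -[RHS](dsum_zero W j); apply: eq_dsum => j1 j2 ej; apply: uv0.
have mul0x z : mul 0 z = 0 := zmod0 (mulBl z).
have mulx0 z : mul z 0 = 0 := zmod0 (mulBr z).
have s0 : sW 0 = 0 := raddf0 sW.
split=> hij; rewrite /mulh /cmul.
  apply: conv_eq0 => i1 j1 i2 j2 ei ej.
  have [e1|/(hx i1 j1).1 ->] := eqVneq (i1 + j1 + c)%N m; last exact: mul0x.
  rewrite ((hy i2 j2).1 _) ?mulx0 //; lia.
rewrite !conv_eq0 ?addr0 // => i1 j1 i2 j2 ei ej.
  have [e1|/(hx i1 j1).1 ->] := eqVneq (i1 + j1 + c)%N m; last by rewrite s0 mul0x.
  rewrite ((hy i2 j2).2 _) ?mulx0 //; lia.
have [e2|/(hy i2 j2).1 ->] := eqVneq (i2 + j2 + d)%N n; last exact: mulx0.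
rewrite ((hx i1 j1).2 _) ?mul0x //; lia.
Qed.

Lemma khat_supported c n x : supported c.+1 n x -> supported c n (kh x).
Proof.
move=> hx i j.
have h0 : h 0 = 0 := raddf0 h.
have k10 : k1 0 = 0 := raddf0 k1.
have k20 : k2 0 = 0 := raddf0 k2.
have t0 (b : bool) (t : {linear W -> W}) z : (b -> z = 0) ->
    (if b then t z else 0) = 0.
  by case: b => // -> //; rewrite raddf0.
have t1 (b : bool) (t : {linear W -> W}) z : (b -> z = 0) ->
    (if b then - t z else 0) = 0.
  by case: b => // -> //; rewrite raddf0 oppr0.
split=> hij; rewrite /kh /khat !coefDE /shift /odd_lift /eps /even_lift.
  rewrite !t0 ?addr0 // => /andP[i1 j1]; apply: (hx _ _).1; lia.
rewrite !t1 ?add0r ?t0 // => /andP[i1 j1].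
- by apply: (hx _ _).1; lia.
- by apply: (hx _ _).2; lia.
- by apply: (hx _ _).2; lia.
Qed.

Lemma supported0 (U : lmodType k) c n : supported c n (0 : coef U).
Proof. by []. Qed.

Lemma supportedD (U : lmodType k) c n (x y : coef U) :
  supported c n x -> supported c n y -> supported c n (x + y).
Proof.
move=> hx hy i j; rewrite !coefDE.
split=> hij; first by rewrite (hx i j).1 // (hy i j).1 // addr0.
by rewrite (hx i j).2 // (hy i j).2 // addr0.
Qed.

(** A binary tree with n > 1 leaves has n - 2 inner edges, or n - 1 with the root edge. Each
    contributes s, t or eps s t, the last at most once since eps^2 = 0. *)
Lemma forest_ctree_supported a :
  supported 1 (size a) (ctree (map C a)) /\
  supported 2 (size a) (cforest (map C a)).
Proof.
have ssumS c n (phi : seq V -> seq V -> coef W) b :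
    (forall u v, b = u ++ v -> supported c n (phi u v)) ->
    supported c n (ssum phi b).
  elim: b phi => [|x b IH] phi hphi /=.
    by apply: supportedD; [apply: hphi | apply: supported0].
  apply: supportedD; first exact: hphi.
  by apply: IH => u v b_uv; apply: hphi; rewrite b_uv.
have treeS b : supported 2 (size b) (cforest (map C b)) ->
    supported 1 (size b) (ctree (map C b)).
  move=> hb; rewrite /ctree treeE //; apply: supportedD; last exact: khat_supported.
  case: b {hb} => [|x [|y b]] i j; split=> //= hij.
    by case: i j hij => [|i] [|j] //= _; apply: raddf0.
  exact: (raddf0 g).
have [n] := ubnP (size a); elim: n a => // n IH a an.
suff hf : supported 2 (size a) (cforest (map C a)) by split=> //; apply: treeS.
rewrite /cforest /forest /star ssum_map; apply: ssumS => u v a_uv.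
have sz : size a = (size u + size v)%N by rewrite a_uv size_cat.
case: (posnP (size u)) => [/size0nil->|u0].
  by rewrite /= tree_nil (zmod0 sWhB) (zmod0 (mulhBl _)); apply: supported0.
case: (posnP (size v)) => [/size0nil->|v0].
  by rewrite /= tree_nil (zmod0 (mulhBr _)); apply: supported0.
rewrite sz; apply: (@cmul_supported 1 1); last by apply: (IH v _).1; lia.
have hu : supported 1 (size u) (ctree (map C u)) by apply: (IH u _).1; lia.
move=> i j; rewrite -/(ctree _); split=> hij; rewrite /sWh /odd_lift.
  by rewrite (hu i j).1 // raddf0.
by rewrite (hu i j).2 // raddf0 oppr0.
Qed.

Lemma tree_coef_supported (a : seq V) i j :
  ((i + j + 1)%N != size a -> tree_coef false i j a = 0)
  /\ (~~ [&& (i + j + 1)%N == (size a).+1, (0 < i)%N & (0 < j)%N] ->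
      tree_coef true i j a = 0).
Proof. exact: (forest_ctree_supported a).1. Qed.

Lemma stem_coef_supported (a : seq V) i j :
  ((i + j + 2)%N != size a -> stem_coef false i j a = 0)
  /\ (~~ [&& (i + j + 2)%N == (size a).+1, (0 < i)%N & (0 < j)%N] ->
      stem_coef true i j a = 0).
Proof.
have [h1 h2] := (forest_ctree_supported a).2 i j.
split=> hij; rewrite /stem_coef /cstem /stem /fh /even_lift.
  exact: etrans (congr1 f (h1 hij)) (raddf0 f).
exact: etrans (congr1 f (h2 hij)) (raddf0 f).
Qed.

Let eval_ssum (U : lmodType k) T (phi : seq T -> seq T -> coef U) a e i j :
  ssum phi a e i j = ssum (fun u v => phi u v e i j) a.
Proof. exact: (@ssum_raddf T _ _ (fun x : coef U => x e i j)). Qed.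

Let stem_finite (v : seq V) e i j :
  (size v < i)%N || (size v < j)%N -> cstem (map C v) e i j = 0.
Proof.
move=> hij; have [h1 h2] := stem_coef_supported v i j.
by case: e; [apply: h2 | apply: h1]; lia.
Qed.

Let nabla_stem (U : lmodType k) (Phi : seq (coef V) -> coef U) (q : bool) e i j a :
  (forall u w, zmod_morphism (fun x => Phi (u ++ x :: w))) ->
  (forall u i j x w, Phi (u ++ shift i j x :: w) = shift i j (Phi (u ++ x :: w))) ->
  (forall u x w, Phi (u ++ eps x :: w) = (-1) ^+ q *: eps (Phi (map tauh u ++ x :: w))) ->
  nabla tauh cstem Phi (map C a) e i j =
  insert_coef tau stem_coef (fun e i j b => Phi (map C b) e i j) q e i j a.
Proof.
move=> PB Ps Pe; rewrite /nabla ssum_map eval_ssum; apply: eq_ssum => u z _.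
rewrite ssum_map eval_ssum; apply: eq_ssum => v w _.
rewrite (slot_expand PB Ps Pe _ _ _ _ _ (n := (size v).+1)); last first.
  by move=> e' i' j' hij; apply: stem_finite.
apply: eq_dsum => i1 i2 _; apply: eq_dsum => j1 j2 _.
by rewrite !map_cat /= -!C_tau (mapK tauK).
Qed.

Let cforestE a e i j : cforest (map C a) e i j = product_coef mul sW tree_coef e i j a.
Proof.
rewrite /cforest /forest /star ssum_map eval_ssum; apply: eq_ssum => u v _.
case: e => //; rewrite /mulh /cmul -dsumD; apply: eq_dsum => i1 i2 _.
rewrite -dsumD; apply: eq_dsum => j1 j2 _.
by congr (_ + mul _ _); apply: sWK.
Qed.

(** * The tree equations, coefficient by coefficient *)

Section CoefficientDifferential.
Variables (dV : {linear V -> V}) (dW : {linear W -> W}).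
Variables (ci cj : nat) (w : nat -> nat -> k).
Hypothesis wD : forall a b a' b',
  w (a + a')%N (b + b')%N = w a b + w a' b'.
Hypothesis dW_s : forall x, dW (sW x) = - sW (dW x).
Hypothesis d_g : forall x, dW (g x) = g (dV x).
Hypothesis d_f : forall x, dV (f x) = f (dW x).
Hypothesis d_mul : forall x y, dW (mul x y) = mul (dW x) y + mul (sW x) (dW y).
Hypothesis d_khat : forall x,
  dhat dW ci cj w (khat k1 k2 h x) + khat k1 k2 h (dhat dW ci cj w x)
  = shift ci cj (even_lift g (even_lift f x) - x).

Let dVh := dhat dV ci cj w.
Let dWh := dhat dW ci cj w.

Let dWhB : zmod_morphism dWh. Proof. exact: dhatB. Qed.

Let dg x : dWh (gh x) = gh (dVh x).
Proof.
rewrite /dWh /dVh /dhat (zmodD ghB) (zmodN ghB) gh_eps; congr (_ - eps _).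
  by apply: coefP => -[] a b; rewrite /odd_lift /gh /even_lift ?raddfN /= d_g.
by rewrite (weigh_even_lift _ _ (linearZ_LR g)) -shift_ops.
Qed.

Let df x : dVh (fh x) = fh (dWh x).
Proof.
rewrite /dWh /dVh /dhat (zmodD fhB) (zmodN fhB) fh_eps; congr (_ - eps _).
  by apply: coefP => -[] a b; rewrite /odd_lift /fh /even_lift ?raddfN /= d_f.
by rewrite (weigh_even_lift _ _ (linearZ_LR f)) -fh_shift.
Qed.

Let d_sW x : dWh (sWh x) = - sWh (dWh x).
Proof.
rewrite /dWh /dhat (zmodD sWhB) (zmodN sWhB) sWh_eps opprK opprD; congr (_ + _).
  rewrite /sWh !odd_lift_comp; try exact: linearB.
  by apply: coefP => e a b; rewrite coefNE /even_lift /= dW_s.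
by rewrite (weigh_odd_lift _ _ (linearZ_LR sW)) -sWh_shift.
Qed.

Let d_mulh x y : dWh (mulh x y) = mulh (dWh x) y + mulh (sWh x) (dWh y).
Proof.
rewrite /dWh /dhat (zmodD (mulhBl y)) (zmodN (mulhBl y)).
rewrite (zmodD (mulhBr _)) (zmodN (mulhBr _)) addrACA -opprD.
have -> : odd_lift dW (mulh x y)
    = mulh (odd_lift dW x) y + mulh (sWh x) (odd_lift dW y).
  by apply: odd_lift_derivation => //; apply: linearB.
congr (_ - _); rewrite mulh_epsl mulh_epsr sWhK mulh_shiftl mulh_shiftr.
rewrite -(zmodD (@epsB k W)) -(zmodD (@shiftB k W _ _)); congr (eps (shift _ _ _)).
by apply: weigh_derivation => //; apply: (linearZ_LR sW).
Qed.

(** The perturbation does not see constants, because additivity forces w 0 0 = 0. *)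
Let dVh_unary v : unary dVh (map C v) = C (unary dV v).
Proof.
have w0 : w 0%N 0%N = 0.
  by apply: (addrI (w 0%N 0%N)); rewrite -wD addr0.
have C0 : C 0 = 0 by apply: coefP => e i j; rewrite /C /coef_const if_same.
case: v => [|x [|y v]] /=; rewrite ?C0 //.
rewrite /dVh /dhat; have -> : weigh w (C x) = 0.
  apply: coefP => e i j; rewrite /weigh /C /coef_const.
  by case: and3P => [[_ /eqP-> /eqP->]|_]; rewrite ?w0 ?scale0r ?scaler0.
rewrite (zmod0 (@shiftB k V _ _)) (zmod0 (@epsB k V)) subr0.
apply: coefP => -[] i j; rewrite /odd_lift /C /coef_const /=.
  by rewrite raddf0 oppr0.
by case: ifP; rewrite ?raddf0.
Qed.

Let nabla_unary (U : lmodType k) (Phi : seq (coef V) -> coef U) e i j a :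
  nabla tauh (unary dVh) Phi (map C a) e i j =
  nabla tau (unary dV) (fun b => Phi (map C b) e i j) a.
Proof.
rewrite /nabla ssum_map eval_ssum; apply: eq_ssum => u z _.
rewrite ssum_map eval_ssum; apply: eq_ssum => v y _.
by rewrite dVh_unary !map_cat /= -C_tau.
Qed.

Lemma tree_coef_del e i j a :
  dWh (ctree (map C a)) e i j = nabla tau (unary dV) (tree_coef e i j) a
  + shift ci cj (fun e i j => insert_coef tau stem_coef tree_coef false e i j a - product_coef mul sW tree_coef e i j a) e i j.
Proof.
rewrite /ctree (d_tree (f := fh) mulhBl mulhBr mulhA sWhB ghB fhB khB sWhK sWh_mul
  gh_s kh_s (@shiftB k W ci cj) dWhB dg d_sW (fun x => esym (sWh_shift ci cj x))
  (fun x => esym (khat_shift ci cj x)) d_mulh (mulh_shiftl ci cj)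
  (mulh_shiftr ci cj) d_khat).
rewrite coefDE; congr (_ + _); first exact: nabla_unary.
rewrite /shift; case: ifP => // _; rewrite coefBE -cforestE; congr (_ - _).
exact: (nabla_stem (q := false) _ _ _ _ ctree_sub ctree_shift ctree_eps).
Qed.

Lemma stem_coef_del e i j a :
  dVh (cstem (map C a)) e i j = - (nabla tau (unary dV) (stem_coef e i j) a
  + shift ci cj (fun e i j => insert_coef tau stem_coef stem_coef true e i j a) e i j).
Proof.
rewrite /cstem (d_stem mulhBl mulhBr mulhA sWhB ghB fhB khB sWhK sWh_mul
  gh_s kh_s (@shiftB k W ci cj) dWhB dg df (fun x => esym (fh_shift ci cj x))
  d_sW (fun x => esym (sWh_shift ci cj x))
  (fun x => esym (khat_shift ci cj x)) d_mulh (mulh_shiftl ci cj)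
  (mulh_shiftr ci cj) d_khat).
rewrite coefNE coefDE; congr (- (_ + _)); first exact: nabla_unary.
rewrite /shift; case: ifP => // _.
exact: (nabla_stem (q := true) _ _ _ _ cstem_sub cstem_shift cstem_eps).
Qed.

Let at_shift (U : lmodType k) (X : nat -> nat -> U) i j :=
  if (ci <= i)%N && (cj <= j)%N then X (i - ci)%N (j - cj)%N else 0.

(** The sign is written through the offset of [supported], 1 here and 2 for stems, so that both
    equations have the form assumed in [tcomm_structure]. *)
Lemma tree_coef_equation e i j a :
  (if e then - dW (tree_coef true i j a)
     - at_shift (fun i j => w i j *: tree_coef false i j a) i j
   else dW (tree_coef false i j a)) =
  (-1) ^+ (~~ odd 1) *: (nabla tau (unary dV) (tree_coef e i j) a
  + at_shift (fun i j => insert_coef tau stem_coef tree_coef false e i j a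
       - product_coef mul sW tree_coef e i j a) i j).
Proof.
rewrite scale1r; have := tree_coef_del e i j a; case: e => //.
by rewrite {1}/dWh /dhat coefBE subr0.
Qed.

Lemma stem_coef_equation e i j a :
  (if e then - dV (stem_coef true i j a)
     - at_shift (fun i j => w i j *: stem_coef false i j a) i j
   else dV (stem_coef false i j a)) =
  (-1) ^+ (~~ odd 2) *: (nabla tau (unary dV) (stem_coef e i j) a
  + at_shift (fun i j => insert_coef tau stem_coef stem_coef true e i j a) i j).
Proof.
rewrite scaleN1r; have := stem_coef_del e i j a; case: e => //.
by rewrite {1}/dVh /dhat coefBE subr0.
Qed.
End CoefficientDifferential.
End CoefficientTransfer.

(** * Signs *)

Section Signs.
Variable k : fieldType.

Definition oddz (m : int) : bool := odd `|m|.

Lemma oddzD m n : oddz (m + n) = oddz m (+) oddz n.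
Proof. by rewrite /oddz; lia. Qed.

Lemma oddzN m : oddz (- m) = oddz m.
Proof. by rewrite /oddz abszN. Qed.

Lemma oddzM m n : oddz (m * n) = oddz m && oddz n.
Proof. by rewrite /oddz abszM oddM. Qed.

Lemma oddz_nat (n : nat) : oddz n%:Z = odd n.
Proof. by []. Qed.

Lemma sgnE m : sgn k m = (-1) ^+ oddz m.
Proof.
rewrite /sgn /oddz; case: m => n; first by rewrite -exprnP signr_odd.
rewrite NegzE abszN -exprnN -[X in X^-1]signr_odd.
by case: (odd _); rewrite ?expr0 ?expr1 ?invr1 ?invrN1.
Qed.

(* The sign that, together with the desuspension twist below, turns the
   equations of the tree sums into the sign conventions of [ppAinf] and
   [ppinf_mor]. *)
Definition rho n : k := (-1) ^+ 'C(n.-1, 2).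

(** C(n, 2) is quadratic in n with polar form m n; this is why [rho] is multiplicative up to a sign
    that depends only on the parities of the arities. *)
Lemma odd_bin2D m n : odd 'C(m + n, 2) = odd 'C(m, 2) (+) odd 'C(n, 2) (+) (odd m && odd n).
Proof.
have e : ('C(m + n, 2) = 'C(m, 2) + 'C(n, 2) + m * n)%N.
  elim: n => [|n IH]; first by rewrite addn0 muln0 !addn0.
  by rewrite addnS !binS !bin1 IH; lia.
by rewrite e !oddD oddM.
Qed.

Lemma rhoE n : rho n = (-1) ^+ odd 'C(n.-1, 2).
Proof. by rewrite signr_odd. Qed.
Lemma rhoM n l : (0 < l <= n)%N -> rho (n.+1 - l) * rho l =
  (-1) ^+ (~~ (odd n (+) odd l (+) true) && ~~ odd l) * rho n.
Proof.
move=> ln; rewrite !rhoE -!signr_addb; congr (_ ^+ _).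
have -> : n.-1 = ((n.+1 - l).-1 + l.-1)%N by lia.
rewrite odd_bin2D; case: (odd 'C(_, 2)); case: (odd 'C(_, 2)) => /=; lia.
Qed.
Lemma rhoD m n : (0 < m)%N -> (0 < n)%N ->
  rho m * rho n = (-1) ^+ (~~ (odd m && odd n)) * rho (m + n).
Proof.
case: m n => [|m] [|n] // _ _; rewrite !rhoE -!signr_addb; congr (_ ^+ _).
rewrite addSn addnS /= -addSn odd_bin2D binS bin1 oddD /=.
by case: (odd 'C(_, 2)); case: (odd 'C(_, 2)); case: (odd m); case: (odd n).
Qed.
End Signs.

Section ParityOperator.
Variable k : fieldType.

Lemma parity_operator (A : bigraded k) : exists s : {linear A -> A},
  forall d x, homog d x -> s x = sgn k (tdeg d) *: x.
Proof.
by have [s sE] := graded_extension (fun d => *:%R (sgn k (tdeg d)) : {linear A -> A}); exists s.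
Qed.

Variables (A : bigraded k) (s : {linear A -> A}).
Hypothesis sE : forall d x, homog d x -> s x = sgn k (tdeg d) *: x.

Lemma homog_parity d x : homog d x -> homog d (s x).
Proof. by move=> hx; rewrite (sE hx); apply: homogZ. Qed.

Lemma parityK : involutive s.
Proof.
apply: (@eq_homog k A A (s \o s) idfun); [exact: linearP | exact: linearP|].
move=> d x hx; rewrite /= (sE hx) linearZ /= (sE hx) scalerA sgnE.
by rewrite -signr_addb addbb expr0 scale1r.
Qed.

Lemma parity_comm (B : bigraded k) (t : {linear B -> B}) (F : {linear A -> B}) c :
  (forall d x, homog d x -> t x = sgn k (tdeg d) *: x) ->
  (forall d x, homog d x -> homog (d + c) (F x)) ->
  forall x, F (s x) = (-1) ^+ oddz (tdeg c) *: t (F x).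
Proof.
move=> tE hF; apply: (@eq_homog k A B (F \o s)
  ((-1) ^+ oddz (tdeg c) \*: (t \o F))); [exact: linearP | exact: linearP|].
move=> d x hx; rewrite /= (sE hx) linearZ /= (tE _ _ (hF _ _ hx)).
rewrite scalerA !sgnE; congr (_ *: _).
have -> : oddz (tdeg (d + c)) = oddz (tdeg d) (+) oddz (tdeg c).
  by rewrite -oddzD /tdeg /=; congr oddz; rewrite addrACA.
by rewrite -signr_addb addbCA addbb addbF.
Qed.
End ParityOperator.

(** * Koszul signs and the desuspension twist *)

Section Koszul.
Variables (k : fieldType) (H : bicomplex k) (s : {linear H -> H}).
Hypothesis sE : forall d x, homog d x -> s x = sgn k (tdeg d) *: x.
Implicit Types (a u v w : seq H) (ds : seq (int * int)).

(* The desuspension twist (-1)^(sum_j (n - j) |a_j|) of a_1 (x) ... (x) a_n. *)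
Fixpoint chi a : seq H :=
  if a is x :: a' then iter (size a') s x :: chi a' else [::].

Lemma size_chi a : size (chi a) = size a.
Proof. by elim: a => //= x a ->. Qed.

Lemma chi_cat u v : chi (u ++ v) = map (iter (size v) s) (chi u) ++ chi v.
Proof. by elim: u => //= x u ->; rewrite size_cat addnC iterD. Qed.

Lemma iter_linear n c x y : iter n s (c *: x + y) = c *: iter n s x + iter n s y.
Proof. by elim: n => //= n ->; rewrite linearP. Qed.

Lemma iter_scale n c x : iter n s (c *: x) = c *: iter n s x.
Proof. by elim: n => //= n ->; rewrite linearZ. Qed.

Lemma homog_iter n d x : homog d x -> homog d (iter n s x).
Proof. by move=> hx; elim: n => //= n; apply: homog_parity. Qed.

Lemma homogs_cons d ds x a :
  homogs (d :: ds) (x :: a) <-> homog d x /\ homogs ds a.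
Proof.
split=> [[[sz] h]|[hx [sz h]]]; last by split=> [/=|[|i]]; [rewrite sz| |apply: h].
by split; [apply: (h 0%N) | split=> // i; apply: (h i.+1)].
Qed.

Lemma homogs_nil ds : homogs (A := H) ds [::] -> ds = [::].
Proof. by case; case: ds. Qed.

Lemma homogs_take n ds a : homogs ds a -> homogs (take n ds) (take n a).
Proof.
elim: a n ds => [|x a IH] n [|d ds] h; try by case: h.
case: n => [|n] //=.
by move: h => /homogs_cons[hx ha]; apply/homogs_cons; split=> //; apply: IH.
Qed.

Lemma homogs_drop n ds a : homogs ds a -> homogs (drop n ds) (drop n a).
Proof.
elim: a n ds => [|x a IH] n [|d ds] h; try by case: h.
by case: n => [|n] //=; move: h => /homogs_cons[hx ha]; apply: IH.
Qed.

Lemma homogs_chi ds a : homogs ds a -> homogs ds (chi a).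
Proof.
elim: a ds => [|x a IH] [|d ds] //=; try by case.
by move=> /homogs_cons[hx ha]; apply/homogs_cons; split; [apply: homog_iter|apply: IH].
Qed.

Lemma homogs_map_iter n ds a : homogs ds a -> homogs ds (map (iter n s) a).
Proof.
elim: a ds => [|x a IH] [|d ds] //=; try by case.
by move=> /homogs_cons[hx ha]; apply/homogs_cons; split; [apply: homog_iter|apply: IH].
Qed.

Lemma bideg_cons d ds : bideg (d :: ds) = d + bideg ds.
Proof. exact: big_cons. Qed.

Lemma bideg_nil : bideg [::] = 0.
Proof. exact: big_nil. Qed.

Lemma bideg_cat ds1 ds2 : bideg (ds1 ++ ds2) = bideg ds1 + bideg ds2.
Proof. exact: big_cat. Qed.

Lemma tdegD d e : tdeg (d + e) = tdeg d + tdeg e.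
Proof. by rewrite /tdeg /= addrACA. Qed.

Section Multilinear.
Variables (U : lmodType k) (phi : seq H -> U).
Hypothesis phi_lin : forall s1 s2 (c : k) x y,
  phi (s1 ++ (c *: x + y) :: s2) = c *: phi (s1 ++ x :: s2) + phi (s1 ++ y :: s2).

Lemma multilinear0 s1 s2 : phi (s1 ++ 0 :: s2) = 0.
Proof.
have := phi_lin s1 s2 (-1) 0 0.
by rewrite scaler0 add0r scaleN1r addNr.
Qed.

Lemma multilinearZ s1 s2 c x : phi (s1 ++ (c *: x) :: s2) = c *: phi (s1 ++ x :: s2).
Proof. by rewrite -[c *: x]addr0 phi_lin multilinear0 addr0. Qed.

(* Applying s to the first entries produces the Koszul sign of moving an odd
   symbol past them. *)
Lemma koszul_map n ds u r : homogs ds u ->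
  phi (map (iter n s) u ++ r) = (-1) ^+ (odd n && oddz (tdeg (bideg ds))) *: phi (u ++ r).
Proof.
have gen p : homogs ds u -> phi (p ++ map (iter n s) u ++ r)
    = (-1) ^+ (odd n && oddz (tdeg (bideg ds))) *: phi (p ++ u ++ r).
  elim: u ds p => [|x u IH] [|d ds] p /=; try by case.
    by move=> _; rewrite bideg_nil andbF scale1r.
  move=> /homogs_cons[hx hu].
  have -> : iter n s x = (-1) ^+ (odd n && oddz (tdeg d)) *: x.
    elim: n {IH} => [|n IHn] /=; first by rewrite scale1r.
    rewrite IHn linearZ /= (sE hx) scalerA sgnE -signr_addb; congr (_ ^+ _ *: _).
    by case: (odd n); case: oddz.
  rewrite multilinearZ -cat_rcons (IH ds) // cat_rcons scalerA -signr_addb.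
  by congr (_ ^+ _ *: _); rewrite bideg_cons tdegD oddzD; case: odd.
exact: (gen [::]).
Qed.

(** As in [koszul_map], but every entry counts with its shifted degree, which adds the length of [u]
    to the exponent. *)
Lemma koszul_tau ds u r : homogs ds u ->
  phi (map (fun x => - s x) u ++ r)
  = (-1) ^+ (odd (size u) (+) oddz (tdeg (bideg ds))) *: phi (u ++ r).
Proof.
have gen p : homogs ds u -> phi (p ++ map (fun x => - s x) u ++ r)
    = (-1) ^+ (odd (size u) (+) oddz (tdeg (bideg ds))) *: phi (p ++ u ++ r).
  elim: u ds p => [|x u IH] [|d ds] p /=; try by case.
    by move=> _; rewrite bideg_nil scale1r.
  move=> /homogs_cons[hx hu].
  have -> : - s x = (-1) ^+ (~~ oddz (tdeg d)) *: x.
    by rewrite (sE hx) sgnE -scaleNr; case: oddz; rewrite ?opprK.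
  rewrite multilinearZ -cat_rcons (IH ds) // cat_rcons scalerA -signr_addb.
  congr (_ ^+ _ *: _); rewrite bideg_cons tdegD oddzD.
  by case: odd; case: oddz; case: oddz.
exact: (gen [::]).
Qed.
End Multilinear.
End Koszul.

(** * Comparison with the structure equations *)

Section Operations.
Variables (k : fieldType) (H B : bicomplex k) (s : {linear H -> H}).
Hypothesis sE : forall d x, homog d x -> s x = sgn k (tdeg d) *: x.
Variables (Phi : bool -> nat -> nat -> seq H -> B) (c : nat).
Hypothesis Phi_lin : forall e i j s1 s2 (a : k) x y,
  Phi e i j (s1 ++ (a *: x + y) :: s2) =
  a *: Phi e i j (s1 ++ x :: s2) + Phi e i j (s1 ++ y :: s2).
Hypothesis Phi_deg : forall e i j ds a, homogs ds a ->
  homog (bideg ds + (- i%:Z, - j%:Z)) (Phi e i j a).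
Hypothesis Phi_supp : forall a i j,
  ((i + j + c)%N != size a -> Phi false i j a = 0)
  /\ (~~ [&& (i + j + c)%N == (size a).+1, (0 < i)%N & (0 < j)%N] ->
      Phi true i j a = 0).
Implicit Types (d : int * int) (ds : seq (int * int)) (a : seq H).

(* Arity n and bidegree d determine whether the coefficient of eps is taken;
   c = 2 for the structure and c = 1 for the morphism. *)
Definition level n d : bool := tdeg d != c%:Z - n%:Z.

(** The guard is there because the absolute values forget the signs in the bidegree. *)
Definition operation d a : B :=
  if (d.1 <= 0) && (d.2 <= 0)
  then rho k (size a) *: Phi (level (size a) d) `|d.1|%N `|d.2|%N (chi s a)
  else 0.

Definition op_range n d : bool :=
  ((tdeg d == c%:Z - n%:Z) && (d.1 <= 0) && (d.2 <= 0)) ||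
  ((tdeg d == c%:Z - n%:Z - 1) && (d.1 <= -1) && (d.2 <= -1)).

Lemma chi_cons u x w : chi s (u ++ x :: w) =
  map (iter (size w).+1 s) (chi s u) ++ iter (size w) s x :: chi s w.
Proof. by rewrite chi_cat. Qed.

Lemma operation_multilinear d : multilinear (operation d).
Proof.
move=> s1 s2 a x y; rewrite /operation !size_cat /= !chi_cons iter_linear.
case: ifP => _; last by rewrite scaler0 addr0.
by rewrite Phi_lin scalerDr !scalerA mulrC.
Qed.

Lemma operation_bidegree d : has_bidegree (operation d) d.
Proof.
move=> ds a hda; rewrite /operation; case: ifP => [/andP[d1 d2]|_]; last exact: homog0.
apply: homogZ; have := Phi_deg (level (size a) d) `|d.1|%N `|d.2|%N (homogs_chi sE hda).
suff -> : (- `|d.1|%N%:Z, - `|d.2|%N%:Z) = d by rewrite addrC.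
by case: d d1 d2 => p q /=; move=> p0 q0; congr (_, _); lia.
Qed.

Lemma operation_zero d a : ~~ op_range (size a) d -> operation d a = 0.
Proof.
rewrite /operation /op_range /level => hr; case: ifP => // /andP[d1 d2].
have [S0 S1] := Phi_supp (chi s a) `|d.1|%N `|d.2|%N.
rewrite size_chi in S0 S1.
case: eqVneq => [e|ne] /=; last rewrite S1 ?scaler0 //.
  by rewrite e eqxx d1 d2 in hr.
move: hr ne; rewrite /tdeg; lia.
Qed.

Lemma nabla_unary_big (U : zmodType) (tau D : H -> H) (phi : seq H -> U) a :
  (forall u v, phi (u ++ 0 :: v) = 0) ->
  nabla tau (unary D) phi a =
  \sum_(i < size a) phi (map tau (take i a) ++ D (nth 0 a i) :: drop i.+1 a).
Proof.
move=> phi0; rewrite /nabla ssum_big big_ord_recr /= drop_size /= addr0 phi0 addr0.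
apply: eq_bigr => i _; rewrite (drop_nth 0) //.
set x := nth 0 a i; set w := drop i.+1 a.
rewrite /= phi0 add0r; case: w => [|y w] /=; rewrite ?addr0 // -[RHS]addr0.
congr (_ + _); rewrite -[RHS](ssum0 U w).
by apply: eq_ssum => v z _; rewrite phi0.
Qed.

Lemma iter_anticomm (D : {linear H -> H}) n x :
  (forall y, s (D y) = - D (s y)) -> iter n s (D x) = (-1) ^+ n *: D (iter n s x).
Proof.
move=> sD; elim: n => [|n IH] /=; first by rewrite scale1r.
by rewrite IH linearZ /= sD exprS mulN1r scaleNr scalerN.
Qed.

(** Moving [DA] out of the twist [chi] at one position gives a sign that depends on the number of
    entries to the right. With the Koszul sign of the entries to the left, this is the effect of the
    shifted parity, up to a sign that is the same at all positions. *)
Lemma tcomm_operation (DA : {linear H -> H}) (DB : {linear B -> B}) d ds a :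
  (forall y, s (DA y) = - DA (s y)) -> homogs ds a -> op_range (size a) d ->
  tcomm DA DB (tdeg d) (operation d) ds a =
  rho k (size a) *:
   (DB (Phi (level (size a) d) `|d.1|%N `|d.2|%N (chi s a))
    + (-1) ^+ (odd c (+) level (size a) d) *:
       nabla (fun x => - s x) (unary DA)
         (Phi (level (size a) d) `|d.1|%N `|d.2|%N) (chi s a)).
Proof.
move=> sD hda hr; rewrite /tcomm /operation.
have d_le0 : (d.1 <= 0) && (d.2 <= 0) by move: hr; rewrite /op_range; lia.
rewrite d_le0 linearZ scalerDr; congr (_ + _); rewrite scalerA.
rewrite nabla_unary_big => [|u v]; last exact: (multilinear0 (@Phi_lin _ _ _)).
rewrite size_chi -scaleNr !scaler_sumr; apply: eq_bigr => i _.
have sz : size (take i a ++ DA (nth 0 a i) :: drop i.+1 a) = size a.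
  by rewrite size_cat /= size_take size_drop ltn_ord; have := ltn_ord i; lia.
rewrite sz chi_cons.
set e := level _ _; set psi := Phi e _ _.
have psi_lin s1 s2 b x y : psi (s1 ++ (b *: x + y) :: s2)
  = b *: psi (s1 ++ x :: s2) + psi (s1 ++ y :: s2) by exact: Phi_lin.
have chi_a : chi s a = map (iter (size (drop i.+1 a)).+1 s) (chi s (take i a))
    ++ iter (size (drop i.+1 a)) s (nth 0 a i) :: chi s (drop i.+1 a).
  by rewrite -chi_cons -drop_nth // cat_take_drop.
have szu : size (map (iter (size (drop i.+1 a)).+1 s) (chi s (take i a))) = i.
  by rewrite size_map size_chi size_takel // ltnW.
have -> : take i (chi s a) = map (iter (size (drop i.+1 a)).+1 s) (chi s (take i a)).
  by rewrite chi_a take_cat szu ltnn subnn take0 cats0.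
have -> : nth 0 (chi s a) i = iter (size (drop i.+1 a)) s (nth 0 a i).
  by rewrite chi_a nth_cat szu ltnn subnn.
have -> : drop i.+1 (chi s a) = chi s (drop i.+1 a).
  by rewrite chi_a drop_cat szu ltnNge leqnSn /= subSn // subnn /= drop0.
have hu := homogs_map_iter sE (size (drop i.+1 a)).+1 (homogs_chi sE (homogs_take i hda)).
rewrite (iter_anticomm _ _ sD) (multilinearZ psi_lin).
rewrite (koszul_tau sE psi_lin _ hu) szu !scalerA; congr (_ *: _).
have dpar : oddz (tdeg d) = odd c (+) odd (size a) (+) e.
  move: hr; rewrite /e /op_range /level /oddz; case: eqVneq => [->|_] /=; lia.
have dropE : odd (size (drop i.+1 a)) = odd (size a) (+) ~~ odd i.
  by rewrite size_drop oddB.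
rewrite !sgnE dpar -[(-1) ^+ size (drop _ _)]signr_odd dropE.
rewrite [_ * rho k _]mulrC mulrCA -!mulrA; congr (_ * _).
rewrite -signrN -!signr_addb; congr (_ ^+ _).
by case: (odd c); case: (odd (size a)); case: (odd i); case: (e); case: oddz.
Qed.
End Operations.

(** * Quadratic terms that come from insertions *)

Section Insertion.
Variables (k : fieldType) (H B : bicomplex k) (s : {linear H -> H}).
Hypothesis sE : forall d x, homog d x -> s x = sgn k (tdeg d) *: x.
Variables (Phi : bool -> nat -> nat -> seq H -> B) (c : nat).
Variables (Psi : bool -> nat -> nat -> seq H -> H).
Hypothesis Phi_lin : forall e i j s1 s2 (a : k) x y,
  Phi e i j (s1 ++ (a *: x + y) :: s2) =
  a *: Phi e i j (s1 ++ x :: s2) + Phi e i j (s1 ++ y :: s2).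
Hypothesis Phi_supp : forall a i j,
  ((i + j + c)%N != size a -> Phi false i j a = 0)
  /\ (~~ [&& (i + j + c)%N == (size a).+1, (0 < i)%N & (0 < j)%N] ->
      Phi true i j a = 0).
Hypothesis Psi_lin : forall e i j s1 s2 (a : k) x y,
  Psi e i j (s1 ++ (a *: x + y) :: s2) =
  a *: Psi e i j (s1 ++ x :: s2) + Psi e i j (s1 ++ y :: s2).
Hypothesis Psi_supp : forall a i j,
  ((i + j + 2)%N != size a -> Psi false i j a = 0)
  /\ (~~ [&& (i + j + 2)%N == (size a).+1, (0 < i)%N & (0 < j)%N] ->
      Psi true i j a = 0).
Let tau (x : H) := - s x.
Hypothesis Psi_parity : forall e i j a,
  Psi e i j (map tau a) = if e then - s (Psi e i j a) else s (Psi e i j a).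
Implicit Types (d : int * int) (ds : seq (int * int)) (a : seq H).

Lemma multilinear_tau (U : lmodType k) (phi : seq H -> U) u :
  (forall s1 s2 (a : k) x y, phi (s1 ++ (a *: x + y) :: s2) =
     a *: phi (s1 ++ x :: s2) + phi (s1 ++ y :: s2)) ->
  phi (map tau u) = (-1) ^+ size u *: phi (map s u).
Proof.
move=> phi_lin; rewrite -[map tau u]cat0s -[map s u]cat0s.
elim: u [::] => [|x u IH] p /=; first by rewrite scale1r.
rewrite {1}/tau -scaleN1r (multilinearZ phi_lin) -cat_rcons IH cat_rcons.
by rewrite scalerA exprS.
Qed.

Lemma Psi_iter m e i j a : Psi e i j (map (iter m s) a) =
  (-1) ^+ (odd m && (odd (size a) (+) e)) *: iter m s (Psi e i j a).
Proof.
have Psi_s b : Psi e i j (map s b) = (-1) ^+ (odd (size b) (+) e) *: s (Psi e i j b).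
  have := multilinear_tau b (@Psi_lin e i j); rewrite Psi_parity => eb.
  have -> : Psi e i j (map s b) = (-1) ^+ size b *: ((-1) ^+ size b *: Psi e i j (map s b)).
    by rewrite scalerA -exprD addnn -signr_odd odd_double scale1r.
  rewrite -eb -signr_odd; case: (e); rewrite ?addbF //.
  by rewrite addbT signrN scaleNr scalerN.
elim: m => [|m IH] /=; first by rewrite map_id_in ?scale1r.
have -> : map (fun x => s (iter m s x)) a = map s (map (iter m s) a).
  by rewrite -map_comp.
rewrite Psi_s size_map IH linearZ /= scalerA -signr_addb.
by congr (_ ^+ _ *: _); case: (odd m); case: (odd _); case: (e).
Qed.

(** Beyond the twists inside each block, [chi] of the whole list twists the left block l + m times
    and the middle block m times, m being the length of the right block; the outer operation twists
    them 1 + m and m times. The Koszul lemmas and the parity of [Psi] evaluate the difference. *)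
Lemma insert_operation d1 d2 r l ds a :
  homogs ds a -> (r + l <= size a)%N ->
  d1.1 <= 0 -> d1.2 <= 0 -> d2.1 <= 0 -> d2.2 <= 0 ->
  let b := chi s a in
  let e1 := level c ((size a).+1 - l) d1 in
  let e2 := level 2 l d2 in
  oddz (tdeg d2) = odd l (+) e2 ->
  insert (operation s Phi c d1) (operation s Psi 2 d2) (tdeg d2) r l ds a =
  (rho k ((size a).+1 - l) * rho k l
    * (-1) ^+ (odd (size a - (r + l)) && (odd l (+) e2))) *:
  (if e2 then Phi e1 `|d1.1|%N `|d1.2|%N (take r b
     ++ Psi true `|d2.1|%N `|d2.2|%N (take l (drop r b)) :: drop (r + l) b)
   else (-1) ^+ r *: Phi e1 `|d1.1|%N `|d1.2|%N (map tau (take r b)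
     ++ Psi false `|d2.1|%N `|d2.2|%N (take l (drop r b)) :: drop (r + l) b)).
Proof.
move=> hda rl d11 d12 d21 d22 b e1 e2 par; rewrite /insert.
set u := take r a; set v := take l (drop r a); set w := drop (r + l) a.
have szu : size u = r by rewrite size_takel //; lia.
have szv : size v = l by rewrite size_takel ?size_drop //; lia.
have szw : size w = (size a - (r + l))%N by rewrite size_drop.
have aE : a = u ++ v ++ w by rewrite /v /w addnC -drop_drop !cat_take_drop.
have szs : size (u ++ operation s Psi 2 d2 v :: w) = ((size a).+1 - l)%N.
  by rewrite size_cat /= szu szw; lia.
have bE : b = map (iter (l + size w) s) (chi s u) ++ map (iter (size w) s) (chi s v) ++ chi s w.
  by rewrite /b aE !chi_cat size_cat szv.
have -> : take r b = map (iter (l + size w) s) (chi s u).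
  by rewrite bE take_size_cat // size_map size_chi.
have -> : take l (drop r b) = map (iter (size w) s) (chi s v).
  rewrite bE drop_size_cat ?size_map ?size_chi //.
  by rewrite take_size_cat // size_map size_chi.
have -> : drop (r + l) b = chi s w.
  rewrite addnC -drop_drop bE drop_size_cat ?size_map ?size_chi //.
  by rewrite drop_size_cat // size_map size_chi.
rewrite {1}/operation szs d11 d12 -/e1 chi_cons.
have -> : operation s Psi 2 d2 v = rho k l *: Psi e2 `|d2.1|%N `|d2.2|%N (chi s v).
  by rewrite /operation szv d21 d22.
set phi := Phi e1 _ _; set U := chi s u; set y := Psi e2 _ _ (chi s v).
have phi_lin s1 s2 q x z : phi (s1 ++ (q *: x + z) :: s2)
  = q *: phi (s1 ++ x :: s2) + phi (s1 ++ z :: s2) by exact: Phi_lin.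
have hU : homogs (take r ds) U by exact: (homogs_chi sE (homogs_take r hda)).
have hU' := homogs_map_iter sE (l + size w) hU.
have szU : size U = r by rewrite size_chi.
rewrite iter_scale (multilinearZ phi_lin) (koszul_map sE phi_lin _ _ hU).
have yE : Psi e2 `|d2.1|%N `|d2.2|%N (map (iter (size w) s) (chi s v))
    = (-1) ^+ (odd (size w) && (odd l (+) e2)) *: iter (size w) s y.
  by rewrite Psi_iter size_chi szv.
rewrite -szw sgnE oddzM par; set x := oddz (tdeg (bideg (take r ds))).
set Z := phi (U ++ iter (size w) s y :: chi s w).
have -> : (if e2 then phi (map (iter (l + size w) s) U
        ++ Psi true `|d2.1|%N `|d2.2|%N (map (iter (size w) s) (chi s v)) :: chi s w)
    else (-1) ^+ r *: phi (map tau (map (iter (l + size w) s) U)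
        ++ Psi false `|d2.1|%N `|d2.2|%N (map (iter (size w) s) (chi s v)) :: chi s w))
  = (-1) ^+ (odd (size w) && (odd l (+) e2) (+)
      ((odd l (+) odd (size w) (+) ~~ e2) && x)) *: Z.
  case: (e2) yE => yE; rewrite yE (multilinearZ phi_lin).
    rewrite (koszul_map sE phi_lin _ _ hU) scalerA -signr_addb oddD -/x.
    by congr (_ ^+ _ *: _); rewrite addbF.
  rewrite (koszul_tau sE phi_lin _ hU') (koszul_map sE phi_lin _ _ hU).
  rewrite -(signr_odd _ r) !scalerA -!signr_addb size_map szU oddD -/x.
  congr (_ ^+ _ *: _).
  by case: (odd r); case: (odd l); case: (odd (size w)); case: x.
rewrite !scalerA -/x -/Z; congr (_ *: _).
rewrite -!mulrA mulrCA; congr (_ * _); rewrite mulrCA; congr (_ * _).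
rewrite -!signr_addb /=; congr (_ ^+ _).
by case: (odd l); case: (odd (size w)); case: x; case: (e2).
Qed.

Lemma ssum2_big (U : zmodType) (phi : seq H -> seq H -> seq H -> U) b :
  ssum (fun u z => ssum (phi u) z) b =
  \sum_(0 <= l < (size b).+1) \sum_(0 <= r < (size b).+1 - l)
    phi (take r b) (take l (drop r b)) (drop (r + l) b).
Proof.
rewrite ssum_big -(big_mkord xpredT (fun r => ssum (phi (take r b)) (drop r b))).
transitivity (\sum_(0 <= r < (size b).+1) \sum_(0 <= l < (size b).+1 | (r + l <= size b)%N)
    phi (take r b) (take l (drop r b)) (drop (r + l) b)).
  apply: eq_big_nat => r /andP[_ rn].
  rewrite ssum_big size_drop -(big_mkord xpredT (fun l =>
    phi (take r b) (take l (drop r b)) (drop l (drop r b)))).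
  rewrite (big_nat_widen _ _ (size b).+1) /=; last by lia.
  by apply: eq_big => [l|l _]; [lia | rewrite drop_drop addnC].
rewrite (exchange_big_dep_nat xpredT) //=; apply: eq_big_nat => l /andP[_ ln].
rewrite [RHS](big_nat_widen _ _ (size b).+1); last by lia.
by apply: eq_bigl => r; lia.
Qed.

(** Common shape of [mu_quad] (c = 2) and [mor_source] (c = 1), with one exponent whose parity
    agrees with both sign conventions. *)
Definition insertion_sum d t ds a : B :=
  \sum_(2 <= l < (size a).+1) \sum_(0 <= r < (size a).+1 - l)
  \sum_(p : 'I_(size a).+1 * 'I_(size a).+1)
    let d1 := npair p in
    let d2 := t - d1 in
    sgn k ((r * l.+1 + l)%N%:Z + tdeg d + c%:Z + 1 + tdeg d1 * (l%:Z + tdeg d2)) *: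
      insert (operation s Phi c d1) (operation s Psi 2 d2) (tdeg d2) r l ds a.

Let Phi0 e i j u w : Phi e i j (u ++ 0 :: w) = 0.
Proof. exact: multilinear0 (@Phi_lin _ _ _) _ _. Qed.

(** The equation between the indices fixes the total degree, so in a nonzero term exactly one of the
    two operations sits at the eps level if [e] holds, and none otherwise. *)
Lemma insertion_term d ds a r l i1 i2 j1 j2 (e := level c (size a) d) :
  homogs ds a -> (r + l <= size a)%N -> (2 <= l)%N -> op_range c (size a) d ->
  (i1 + i2 + (j1 + j2) + 1 + c = size a + e)%N ->
  let b := chi s a in
  let d1 := (- i1%:Z, - j1%:Z) in
  let d2 := (- i2%:Z, - j2%:Z) in
  sgn k ((r * l.+1 + l)%N%:Z + tdeg d + c%:Z + 1 + tdeg d1 * (l%:Z + tdeg d2)) *: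
    insert (operation s Phi c d1) (operation s Psi 2 d2) (tdeg d2) r l ds a =
  ((-1) ^+ (~~ e) * rho k (size a)) *:
   (Phi e i1 j1 (map tau (take r b) ++ Psi false i2 j2 (take l (drop r b)) :: drop (r + l) b)
    + if e then (-1) ^+ (~~ odd c) *:
        Phi false i1 j1 (take r b ++ Psi true i2 j2 (take l (drop r b)) :: drop (r + l) b)
      else 0).
Proof.
move=> hda rl l2 hr ij b d1 d2.
have ln : (0 < l <= size a)%N by clear -rl l2; lia.
have par_neg (i j : nat) : oddz (tdeg (- i%:Z, - j%:Z)) = odd (i + j).
  by rewrite /tdeg oddzD !oddzN !oddz_nat oddD.
have szv : size (take l (drop r b)) = l.
  by rewrite size_takel // size_drop size_chi; lia.
have [P0 P1] := Psi_supp (take l (drop r b)) i2 j2; rewrite szv in P0 P1.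
have nonpos (x : nat) : - x%:Z <= 0 by lia.
have absn (x : nat) : `|- x%:Z|%N = x by lia.
have dpar : oddz (tdeg d) = odd c (+) odd (size a) (+) e.
  move: hr; rewrite /e /op_range /level /oddz; case: eqVneq => [->|_] /=; lia.
have [A|nA] := eqVneq (i2 + j2 + 2)%N l.
  have e2 : level 2 l d2 = false by rewrite /level /tdeg /=; clear -A; lia.
  have e1 : level c ((size a).+1 - l) d1 = e.
    by move: ij; rewrite /level /tdeg /=; case: (e) => /=; clear -A rl; lia.
  have par : oddz (tdeg d2) = odd l (+) false.
    by rewrite par_neg -A addn2 /= negbK addbF.
  have := @insert_operation d1 d2 r l ds a hda rl (nonpos _) (nonpos _) (nonpos _) (nonpos _).
  rewrite e2 e1 => /(_ par) -> /=; rewrite !absn P1; last by clear -A; lia.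
  rewrite Phi0 scaler0 if_same addr0 !scalerA; congr (_ *: _).
  rewrite (rhoM _ ln).
  have -> : odd (size a - (r + l)) = odd (size a) (+) (odd r (+) odd l).
    by rewrite oddB // oddD.
  move: (tdeg d) (tdeg d1) (tdeg d2) dpar par => td t1 t2 dpar par.
  rewrite -[(-1) ^+ r]signr_odd sgnE !oddzD oddzM oddzD par dpar !oddz_nat.
  rewrite oddD oddM /= -!mulrA [rho _ _ * _]mulrC !mulrA; congr (_ * _).
  rewrite -!signr_addb; congr (_ ^+ _).
  by case: (odd r); case: (odd l); case: (odd (size a)); case: (e); case: (odd c); case: oddz.
rewrite P0 // Phi0 add0r.
(* Out of range both sides vanish by support; in range the inner operation now carries eps. *)
have [|nr] := boolP (op_range 2 l d2 && op_range c ((size a).+1 - l) d1); last first.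
  have [hi|hi] := boolP (op_range 2 l d2); rewrite ?hi ?andbT in nr *.
    have -> : insert (operation s Phi c d1) (operation s Psi 2 d2) (tdeg d2) r l ds a = 0.
      rewrite /insert (operation_zero s Phi_supp) ?scaler0 //.
      have -> // : size (take r a ++ operation s Psi 2 d2 (take l (drop r a))
          :: drop (r + l) a) = ((size a).+1 - l)%N.
      by clear -rl; rewrite size_cat /= size_takel ?size_drop; lia.
    rewrite scaler0; case: ifP => [eT|_]; last by rewrite scaler0.
    rewrite P1 ?Phi0 ?scaler0 //; apply: contra nr => /and3P[/eqP ij2 i20 j20].
    by move: ij; rewrite eT /op_range /tdeg /=; clear -ij2 rl; lia.
  have -> : insert (operation s Phi c d1) (operation s Psi 2 d2) (tdeg d2) r l ds a = 0.
    rewrite /insert (operation_zero s Psi_supp); last first.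
      have -> // : size (take l (drop r a)) = l by clear -rl; rewrite size_takel ?size_drop; lia.
    by rewrite (multilinear0 (operation_multilinear s c Phi_lin d1)) scaler0.
  rewrite scaler0; case: ifP => [eT|_]; last by rewrite scaler0.
  rewrite P1 ?Phi0 ?scaler0 //; apply: contra hi => /and3P[/eqP ij2 i20 j20].
  by rewrite /op_range /tdeg /=; clear -ij2 i20 j20; lia.
case/andP => hi ho.
have ij2 : (i2 + j2 + 2 = l.+1)%N by move: hi nA; rewrite /op_range /tdeg /=; clear; lia.
have eT : e by move: ho ij; rewrite /op_range /tdeg /=; case: (e) => //=; clear -ij2 rl; lia.
have e2 : level 2 l d2 by rewrite /level /tdeg /=; clear -ij2; lia.
have e1 : level c ((size a).+1 - l) d1 = false.
  by move: ij; rewrite eT /level /tdeg /=; clear -ij2 rl; lia.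
have par : oddz (tdeg d2) = odd l (+) true.
  by rewrite par_neg addbT -[~~ odd l]/(odd l.+1) -ij2 addn2 /= negbK.
have := @insert_operation d1 d2 r l ds a hda rl (nonpos _) (nonpos _) (nonpos _) (nonpos _).
rewrite e2 e1 => /(_ par) -> /=; rewrite !absn eT /= !scalerA; congr (_ *: _).
rewrite (rhoM _ ln).
have -> : odd (size a - (r + l)) = odd (size a) (+) (odd r (+) odd l).
  by rewrite oddB // oddD.
have par1 : oddz (tdeg d1) = ~~ odd (size a) (+) odd l (+) odd c.
  rewrite par_neg; have /(congr1 odd) : (i1 + j1 + c + l = (size a).+1)%N.
    by move: ij; rewrite eT; clear -ij2; lia.
  by rewrite /= !oddD => <-; case: (odd i1); case: (odd j1); case: (odd c); case: (odd l).
move: (tdeg d) (tdeg d1) (tdeg d2) dpar par par1 => td t1 t2 dpar par par1.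
rewrite sgnE !oddzD oddzM oddzD par par1 dpar eT !oddz_nat.
rewrite oddD oddM /= mul1r -!mulrA [rho _ _ * _]mulrC !mulrA [RHS]mulrC.
congr (_ * _); rewrite -!signr_addb; congr (_ ^+ _).
by case: (odd r); case: (odd l); case: (odd (size a)); case: (odd c).
Qed.

Let insert_pos d1 d2 m r l ds a : (0 < d2.1) || (0 < d2.2) ->
  insert (operation s Phi c d1) (operation s Psi 2 d2) m r l ds a = 0.
Proof.
move=> d2p; rewrite /insert {2}/operation.
have -> : (d2.1 <= 0) && (d2.2 <= 0) = false.
  by apply/negbTE; rewrite negb_and -!ltNge.
by rewrite (multilinear0 (operation_multilinear s c Phi_lin d1)) scaler0.
Qed.

Lemma insertion_sumE d ds a (ci cj : nat) (e := level c (size a) d) :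
  homogs ds a -> op_range c (size a) d -> (ci + cj)%N = 1%N ->
  insertion_sum d (d + (ci%:Z, cj%:Z)) ds a =
  ((-1) ^+ (~~ e) * rho k (size a)) *:
   (if (ci <= `|d.1|)%N && (cj <= `|d.2|)%N then
      insert_coef tau Psi Phi (~~ odd c) e (`|d.1| - ci)%N (`|d.2| - cj)%N (chi s a)
    else 0).
Proof.
move=> hda hr cij; rewrite /insertion_sum.
set n := size a; set I := `|d.1|%N; set J := `|d.2|%N.
have dE : d = (- I%:Z, - J%:Z).
  by rewrite [LHS]surjective_pairing; congr (_, _); move: hr; rewrite /op_range /I /J; clear; lia.
have IJ : (I + J + c = n + e)%N /\ (I <= n)%N /\ (J <= n)%N.
  have : op_range c n (- I%:Z, - J%:Z) by rewrite -dE.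
  by rewrite /e dE /level /op_range /tdeg /=; clear; case: eqVneq => /=; lia.
case: IJ => IJ [In Jn].
(* If d + (ci, cj) has a positive component, so has every [d2], and all inner operations vanish. *)
case: ifP => [/andP[cI cJ]|cIJ]; last first.
  rewrite scaler0 big1 // => l _; rewrite big1 // => r _; rewrite big1 // => p _.
  rewrite insert_pos ?scaler0 // dE /=.
  by move: cIJ; clear; case: (ltnP I ci) => /=; case: (ltnP J cj) => //=; lia.
rewrite /insert_coef ssum2_big size_chi -/n.
rewrite (big_nat_widenl 2 0) // [in LHS]big_mkcond scaler_sumr.
apply: eq_big_nat => l /andP[_ ln]; rewrite scaler_sumr.
have dsumE (F : nat -> nat -> nat -> nat -> B) :
    dsum (fun i i' => dsum (fun j j' => F i i' j j') (J - cj)) (I - ci)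
    = \sum_(i < n.+1) \sum_(j < n.+1)
      if (i <= I - ci)%N && (j <= J - cj)%N
      then F i (I - ci - i)%N j (J - cj - j)%N else 0.
  rewrite -(@dsum_window _ _ _ n.+1); last by clear -In; lia.
  apply: eq_bigr => i _; case: (i <= _)%N => /=; last by rewrite big1.
  by rewrite -(@dsum_window _ _ _ n.+1) //; clear -Jn; lia.
(* [insert_coef] also runs over inserted blocks of length 0 and 1, on which [Psi] vanishes. *)
case: ifP => [l2|l2]; last first.
  apply/esym/big1_seq => r /andP[_]; rewrite mem_index_iota => /andP[_ rl].
  rewrite dsumE !big1 ?scaler0 // => i _; rewrite big1 // => j _; case: ifP => // _.
  have szv : size (take l (drop r (chi s a))) = l.
    by clear -rl; rewrite size_takel // size_drop size_chi; lia.
  rewrite (Psi_supp _ _ _).1 ?(Psi_supp _ _ _).2 ?Phi0 ?scaler0 ?if_same ?addr0 //;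
    by rewrite szv; clear -l2; lia.
apply: eq_big_nat => r /andP[_ rl]; rewrite dsumE scaler_sumr.
rewrite (eq_bigr (fun p : 'I_n.+1 * 'I_n.+1 => let d1 := npair (p.1, p.2) in
    let d2 := d + (ci%:Z, cj%:Z) - d1 in
    sgn k ((r * l.+1 + l)%N%:Z + tdeg d + c%:Z + 1 + tdeg d1 * (l%:Z + tdeg d2)) *:
    insert (operation s Phi c d1) (operation s Psi 2 d2) (tdeg d2) r l ds a));
  last by case.
rewrite -(pair_bigA _ (fun i j => let d1 := npair (i, j) in
    let d2 := d + (ci%:Z, cj%:Z) - d1 in
    sgn k ((r * l.+1 + l)%N%:Z + tdeg d + c%:Z + 1 + tdeg d1 * (l%:Z + tdeg d2)) *:
    insert (operation s Phi c d1) (operation s Psi 2 d2) (tdeg d2) r l ds a)) /=.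
apply: eq_bigr => i _; rewrite scaler_sumr; apply: eq_bigr => j _.
case: ifP => [/andP[iI jJ]|ij]; last first.
  rewrite insert_pos ?scaler0 // dE /=.
  by move: ij; clear -cI cJ; case: (leqP i (I - ci)) => /=; lia.
have -> : d + (ci%:Z, cj%:Z) - npair (i, j)
    = (- (I - ci - i)%N%:Z, - (J - cj - j)%N%:Z).
  by rewrite dE; congr (_, _); rewrite /=; clear -iI jJ cI cJ; lia.
apply: insertion_term => //; first by clear -rl; lia.
by move: IJ; rewrite -/n -/e /=; case: (e); clear -iI jJ cI cJ cij; lia.
Qed.
End Insertion.

(** * Quadratic terms that come from the product of the algebra *)

Section ProductTerms.
Variables (k : fieldType) (H : bicomplex k) (A : bidiff_algebra k).
Variables (s : {linear H -> H}) (sA : {linear A -> A}).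
Hypothesis sE : forall d x, homog d x -> s x = sgn k (tdeg d) *: x.
Hypothesis sAE : forall d x, homog d x -> sA x = sgn k (tdeg d) *: x.
Variable Phi : bool -> nat -> nat -> seq H -> A.
Hypothesis Phi_lin : forall e i j s1 s2 (a : k) x y,
  Phi e i j (s1 ++ (a *: x + y) :: s2) =
  a *: Phi e i j (s1 ++ x :: s2) + Phi e i j (s1 ++ y :: s2).
Hypothesis Phi_deg : forall e i j ds a, homogs ds a ->
  homog (bideg ds + (- i%:Z, - j%:Z)) (Phi e i j a).
Hypothesis Phi_supp : forall a i j,
  ((i + j + 1)%N != size a -> Phi false i j a = 0)
  /\ (~~ [&& (i + j + 1)%N == (size a).+1, (0 < i)%N & (0 < j)%N] ->
      Phi true i j a = 0).
Local Notation mul := (@ba_mul k A).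
Local Notation op := (operation s Phi 1).

Let mulZl c x y : mul (c *: x) y = c *: mul x y.
Proof. by have := ba_mul_linearl y c x 0; rewrite !addr0 ba_mul0x addr0. Qed.
Let mulx0 x : mul x 0 = 0.
Proof.
by have := ba_mul_linearr x (-1) 0 0; rewrite scaler0 add0r scaleN1r addNr.
Qed.
Let mulZr c x y : mul x (c *: y) = c *: mul x y.
Proof. by have := ba_mul_linearr x c y 0; rewrite !addr0 mulx0 addr0. Qed.
Let mul0x x : mul 0 x = 0. Proof. exact: ba_mul0x. Qed.

(** As for insertions, [e] decides whether one of the two factors takes its eps coefficient. The
    cases are the left factor at its level without eps, at neither level, where all terms vanish,
    and at its eps level. *)
Lemma product_term d ds a (x y i1 i2 j1 j2 : nat) (e := level 1 (size a) d) :
  homogs ds a -> (x + y = size a)%N -> (0 < x)%N -> (0 < y)%N ->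
  op_range 1 (size a) d ->
  (i1 + i2 + (j1 + j2) + 2 = size a + e)%N ->
  let b := chi s a in
  let d1 := (- i1%:Z, - j1%:Z) in
  let d2 := (- i2%:Z, - j2%:Z) in
  sgn k ((x * y.+1)%N%:Z + (tdeg d1 * (tdeg d2 + y%:Z + 1) + tdeg d
     + (size a)%:Z + 1) + tdeg d2 * tdeg (bideg (take x ds))) *:
    mul (op d1 (take x a)) (op d2 (drop x a)) =
  ((-1) ^+ e * rho k (size a)) *:
   (if e then
      mul (- sA (Phi true i1 j1 (take x b))) (Phi false i2 j2 (drop x b))
      + mul (Phi false i1 j1 (take x b)) (Phi true i2 j2 (drop x b))
    else mul (sA (Phi false i1 j1 (take x b))) (Phi false i2 j2 (drop x b))).
Proof.
move=> hda xy x0 y0 hr ij b d1 d2.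
set u := take x a; set v := drop x a.
have par_neg (i j : nat) : oddz (tdeg (- i%:Z, - j%:Z)) = odd (i + j).
  by rewrite /tdeg oddzD !oddzN !oddz_nat oddD.
have nonpos (i : nat) : - i%:Z <= 0 by lia.
have absn (i : nat) : `|- i%:Z|%N = i by lia.
have dpar : oddz (tdeg d) = ~~ odd (size a) (+) e.
  move: hr; rewrite /e /op_range /level /oddz; clear; case: eqVneq => [->|_] /=; lia.
have szu : size u = x by rewrite size_takel // -xy leq_addr.
have szv : size v = y by rewrite size_drop -xy addKn.
have aE : a = u ++ v by rewrite cat_take_drop.
have uE : take x b = map (iter y s) (chi s u).
  by rewrite /b aE chi_cat szv take_size_cat // size_map size_chi.
have vE : drop x b = chi s v.
  by rewrite /b aE chi_cat szv drop_size_cat // size_map size_chi.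
have hu : homogs (take x ds) (chi s u) by exact: (homogs_chi sE (homogs_take x hda)).
set D := oddz (tdeg (bideg (take x ds))).
have Phi_u e' i j : Phi e' i j (take x b) = (-1) ^+ (odd y && D) *: Phi e' i j (chi s u).
  rewrite uE -[map _ _]cats0 -[in RHS](cats0 (chi s u)).
  exact: (koszul_map sE (@Phi_lin e' i j) _ _ hu).
have sPhi_u e' i j : sA (Phi e' i j (chi s u))
    = (-1) ^+ (D (+) odd (i + j)) *: Phi e' i j (chi s u).
  by rewrite (sAE (Phi_deg e' i j hu)) sgnE tdegD oddzD par_neg.
have opE i j z n : size z = n ->
    op (- i%:Z, - j%:Z) z = rho k n *: Phi ((i + j + 1)%N != n) i j (chi s z).
  move=> szz; rewrite /operation /= !nonpos !absn szz; congr (_ *: Phi _ _ _ _).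
  by rewrite /level /tdeg /=; clear; lia.
have [P0 P1] := Phi_supp (chi s u) i1 j1; rewrite size_chi szu in P0 P1.
have [Q0 Q1] := Phi_supp (chi s v) i2 j2; rewrite size_chi szv in Q0 Q1.
rewrite (opE _ _ _ _ szu) (opE _ _ _ _ szv) vE !Phi_u !linearZ /= !sPhi_u.
rewrite !mulZl !mulZr.
have signE : sgn k ((x * y.+1)%N%:Z + (tdeg d1 * (tdeg d2 + y%:Z + 1) + tdeg d
     + (size a)%:Z + 1) + tdeg d2 * tdeg (bideg (take x ds)))
  = (-1) ^+ ((odd x && ~~ odd y) (+) (odd (i1 + j1) && ~~ (odd (i2 + j2) (+) odd y))
      (+) e (+) (odd (i2 + j2) && D)).
  have := par_neg i1 j1; have := par_neg i2 j2; rewrite -/d1 -/d2 /D sgnE.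
  move: (tdeg d1) (tdeg d2) (tdeg d) dpar (tdeg _) => t1 t2 t3 p3 t4 p2 p1.
  rewrite !oddzD !oddzM !oddzD p1 p2 p3 !oddz_nat oddM /=; congr (_ ^+ _).
  case: (odd x); case: (odd y); case: (odd (i1 + j1)); case: (odd (i2 + j2));
    by case: (odd (size a)); case: (e); case: (oddz t4).
have rxy := rhoD k x0 y0; rewrite xy in rxy.
rewrite signE {signE} [rho k x *: (_ *: _)]scalerA rxy -scaleNr !mulZl.
have odd_pred i j z : (i + j + 1)%N = z -> odd (i + j) = ~~ odd z.
  by move=> <-; rewrite addn1 /= negbK.
have [lv1|lv1] := eqVneq (i1 + j1 + 1)%N x.
  have -> := odd_pred _ _ _ lv1; move: ij; case: (e) => /= ij.
    have lv2 : (i2 + j2 + 1)%N = y.+1 by clear -ij lv1 xy; lia.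
    have -> := odd_pred _ _ _ lv2; rewrite lv2 Q0; last by clear -lv2; lia.
    rewrite mulx0 !scaler0 add0r (_ : y.+1 != y) ?scalerA; last by clear; lia.
    congr (_ *: _); rewrite -!mulrA ![rho k _ * _]mulrC !mulrA; congr (_ * _).
    rewrite -[_ ^+ 1]/((-1) ^+ true) -!signr_addb; congr (_ ^+ _); clear.
    by rewrite /=; case: (odd x); case: (odd y); case: D.
  have lv2 : (i2 + j2 + 1)%N = y by clear -ij lv1 xy; lia.
  have -> := odd_pred _ _ _ lv2; rewrite lv2 eqxx !scalerA /=.
  congr (_ *: _); rewrite -!mulrA ![rho k _ * _]mulrC !mulrA; congr (_ * _).
  rewrite -[_ ^+ 0]/((-1) ^+ false) -!signr_addb; congr (_ ^+ _); clear.
  by rewrite /=; case: (odd x); case: (odd y); case: D.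
rewrite (P0 lv1) !mul0x !scaler0 addr0.
have [lv1'|lv1'] := eqVneq (i1 + j1 + 1)%N x.+1; last first.
  rewrite P1; last by rewrite (negbTE lv1').
  by rewrite !mul0x !scaler0 if_same scaler0.
have -> := odd_pred _ _ _ lv1'; move: ij; case: (e) => /= ij; last first.
  have lv2 : (i2 + j2 + 1)%N != y by clear -ij lv1' xy; lia.
  rewrite lv2 Q1; last by clear -ij lv1' xy; lia.
  by rewrite mulx0 !scaler0.
have lv2 : (i2 + j2 + 1)%N = y by clear -ij lv1' xy; lia.
have -> := odd_pred _ _ _ lv2; rewrite lv2 eqxx !scalerA /=.
congr (_ *: _); rewrite -signrN -!mulrA ![rho k _ * _]mulrC !mulrA.
congr (_ * _); rewrite -[_ ^+ 1]/((-1) ^+ true) -!signr_addb; congr (_ ^+ _); clear.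
by rewrite /=; case: (odd x); case: (odd y); case: D.
Qed.

Lemma product_coef_small e i j a : (size a < 2)%N ->
  product_coef mul sA Phi e i j a = 0.
Proof.
have Phi_nil e' i' j' : Phi e' i' j' [::] = 0.
  have [h1 h2] := Phi_supp [::] i' j'.
  by case: e'; [apply: h2 | apply: h1]; rewrite /=; clear; lia.
move=> a2; rewrite /product_coef -[RHS](ssum0 A a); apply: eq_ssum => u v a_uv.
rewrite -[RHS](dsum_zero A i); apply: eq_dsum => i1 i2 _.
rewrite -[RHS](dsum_zero A j); apply: eq_dsum => j1 j2 _.
move: a2; rewrite a_uv size_cat; case: u v {a_uv} => [|x u] [|y v] /= uv;
  rewrite ?Phi_nil ?raddf0 ?oppr0 ?mulx0 ?mul0x ?addr0 ?if_same //.
by move: uv; clear; lia.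
Qed.

Lemma big_tuple2 (T : finType) (U : zmodType) (P : pred (2.-tuple T))
    (F : 2.-tuple T -> U) :
  \sum_(t : 2.-tuple T | P t) F t =
  \sum_(x : T) \sum_(y : T | P [tuple x; y]) F [tuple x; y].
Proof.
rewrite pair_big_dep /= (reindex (fun p : T * T => [tuple p.1; p.2])) //=.
exists (fun t : 2.-tuple T => (tnth t ord0, tnth t ord_max)) => [[x y] _ //|t _].
by case/tupleP: t => x t; case/tupleP: t => y t; rewrite tuple0; apply: val_inj.
Qed.

(** The product of the algebra is binary and of bidegree zero, so the general sign is wanted only
    for two factors and an outer operation of total degree zero. *)
Lemma binary_sign (x y : nat) (d0 d1 d2 d : int * int) ds n : tdeg d0 = 0 ->
  (theta [:: x; y])%:Z + eps1 [:: x; y] [:: d0; d1; d2] d n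
    + tensor_sign [:: x; y] [:: d1; d2] ds
  = (x * y.+1)%N%:Z + (tdeg d1 * (tdeg d2 + y%:Z + 1) + tdeg d + n%:Z + 1)
    + tdeg d2 * tdeg (bideg (take x ds)).
Proof.
move=> d00; have th : theta [:: x; y] = (x * y.+1)%N.
  by rewrite /theta /= !big_ord_recl !big_ord0 /= !addn0.
have ep : eps1 [:: x; y] [:: d0; d1; d2] d n
    = tdeg d1 * (tdeg d2 + y%:Z + 1) + tdeg d + n%:Z + 1.
  by rewrite /eps1 /= !big_ord_recl !big_ord0 /= d00 !addr0 mul0r !add0r.
have te : tensor_sign [:: x; y] [:: d1; d2] ds = tdeg d2 * tdeg (bideg (take x ds)).
  rewrite /tensor_sign /= !big_ord_recl !big_ord0 /= take0 bideg_nil addn0 addr0.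
  by rewrite mulr0 add0r.
by rewrite th ep te.
Qed.

Lemma mor_targetE d ds a (ci cj : nat) (e := level 1 (size a) d) :
  homogs ds a -> op_range 1 (size a) d -> (ci + cj)%N = 1%N ->
  mor_target (ba_mu (A := A)) op d (d + (ci%:Z, cj%:Z)) ds a =
  ((-1) ^+ e * rho k (size a)) *:
   (if (ci <= `|d.1|)%N && (cj <= `|d.2|)%N then
      product_coef mul sA Phi e (`|d.1| - ci)%N (`|d.2| - cj)%N (chi s a)
    else 0).
Proof.
move=> hda hr cij; rewrite /mor_target.
set n := size a; set I := `|d.1|%N; set J := `|d.2|%N.
have [n2|n2] := ltnP n 2.
  by rewrite big_geq // product_coef_small ?size_chi // if_same scaler0.
have dE : d = (- I%:Z, - J%:Z).
  by rewrite [LHS]surjective_pairing; congr (_, _); move: hr; rewrite /op_range /I /J; clear; lia.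
have IJ : (I + J + 1 = n + e)%N /\ (I <= n)%N /\ (J <= n)%N.
  have : op_range 1 n (- I%:Z, - J%:Z) by rewrite -dE.
  by rewrite /e dE /level /op_range /tdeg /=; clear; case: eqVneq => /=; lia.
case: IJ => IJ [In Jn].
rewrite big_ltn // [X in _ + X]big1_seq ?addr0; last first.
  move=> m /andP[_]; rewrite mem_index_iota => /andP[m3 _].
  rewrite big1 // => it _; rewrite big1 // => et _.
  rewrite ba_mu_size ?scaler0 // /tensor_app size_map size_zip size_reshape.
  by rewrite !size_map !size_tuple minnn; move: m3; clear; lia.
have Phi_nil e' i' j' : Phi e' i' j' [::] = 0.
  have [h1 h2] := Phi_supp [::] i' j'.
  by case: e'; [apply: h2 | apply: h1]; rewrite /=; clear; lia.
have dsumE (F : nat -> nat -> nat -> nat -> A) :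
    dsum (fun i i' => dsum (fun j j' => F i i' j j') (J - cj)) (I - ci)
    = \sum_(i < n.+1) \sum_(j < n.+1)
      if (i <= I - ci)%N && (j <= J - cj)%N
      then F i (I - ci - i)%N j (J - cj - j)%N else 0.
  rewrite -(@dsum_window _ _ _ n.+1); last by clear -In; lia.
  apply: eq_bigr => i _; case: (i <= _)%N => /=; last by rewrite big1.
  by rewrite -(@dsum_window _ _ _ n.+1) //; clear -Jn; lia.
transitivity (\sum_(x < n.+1) ((-1) ^+ e * rho k n) *:
  (if (ci <= I)%N && (cj <= J)%N then
    dsum (fun i1 i2 => dsum (fun j1 j2 =>
      if e then mul (- sA (Phi true i1 j1 (take x (chi s a)))) (Phi false i2 j2 (drop x (chi s a)))
              + mul (Phi false i1 j1 (take x (chi s a))) (Phi true i2 j2 (drop x (chi s a)))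
      else mul (sA (Phi false i1 j1 (take x (chi s a)))) (Phi false i2 j2 (drop x (chi s a))))
      (J - cj)) (I - ci) else 0)); last first.
  rewrite -scaler_sumr /product_coef ssum_big size_chi -/n; congr (_ *: _).
  by case: ifP => // _; rewrite big1.
rewrite big_tuple2; apply: eq_bigr => x _.
have [x0|x0] := posnP x.
  rewrite big_pred0 => [|y]; last by rewrite /= x0.
  rewrite x0 take0; case: ifP => _; last by rewrite scaler0.
  rewrite dsumE !big1 ?scaler0 // => i _; rewrite big1 // => j _.
  by rewrite !Phi_nil raddf0 oppr0 !mul0x addr0 !if_same.
have [xn|xn] := leqP n x.
  rewrite big_pred0 => [|y]; last by rewrite /=; clear -xn; lia.
  rewrite drop_oversize ?size_chi //; case: ifP => _; last by rewrite scaler0.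
  rewrite dsumE !big1 ?scaler0 // => i _; rewrite big1 // => j _.
  by rewrite !Phi_nil !mulx0 addr0 !if_same.
have yn : (n - x < n.+1)%N by clear -xn; lia.
rewrite (big_pred1 (Ordinal yn)) => [|y]; last first.
  by rewrite /= -val_eqE /=; clear -xn x0; lia.
rewrite big_tuple2; set y := (n - x)%N.
pose t := d + (ci%:Z, cj%:Z).
have yn' : nat_of_ord (Ordinal yn) = y by [].
pose T p1 p2 := sgn k ((x * y.+1)%N%:Z + (tdeg p1 * (tdeg p2 + y%:Z + 1) + tdeg d
    + n%:Z + 1) + tdeg p2 * tdeg (bideg (take x ds))) *:
  mul (op p1 (take x a)) (op p2 (drop x a)).
(* The product has bidegree 0, which forces d0 = 0, so the bidegree of the second factor is [t]
   minus that of the first. *)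
transitivity (\sum_(p1 : 'I_n.+1 * 'I_n.+1) \sum_(p2 : 'I_n.+1 * 'I_n.+1)
    if npair p2 == t - npair p1 then T (npair p1) (npair p2) else 0).
  apply: eq_bigr => p1 _; apply: eq_bigr => p2 _; rewrite /= -/t -/y.
  have bE : bideg [:: npair p1; npair p2] = npair p1 + npair p2.
    by rewrite /bideg !big_cons big_nil addr0.
  rewrite bE; set d0 := t - (npair p1 + npair p2).
  have d0E : (npair p2 == t - npair p1) = (d0 == 0).
    by rewrite subr_eq0 eq_sym subr_eq addrC.
  rewrite d0E; case: eqP => [d00|/eqP/ba_mu_deg->]; last by rewrite scaler0.
  rewrite binary_sign ?d00 // /T; congr (_ *: _).
  by rewrite /ba_mu eqxx /tensor_app /= (@take_oversize _ y) // size_drop.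
rewrite (eq_bigr (fun p : 'I_n.+1 * 'I_n.+1 => \sum_(p2 : 'I_n.+1 * 'I_n.+1)
  if npair p2 == t - npair (p.1, p.2) then T (npair (p.1, p.2)) (npair p2) else 0));
  last by case.
rewrite -(pair_bigA _ (fun i j => \sum_(p2 : 'I_n.+1 * 'I_n.+1)
  if npair p2 == t - npair (i, j) then T (npair (i, j)) (npair p2) else 0)) /=.
have npair_le (i j : nat) (p1 p2 : 'I_n.+1 * 'I_n.+1) :
    (npair p2 == t - npair p1) -> (p1.1 + p2.1 + ci = I)%N /\ (p1.2 + p2.2 + cj = J)%N.
  rewrite /t dE => /eqP[]; clear; lia.
case: ifP => [/andP[cI cJ]|cIJ]; last first.
  rewrite scaler0 big1 // => i _; rewrite big1 // => j _; rewrite big1 // => p2 _.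
  case: ifP => // /(npair_le 0%N 0%N) /= [h1 h2]; move: cIJ h1 h2; clear; lia.
rewrite dsumE scaler_sumr; apply: eq_bigr => i _.
rewrite scaler_sumr; apply: eq_bigr => j _.
case: ifP => [/andP[iI jJ]|ij]; last first.
  rewrite scaler0 big1 // => p2 _.
  case: ifP => // /(npair_le 0%N 0%N) /= [h1 h2]; move: ij h1 h2; clear; lia.
have i2n : (I - ci - i < n.+1)%N by clear -In; lia.
have j2n : (J - cj - j < n.+1)%N by clear -Jn; lia.
rewrite (bigD1 (Ordinal i2n, Ordinal j2n)) //= [X in _ + X]big1 ?addr0; last first.
  move=> p2; case: ifP => // /(npair_le 0%N 0%N) /= [h1 h2] /eqP[].
  by case: p2 h1 h2 => p q /= h1 h2; congr (_, _); apply: val_inj => /=;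
    move: h1 h2; clear; lia.
have -> : npair (Ordinal i2n, Ordinal j2n) == t - npair (i, j).
  by apply/eqP; rewrite /t dE; congr (_, _) => /=; clear -iI jJ cI cJ; lia.
apply: product_term => //.
- by rewrite /y; clear -xn; lia.
- by rewrite /y; clear -xn; lia.
- by move: IJ; rewrite -/n -/e /=; case: (e); clear -iI jJ cI cJ cij; lia.
Qed.
End ProductTerms.

Lemma mu_rangeE n d : mu_range n d = op_range 2 n d.
Proof. by rewrite /mu_range /op_range; lia. Qed.

Lemma mor_rangeE n d : mor_range n d = op_range 1 n d.
Proof. by rewrite /mor_range /op_range; lia. Qed.

(** * From the tree equations to the structure equations *)

Section StructureEquation.
Variables (k : fieldType) (H B : bicomplex k) (s : {linear H -> H}).
Hypothesis sE : forall d x, homog d x -> s x = sgn k (tdeg d) *: x.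
Variables (Phi Z : bool -> nat -> nat -> seq H -> B) (c : nat).
Hypothesis Phi_lin : forall e i j s1 s2 (a : k) x y,
  Phi e i j (s1 ++ (a *: x + y) :: s2) =
  a *: Phi e i j (s1 ++ x :: s2) + Phi e i j (s1 ++ y :: s2).
Hypothesis Phi_supp : forall a i j,
  ((i + j + c)%N != size a -> Phi false i j a = 0)
  /\ (~~ [&& (i + j + c)%N == (size a).+1, (0 < i)%N & (0 < j)%N] ->
      Phi true i j a = 0).
Variables (DH : {linear H -> H}) (DB : {linear B -> B}).
Variables (ci cj : nat) (w : nat -> nat -> k).
Hypothesis cij : (ci + cj)%N = 1%N.
Hypothesis sD : forall y, s (DH y) = - DH (s y).
Let sh (X : nat -> nat -> B) i j :=
  if (ci <= i)%N && (cj <= j)%N then X (i - ci)%N (j - cj)%N else 0.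
Hypothesis Phi_D : forall e i j b,
  (if e then - DB (Phi true i j b) - sh (fun i j => w i j *: Phi false i j b) i j
   else DB (Phi false i j b)) =
  (-1) ^+ (~~ odd c) *: (nabla (fun x => - s x) (unary DH) (Phi e i j) b
    + sh (fun i j => Z e i j b) i j).

(** The insertions of [DH] found in [tcomm_operation] cancel against those in [Phi_D]. There remain
    the quadratic terms [Z] and, at the eps level only, the weight term, which is an operation of
    the neighbouring bidegree without eps. *)
Lemma tcomm_structure d ds a (e := level c (size a) d) :
  homogs ds a -> op_range c (size a) d ->
  tcomm DH DB (tdeg d) (operation s Phi c d) ds a =
  - w (`|d.1| - ci)%N (`|d.2| - cj)%N *:
      operation s Phi c (d + (ci%:Z, cj%:Z)) a
  + ((-1) ^+ (~~ odd c (+) e) * rho k (size a)) *: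
    (if (ci <= `|d.1|)%N && (cj <= `|d.2|)%N
     then Z e (`|d.1| - ci)%N (`|d.2| - cj)%N (chi s a) else 0).
Proof.
move=> hda hr; rewrite (tcomm_operation sE Phi_lin) // -/e.
set n := size a; set I := `|d.1|%N; set J := `|d.2|%N; set b := chi s a.
have dE : d = (- I%:Z, - J%:Z).
  by rewrite [LHS]surjective_pairing; congr (_, _); move: hr; rewrite /op_range /I /J; clear; lia.
have IJ : (I + J + c = n + e)%N.
  have : op_range c n (- I%:Z, - J%:Z) by rewrite -dE.
  by rewrite /e dE /level /op_range /tdeg /=; clear; case: eqVneq => /=; lia.
have := Phi_D e I J b; rewrite /sh.
(* Raising the total degree by one leads from the eps level to the level without eps, and from the
   latter out of range. *)
have opE : operation s Phi c (d + (ci%:Z, cj%:Z)) a =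
    if e && ((ci <= I)%N && (cj <= J)%N)
    then rho k n *: Phi false (I - ci)%N (J - cj)%N b else 0.
  case: ifP => [/andP[eT /andP[cI cJ]]|ne].
    rewrite dE /operation /=.
    have -> : (- I%:Z + ci%:Z <= 0) && (- J%:Z + cj%:Z <= 0) by clear -cI cJ; lia.
    have -> : absz (- I%:Z + ci%:Z) = (I - ci)%N by clear -cI; lia.
    have -> : absz (- J%:Z + cj%:Z) = (J - cj)%N by clear -cJ; lia.
    congr (_ *: Phi _ _ _ _); rewrite /level /tdeg /= -/n.
    by move: IJ; rewrite eT /=; clear -cij; lia.
  apply: (operation_zero s Phi_supp); rewrite dE /op_range /tdeg /= -/n.
  by move: IJ ne; case: (e) => /=; clear -cij; lia.
have sgN : (-1) ^+ odd c = - (-1) ^+ (~~ odd c) :> k.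
  by rewrite -signrN negbK.
rewrite {}opE; case: (e) => /=; set S := (if _ then Z _ _ _ _ else 0).
  set N := nabla _ _ _ _; set C := (if _ then w _ _ *: _ else 0) => Dx.
  have -> : DB (Phi true I J b) = - C + - (-1) ^+ (~~ odd c) *: (N + S).
    by rewrite scaleNr -Dx opprD !opprK addrCA addNr addr0.
  rewrite !addbT negbK sgN -addrA scalerDr; congr (_ + _).
    rewrite /C; case: ifP => _; last by rewrite !scaler0 oppr0 scaler0.
    by rewrite scalerN scaleNr !scalerA mulrC.
  by rewrite [_ *: (N + S)]scalerDr addrAC scaleNr addNr add0r scalerA mulrC.
set N := nabla _ _ _ _ => Dx.
by rewrite !addbF Dx sgN [_ *: (N + S)]scalerDr scaleNr addrAC subrr add0r scaler0 add0r scalerA mulrC.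
Qed.
End StructureEquation.

Section SumComparison.
Variables (k : fieldType) (H B : bicomplex k) (s : {linear H -> H}).
Variables (Phi : bool -> nat -> nat -> seq H -> B).
Variables (Psi : bool -> nat -> nat -> seq H -> H).

Lemma mor_sourceE d t ds a :
  mor_source (operation s Psi 2) (operation s Phi 1) d t ds a =
  insertion_sum s Phi 1 Psi d t ds a.
Proof.
rewrite /mor_source /insertion_sum; apply: eq_big_nat => l /andP[l2 ln].
apply: eq_big_nat => r /andP[_ rl]; apply: eq_bigr => p _ /=.
congr (_ *: _); rewrite !sgnE; congr (_ ^+ _).
move: (tdeg (t - _)) (tdeg (npair p)) (tdeg d) => t2 t1 t0.
rewrite !oddzD !oddzM !oddzD !oddz_nat !oddD (oddB (ltnW ln)) /=.
by case: (odd (r * _)); case: (odd l); case: (odd (size a)); case: (oddz t1);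
  case: (oddz t2); case: (oddz t0).
Qed.

Hypothesis Psi_supp : forall a i j,
  ((i + j + 2)%N != size a -> Psi false i j a = 0)
  /\ (~~ [&& (i + j + 2)%N == (size a).+1, (0 < i)%N & (0 < j)%N] ->
      Psi true i j a = 0).

Lemma mu_quadE d t ds a :
  mu_quad (operation s Psi 2) d t ds a = insertion_sum s Psi 2 Psi d t ds a.
Proof.
rewrite /mu_quad /insertion_sum; set n := size a.
have [n2|n2] := ltnP n 2; first by rewrite !big_geq // ltnW.
(* The extra summand l = n has an outer operation of arity 1, which is zero. *)
rewrite [RHS]big_nat_recr //= -[LHS]addr0; congr (_ + _); last first.
  apply/esym/big1_seq => r /andP[_]; rewrite mem_index_iota => /andP[_ rl].
  apply: big1 => p _; rewrite /insert (operation_zero s Psi_supp) ?scaler0 //.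
  rewrite size_cat /= size_take size_drop -/n /op_range.
  have -> : ((if (r < n)%N then r else n) + (n - (r + n)).+1 = 1)%N.
    by case: ifP; move: rl; clear; lia.
  by rewrite /tdeg; clear; lia.
apply: eq_big_nat => l /andP[l2 ln]; rewrite big_add1 /=.
apply: eq_big_nat => r /andP[_ rl]; apply: eq_bigr => p _ /=.
congr (_ *: _); rewrite !sgnE; congr (_ ^+ _).
move: (tdeg (t - _)) (tdeg (npair p)) (tdeg d) => t2 t1 t0.
rewrite !oddzD !oddzM !oddzD !oddz_nat !oddD !oddM /=.
by case: (odd r); case: (odd l); case: (odd n); case: (oddz t1);
  case: (oddz t2); case: (oddz t0).
Qed.
End SumComparison.

(** * Bidegrees of the tree coefficients *)

Section Homogeneity.
Variables (k : fieldType) (H : bicomplex k) (A : bidiff_algebra k).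
Variables (sA : {linear A -> A}) (f : {linear A -> H}) (g : {linear H -> A}).
Variables (k1 k2 h : {linear A -> A}).
Hypothesis sA_deg : forall d x, homog d x -> homog d (sA x).
Hypothesis f_deg : forall d x, homog d x -> homog d (f x).
Hypothesis g_deg : forall d x, homog d x -> homog d (g x).
Hypothesis k1_deg : forall d x, homog d x -> homog (d + (-1, 0)) (k1 x).
Hypothesis k2_deg : forall d x, homog d x -> homog (d + (0, -1)) (k2 x).
Hypothesis h_deg : forall d x, homog d x -> homog (d + (-1, -1)) (h x).
Local Notation mul := (@ba_mul k A).

(** Here s has bidegree (1, 0), t has (0, 1) and eps has (0, 0), which gives [khat] bidegree zero.
    This grading is separate from the parities, for which s and t are even. *)
Let coef_homog (X : bigraded k) (d : int * int) (x : coef X) : Prop :=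
  forall e i j, homog (d + (- i%:Z, - j%:Z)) (x e i j).

Let homog_if (X : bigraded k) d (c : bool) (x y : X) :
  (c -> homog d x) -> homog d y -> homog d (if c then x else y).
Proof. by case: c => // hx _; apply: hx. Qed.

Let dsum_homog (X : bigraded k) (d : int * int) n (F : nat -> nat -> X) :
  (forall i j, (i + j)%N = n -> homog d (F i j)) -> homog d (dsum F n).
Proof.
move=> hF; rewrite dsum_big; apply: homog_sum => i _; apply: hF.
by rewrite subnKC // -ltnS.
Qed.

Let cmul_homog (d1 d2 : int * int) x y : coef_homog d1 x -> coef_homog d2 y ->
  coef_homog (d1 + d2) (cmul mul sA x y).
Proof.
move=> hx hy e i j.
have conv_homog (u v : nat -> nat -> A) :
    (forall i j, homog (d1 + (- i%:Z, - j%:Z)) (u i j)) ->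
    (forall i j, homog (d2 + (- i%:Z, - j%:Z)) (v i j)) ->
    homog (d1 + d2 + (- i%:Z, - j%:Z)) (conv mul u v i j).
  move=> hu hv; apply: dsum_homog => i1 i2 ei; apply: dsum_homog => j1 j2 ej.
  have -> : d1 + d2 + (- i%:Z, - j%:Z)
      = d1 + (- i1%:Z, - j1%:Z) + (d2 + (- i2%:Z, - j2%:Z)).
    by rewrite addrACA -ei -ej; congr (_ + (_, _)) => /=; clear; lia.
  exact: ba_mul_deg.
rewrite /cmul; case: e; last exact: conv_homog.
by apply: homogD; apply: conv_homog => // *; apply: sA_deg.
Qed.

Let khat_homog (d : int * int) x : coef_homog d x -> coef_homog d (khat k1 k2 h x).
Proof.
move=> hx e i j; rewrite /khat !coefDE.
have shift_deg (a b : nat) (t : A -> A) e' : (forall d x, homog d x ->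
      homog (d + (- a%:Z, - b%:Z)) (t x)) -> (a <= i)%N && (b <= j)%N ->
    homog (d + (- i%:Z, - j%:Z)) (t (x e' (i - a)%N (j - b)%N)).
  move=> t_deg /andP[ai bj].
  have -> : (- i%:Z, - j%:Z) = (- (i - a)%N%:Z, - (j - b)%N%:Z)
      + (- a%:Z, - b%:Z).
    by congr (_, _) => /=; move: ai bj; clear; lia.
  by rewrite addrA; apply: t_deg; apply: hx.
apply: homogD; first apply: homogD.
- apply: homog_if => [ij|]; last exact: homog0.
  rewrite /odd_lift; case: e; first apply: homogN; exact: (@shift_deg 1%N 0%N).
- apply: homog_if => [ij|]; last exact: homog0.
  rewrite /odd_lift; case: e; first apply: homogN; exact: (@shift_deg 0%N 1%N).
rewrite /eps; case: e; last exact: homog0.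
apply: homog_if => [ij|]; last exact: homog0.
exact: (@shift_deg 1%N 1%N).
Qed.

Let C := @coef_const k H.

Let tree_forest_homog ds a : homogs ds a ->
  coef_homog (bideg ds) (ctree mul sA g k1 k2 h (map C a)) /\
  coef_homog (bideg ds) (cforest mul sA g k1 k2 h (map C a)).
Proof.
have mulBl y : zmod_morphism (mul^~ y).
  by move=> x z; rewrite -scaleN1r addrC ba_mul_linearl scaleN1r addrC.
have mulBr x : zmod_morphism (mul x).
  by move=> y z; rewrite -scaleN1r addrC ba_mul_linearr scaleN1r addrC.
have cB1 y := cmulBl mulBl (linearB sA) y.
have cB2 x : zmod_morphism (cmul mul sA x) by exact: cmulBr.
have sB := odd_liftB (linearB sA).
have treeE' b : ctree mul sA g k1 k2 h b
    = leaf (even_lift g) b + khat k1 k2 h (cforest mul sA g k1 k2 h b).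
  by apply: treeE => //; apply: khatB.
have [n] := ubnP (size a); elim: n ds a => // n IH ds a an hda.
suff hf : coef_homog (bideg ds) (cforest mul sA g k1 k2 h (map C a)).
  split=> // e i j; rewrite treeE' coefDE; apply: homogD; last exact: khat_homog.
  case: a ds hda {an hf} => [|x [|y a]] [|d ds] hda /=; try exact: homog0.
    by case: hda.
  have [hx hds] := (homogs_cons _ _ _ _).1 hda.
  rewrite (homogs_nil hds) /even_lift /C /coef_const bideg_cons bideg_nil addr0.
  case: and3P => [[_ /eqP-> /eqP->]|_]; last by rewrite raddf0; apply: homog0.
  by rewrite oppr0 addr0; apply: g_deg.
move=> e i j; rewrite /cforest /forest /star ssum_map ssum_big.
have sumE (I : Type) (r : seq I) (F : I -> coef A) :
    (\sum_(x <- r) F x) e i j = \sum_(x <- r) F x e i j.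
  by elim/big_rec2: _ => // x y z _ <-; rewrite coefDE.
rewrite sumE; apply: homog_sum => x _.
have -> : bideg ds = bideg (take x ds) + bideg (drop x ds).
  by rewrite -bideg_cat cat_take_drop.
have [x0|x0] := posnP x.
  rewrite x0 !take0 [map C [::]]/= tree_nil (zmod0 sB) (zmod0 (cB1 _)).
  exact: homog0.
have [xn|xn] := leqP (size a) x.
  by rewrite (drop_oversize xn) [map C [::]]/= tree_nil (zmod0 (cB2 _)); apply: homog0.
apply: cmul_homog => [e' i' j'|].
  have hu : coef_homog (bideg (take x ds)) (ctree mul sA g k1 k2 h (map C (take x a))).
    by apply: (IH _ _ _ (homogs_take x hda)).1; rewrite size_takel ?(leq_trans xn) // ltnW.
  by rewrite /odd_lift; case: e'; [apply: homogN|]; apply: sA_deg; apply: hu.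
apply: (IH _ _ _ (homogs_drop x hda)).1; rewrite size_drop.
by move: an x0 xn; clear; lia.
Qed.

Lemma tree_coef_homog e i j ds a : homogs ds a ->
  homog (bideg ds + (- i%:Z, - j%:Z)) (tree_coef mul sA g k1 k2 h e i j a).
Proof. by move/tree_forest_homog => [h1 _]; apply: h1. Qed.

Lemma stem_coef_homog e i j ds a : homogs ds a ->
  homog (bideg ds + (- i%:Z, - j%:Z)) (stem_coef mul sA g f k1 k2 h e i j a).
Proof. by move/tree_forest_homog => [_ h1]; apply/f_deg/h1. Qed.
End Homogeneity.

(** * Homotopy transfer *)

Section HomotopyTransfer.
Variables (k : fieldType) (A : bidiff_algebra k) (H : bicomplex k).
Variables (f : {linear A -> H}) (g : {linear H -> A}) (h : {linear A -> A}).
Hypothesis ctr : contraction f g h.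
Variables (s : {linear H -> H}) (sA : {linear A -> A}).
Hypothesis sE : forall d x, homog d x -> s x = sgn k (tdeg d) *: x.
Hypothesis sAE : forall d x, homog d x -> sA x = sgn k (tdeg d) *: x.
Local Notation mul := (@ba_mul k A).

Let k1 : {linear A -> A} := (delb A \o h) \- (h \o delb A).
Let k2 : {linear A -> A} := (h \o del A) \- (del A \o h).

Let f_deg : forall d x, homog d x -> homog d (f x).
Proof. by case: ctr => -[]. Qed.
Let g_deg : forall d x, homog d x -> homog d (g x).
Proof. by case: ctr => _ []. Qed.
Let h_deg : forall d x, homog d x -> homog (d + (-1, -1)) (h x).
Proof. by case: ctr. Qed.
Let k1_deg d x : homog d x -> homog (d + (-1, 0)) (k1 x).
Proof.
move=> hx; apply: homogD; last apply: homogN.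
  by have := delb_deg (h_deg hx); rewrite -addrA.
by have := h_deg (delb_deg hx); rewrite -addrA.
Qed.
Let k2_deg d x : homog d x -> homog (d + (0, -1)) (k2 x).
Proof.
move=> hx; apply: homogD; last apply: homogN.
  by have := h_deg (del_deg hx); rewrite -addrA.
by have := del_deg (h_deg hx); rewrite -addrA.
Qed.

Let g_s x : g (s x) = sA (g x).
Proof.
rewrite (parity_comm sE (c := 0) sAE) ?scale1r // => d y /g_deg.
by rewrite addr0.
Qed.
Let f_s x : f (sA x) = s (f x).
Proof.
rewrite (parity_comm sAE (c := 0) sE) ?scale1r // => d y /f_deg.
by rewrite addr0.
Qed.
Let h_s x : h (sA x) = sA (h x).
Proof. by rewrite (parity_comm sAE sAE h_deg) scale1r. Qed.
Let k1_s x : k1 (sA x) = - sA (k1 x).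
Proof. by rewrite (parity_comm sAE sAE k1_deg) scaleN1r. Qed.
Let k2_s x : k2 (sA x) = - sA (k2 x).
Proof. by rewrite (parity_comm sAE sAE k2_deg) scaleN1r. Qed.
Let d1_s x : del A (sA x) = - sA (del A x).
Proof. by rewrite (parity_comm sAE sAE (@del_deg _ A)) scaleN1r. Qed.
Let d2_s x : delb A (sA x) = - sA (delb A x).
Proof. by rewrite (parity_comm sAE sAE (@delb_deg _ A)) scaleN1r. Qed.

Let d1H_s x : s (del H x) = - del H (s x).
Proof. by rewrite (parity_comm sE sE (@del_deg _ H)) scaleN1r opprK. Qed.
Let d2H_s x : s (delb H x) = - delb H (s x).
Proof. by rewrite (parity_comm sE sE (@delb_deg _ H)) scaleN1r opprK. Qed.

Let mulDl y : linear (mul^~ y). Proof. exact: ba_mul_linearl. Qed.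
Let mulDr x : linear (mul x). Proof. exact: ba_mul_linearr. Qed.

Let bilinear_ext (F G : A -> A -> A) :
  (forall y, linear (F^~ y)) -> (forall x, linear (F x)) ->
  (forall y, linear (G^~ y)) -> (forall x, linear (G x)) ->
  (forall d e x y, homog d x -> homog e y -> F x y = G x y) ->
  forall x y, F x y = G x y.
Proof.
move=> Fl Fr Gl Gr e x y; move: x.
apply: (eq_homog (Fl y) (Gl y)) => d x hx; move: y.
by apply: (eq_homog (Fr x) (Gr x)) => d' y hy; apply: (e d d').
Qed.

Let sA_mul x y : sA (mul x y) = mul (sA x) (sA y).
Proof.
apply: (bilinear_ext (F := fun x y => sA (mul x y)) (G := fun x y => mul (sA x) (sA y))).
- by move=> y' c u v; rewrite mulDl linearP.
- by move=> x' c u v; rewrite mulDr linearP.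
- by move=> y' c u v; rewrite linearP mulDl.
- by move=> x' c u v; rewrite linearP mulDr.
move=> d e x' y' hx hy; rewrite (sAE (ba_mul_deg hx hy)) (sAE hx) (sAE hy).
have Z c u v : mul (c *: u) v = c *: mul u v.
  by have := mulDl v c u 0; rewrite !addr0 ba_mul0x addr0.
have mulx0 u : mul u 0 = 0.
  by have := mulDr u (-1) 0 0; rewrite scaler0 add0r scaleN1r addNr.
have Z' c u v : mul u (c *: v) = c *: mul u v.
  by have := mulDr u c v 0; rewrite !addr0 mulx0 addr0.
by rewrite Z Z' scalerA tdegD !sgnE oddzD signr_addb.
Qed.

Let derivation (D : {linear A -> A}) :
  (forall d x y, homog d x ->
     D (mul x y) = mul (D x) y + sgn k (tdeg d) *: mul x (D y)) ->
  forall x y, D (mul x y) = mul (D x) y + mul (sA x) (D y).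
Proof.
move=> DM x y; move: x.
apply: (@eq_homog k A A (fun x => D (mul x y)) (fun x => mul (D x) y + mul (sA x) (D y))).
- by move=> c u v; rewrite mulDl linearP.
- by move=> c u v; rewrite !linearP !mulDl scalerDr addrACA.
move=> d x hx; rewrite (DM d) // (sAE hx); congr (_ + _).
by have := mulDl (D y) (sgn k (tdeg d)) x 0; rewrite !addr0 ba_mul0x addr0.
Qed.

Let gf x : g (f x) - x = del A (delb A (h x)) - del A (h (delb A x))
  + delb A (h (del A x)) + h (del A (delb A x)).
Proof. by case: ctr => _ _ _ _ _ ->; rewrite gcomm_gcommE //; apply: linearP. Qed.

Let w1 (i j : nat) : k := j%:R.
Let w2 (i j : nat) : k := - i%:R.

Let d1_khat x : dhat (del A) 1 0 w1 (khat k1 k2 h x)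
  + khat k1 k2 h (dhat (del A) 1 0 w1 x)
  = shift 1 0 (even_lift g (even_lift f x) - x).
Proof.
rewrite dhat_khat => [|a b a' b']; last by rewrite /w1 natrD.
have -> : even_lift (fun y => del A (k1 y) + k1 (del A y)) x
    = even_lift g (even_lift f x) - x.
  apply: coefP => e i j; rewrite coefBE /even_lift gf /k1 /= raddfB /=.
  by rewrite delb_del [h (- _)]raddfN opprK addrA.
have -> : even_lift (fun y => del A (k2 y) + k2 (del A y)) x = 0.
  apply: coefP => e i j; rewrite coef0E /even_lift /k2 /= raddfB /= !del_del.
  by rewrite [h 0]raddf0 subr0 sub0r subrr.
rewrite (zmod0 (@shiftB k A _ _)) addr0 -[RHS]addr0; congr (_ + _).
(* The weight is 0 on s and 1 on t, and eps s t k2 cancels against eps s t (h del - del h). *)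
rewrite scale0r add0r scale1r shift_shift.
rewrite -[RHS](zmod0 (@epsB k A)); apply: coefP => -[] i j //.
rewrite /eps coefBE /shift /even_lift /odd_lift /k2 /=.
by case: ifP => _; rewrite ?subrr.
Qed.

Let d2_khat x : dhat (delb A) 0 1 w2 (khat k1 k2 h x)
  + khat k1 k2 h (dhat (delb A) 0 1 w2 x)
  = shift 0 1 (even_lift g (even_lift f x) - x).
Proof.
rewrite dhat_khat => [|a b a' b']; last by rewrite /w2 natrD opprD.
have -> : even_lift (fun y => delb A (k2 y) + k2 (delb A y)) x
    = even_lift g (even_lift f x) - x.
  apply: coefP => e i j; rewrite coefBE /even_lift gf /k2 /= raddfB /=.
  rewrite [delb A (del A (h _))]delb_del opprK addrACA addrC -!addrA.
  by [].
have -> : even_lift (fun y => delb A (k1 y) + k1 (delb A y)) x = 0.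
  apply: coefP => e i j; rewrite coef0E /even_lift /k1 /= raddfB /= !delb_delb.
  by rewrite [h 0]raddf0 subr0 sub0r addNr.
rewrite (zmod0 (@shiftB k A _ _)) add0r -[RHS]addr0; congr (_ + _).
(* The weight is -1 on s and 0 on t, and eps s t k1 cancels against eps s t (h delb - delb h). *)
rewrite /w2 oppr0 scale0r addr0 scaleN1r (zmodN (@shiftB k A _ _)) opprK shift_shift.
rewrite -[RHS](zmod0 (@epsB k A)); apply: coefP => -[] i j //.
rewrite /eps coefDE /shift /even_lift /odd_lift /k1 /=.
by case: ifP => _; rewrite ?addr0 // addrC subrKA subrr.
Qed.

Let Phi := tree_coef mul sA g k1 k2 h.
Let Psi := stem_coef mul sA g f k1 k2 h.

Let Phi_lin := tree_coef_linear mulDl mulDr sA_mul g_s k1_s k2_s h_s.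
Let Psi_lin := stem_coef_linear f mulDl mulDr sA_mul g_s k1_s k2_s h_s.
Let Phi_supp := tree_coef_supported sA g k1 k2 h mulDl mulDr.
Let Psi_supp := stem_coef_supported sA g f k1 k2 h mulDl mulDr.
Let Psi_parity := stem_coef_parity mulDl mulDr sA_mul g_s f_s k1_s k2_s h_s.

Definition transfer_mu : int * int -> seq H -> H := operation s Psi 2.
Definition transfer_mor : int * int -> seq H -> A := operation s Phi 1.

Lemma transfer_mu_zero d a : ~~ mu_range (size a) d -> transfer_mu d a = 0.
Proof. by rewrite mu_rangeE; apply: operation_zero. Qed.

Lemma transfer_mor_zero d a : ~~ mor_range (size a) d -> transfer_mor d a = 0.
Proof. by rewrite mor_rangeE; apply: operation_zero. Qed.

Let sK := parityK sE.
Let sAK := parityK sAE.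
Let mulA := @ba_mulA k A.

Let w1D a b a' b' : w1 (a + a')%N (b + b')%N = w1 a b + w1 a' b'.
Proof. exact: natrD. Qed.
Let w2D a b a' b' : w2 (a + a')%N (b + b')%N = w2 a b + w2 a' b'.
Proof. by rewrite /w2 natrD opprD. Qed.

Let g_d1 x : del A (g x) = g (del H x). Proof. by case: ctr => _ []. Qed.
Let g_d2 x : delb A (g x) = g (delb H x). Proof. by case: ctr => _ []. Qed.
Let f_d1 x : del H (f x) = f (del A x). Proof. by case: ctr => -[]. Qed.
Let f_d2 x : delb H (f x) = f (delb A x). Proof. by case: ctr => -[]. Qed.
Let d1_mul := derivation (@ba_del k A).
Let d2_mul := derivation (@ba_delb k A).

Let weight1 n m d : op_range n m d ->
  (- w1 (`|d.1| - 1)%N (`|d.2| - 0)%N) = (d.2)%:~R.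
Proof.
move=> hr; rewrite /w1 subn0 -[d.2 in RHS]opprK rmorphN /=; congr (- _).
rewrite pmulrn; congr (1 *~ _).
by move: hr; rewrite /op_range; clear; lia.
Qed.

Let weight2 n m d : op_range n m d ->
  (- w2 (`|d.1| - 0)%N (`|d.2| - 1)%N) = - (d.1)%:~R.
Proof.
move=> hr; rewrite /w2 opprK subn0 -[d.1 in RHS]opprK rmorphN opprK /=.
rewrite pmulrn; congr (1 *~ _).
by move: hr; rewrite /op_range; clear; lia.
Qed.

Let sA_deg d x : homog d x -> homog d (sA x).
Proof. exact: homog_parity. Qed.
Let Phi_deg e i j ds a : homogs ds a ->
  homog (bideg ds + (- i%:Z, - j%:Z)) (Phi e i j a).
Proof. exact: tree_coef_homog. Qed.
Let Psi_deg e i j ds a : homogs ds a ->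
  homog (bideg ds + (- i%:Z, - j%:Z)) (Psi e i j a).
Proof. exact: stem_coef_homog. Qed.

Let mu_insertion d ds a (ci cj : nat) :
  homogs ds a -> op_range 2 (size a) d -> (ci + cj)%N = 1%N ->
  mu_quad transfer_mu d (d + (ci%:Z, cj%:Z)) ds a =
  ((-1) ^+ (~~ odd 2 (+) level 2 (size a) d) * rho k (size a)) *:
  (if (ci <= `|d.1|)%N && (cj <= `|d.2|)%N
   then insert_coef (fun x => - s x) Psi Psi true (level 2 (size a) d)
          (`|d.1| - ci)%N (`|d.2| - cj)%N (chi s a) else 0).
Proof.
move=> hda hr cij; rewrite /transfer_mu (mu_quadE _ Psi_supp).
exact: (insertion_sumE sE Psi_lin Psi_supp Psi_lin Psi_supp Psi_parity hda hr cij).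
Qed.

Let mor_insertion d ds a (ci cj : nat) :
  homogs ds a -> op_range 1 (size a) d -> (ci + cj)%N = 1%N ->
  - mor_target (ba_mu (A := A)) transfer_mor d (d + (ci%:Z, cj%:Z)) ds a
  - mor_source transfer_mu transfer_mor d (d + (ci%:Z, cj%:Z)) ds a =
  ((-1) ^+ (~~ odd 1 (+) level 1 (size a) d) * rho k (size a)) *:
  (if (ci <= `|d.1|)%N && (cj <= `|d.2|)%N
   then insert_coef (fun x => - s x) Psi Phi false (level 1 (size a) d)
          (`|d.1| - ci)%N (`|d.2| - cj)%N (chi s a)
      - product_coef mul sA Phi (level 1 (size a) d)
          (`|d.1| - ci)%N (`|d.2| - cj)%N (chi s a) else 0).
Proof.
move=> hda hr cij.
rewrite /transfer_mu /transfer_mor mor_sourceE.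
rewrite (mor_targetE sE sAE Phi_lin Phi_deg Phi_supp hda hr cij).
rewrite (insertion_sumE sE Phi_lin Phi_supp Psi_lin Psi_supp Psi_parity hda hr cij).
rewrite /= signrN mulNr scaleNr opprK addrC -scalerBr; congr (_ *: _).
by case: ifP; rewrite // subrr.
Qed.

Lemma transfer_mu_del d ds a : homogs ds a -> mu_range (size a) d ->
  tcomm (del H) (del H) (tdeg d) (transfer_mu d) ds a =
  (d.2)%:~R *: transfer_mu (d + (1, 0)) a + mu_quad transfer_mu d (d + (1, 0)) ds a.
Proof.
rewrite mu_rangeE => hda hr; rewrite (mu_insertion (ci := 1) (cj := 0)) //.
rewrite -(weight1 hr); apply: (tcomm_structure sE Psi_lin Psi_supp (ci := 1) (cj := 0)) => //.
exact: (stem_coef_equation mulDl mulDr mulA sK sAK sA_mul g_s k1_s k2_s h_s w1D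
  d1_s g_d1 f_d1 d1_mul d1_khat).
Qed.

Lemma transfer_mu_delb d ds a : homogs ds a -> mu_range (size a) d ->
  tcomm (delb H) (delb H) (tdeg d) (transfer_mu d) ds a =
  - (d.1)%:~R *: transfer_mu (d + (0, 1)) a + mu_quad transfer_mu d (d + (0, 1)) ds a.
Proof.
rewrite mu_rangeE => hda hr; rewrite (mu_insertion (ci := 0) (cj := 1)) //.
rewrite -(weight2 hr); apply: (tcomm_structure sE Psi_lin Psi_supp (ci := 0) (cj := 1)) => //.
exact: (stem_coef_equation mulDl mulDr mulA sK sAK sA_mul g_s k1_s k2_s h_s w2D
  d2_s g_d2 f_d2 d2_mul d2_khat).
Qed.

Definition transfer_structure : ppAinf H :=
  PPAinf (operation_multilinear s 2 Psi_lin) (operation_bidegree sE 2 Psi_deg)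
    transfer_mu_zero transfer_mu_del transfer_mu_delb.

Let mor_term e i j b := insert_coef (fun x => - s x) Psi Phi false e i j b
  - product_coef mul sA Phi e i j b.

Lemma transfer_mor_del d ds a : homogs ds a -> mor_range (size a) d ->
  tcomm (del H) (del A) (tdeg d) (transfer_mor d) ds a =
  (d.2)%:~R *: transfer_mor (d + (1, 0)) a
    - mor_target (ba_ppAinf A) transfer_mor d (d + (1, 0)) ds a
    - mor_source transfer_structure transfer_mor d (d + (1, 0)) ds a.
Proof.
rewrite mor_rangeE -addrA => hda hr; rewrite (mor_insertion (ci := 1) (cj := 0)) //.
rewrite -(weight1 hr); apply: (tcomm_structure sE (Z := mor_term) Phi_lin Phi_supp (ci := 1) (cj := 0)) => //.
exact: (tree_coef_equation mulDl mulDr mulA sK sAK sA_mul g_s k1_s k2_s h_s w1D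
  d1_s g_d1 d1_mul d1_khat).
Qed.

Lemma transfer_mor_delb d ds a : homogs ds a -> mor_range (size a) d ->
  tcomm (delb H) (delb A) (tdeg d) (transfer_mor d) ds a =
  - (d.1)%:~R *: transfer_mor (d + (0, 1)) a
    - mor_target (ba_ppAinf A) transfer_mor d (d + (0, 1)) ds a
    - mor_source transfer_structure transfer_mor d (d + (0, 1)) ds a.
Proof.
rewrite mor_rangeE -addrA => hda hr; rewrite (mor_insertion (ci := 0) (cj := 1)) //.
rewrite -(weight2 hr); apply: (tcomm_structure sE (Z := mor_term) Phi_lin Phi_supp (ci := 0) (cj := 1)) => //.
exact: (tree_coef_equation mulDl mulDr mulA sK sAK sA_mul g_s k1_s k2_s h_s w2D
  d2_s g_d2 d2_mul d2_khat).
Qed.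

Definition transfer_morphism : ppinf_mor transfer_structure (ba_ppAinf A) :=
  PPInfMor (operation_multilinear s 1 Phi_lin) (operation_bidegree sE 1 Phi_deg)
    transfer_mor_zero transfer_mor_del transfer_mor_delb.

Lemma transfer_morphism1 x : transfer_morphism (0, 0) [:: x] = g x.
Proof.
rewrite /= /transfer_mor /operation /= /rho /= bin_small // expr0 scale1r.
exact: tree_coef1 mulDl mulDr _.
Qed.
End HomotopyTransfer.

Theorem theorem3 (k : fieldType) (k_char0 : [pchar k]%R =i pred0)
    (A : bidiff_algebra k) :
  exists (H : bicomplex k) (f : A -> H) (g : H -> A) (h : A -> A),
    [/\ minimal H, contraction f g h
      & exists (muH : ppAinf H) (F : ppinf_mor muH (ba_ppAinf A)),
          ppinf_weq F].
Proof.
have [H [f [g [h [minH ctr]]]]] := minimal_contraction A.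
exists H, f, g, h; split=> //.
case: (ctr) => -[fl _ _ _] [gl _ _ _] hl _ _ _.
pose fL : {linear A -> H} := HB.pack f (GRing.isLinear.Build k A H *:%R f fl).
pose gL : {linear H -> A} := HB.pack g (GRing.isLinear.Build k H A *:%R g gl).
pose hL : {linear A -> A} := HB.pack h (GRing.isLinear.Build k A A *:%R h hl).
have [s sE] := parity_operator H; have [sA sAE] := parity_operator A.
have ctrL : contraction fL gL hL := ctr.
exists (transfer_structure ctrL sE sAE), (transfer_morphism ctrL sE sAE).
rewrite /ppinf_weq.
(* On a single entry the only tree is the leaf, and the sign [rho] is 1 in arity 1. *)
have -> : (fun x : H => transfer_morphism ctrL sE sAE (0, 0) [:: x]) = g.
  by apply: funext => x; apply: transfer_morphism1.
exact: contraction_weq ctr.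
Qed.
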